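(* Let $a\ge 1$, $b$, $k$ be integers with $1\le k\le b$, let $\mathrm{h}=(a,1^b)$ and $\mathrm{h}(k)=(a+k,1^{b-k})$, and let $r=a+b$. If $n\ge b+1$, then $$\mathrm{Ext}^k_{S(n,r)}(\Delta(\mathrm{h}),\Delta(\mathrm{h}(k)))\cong\mathbb{Z}_{d_k},\qquad d_k=\gcd\left(\tbinom{a+b}{1},\tbinom{a+b}{2},\dots,\tbinom{a+b}{k}\right).$$
   Context: $S(n,r)=S_{\mathbb{Z}}(n,r)$ denotes the integral Schur algebra; its modules are the homogeneous polynomial representations of $GL_n(\mathbb{Z})$ of degree $r$. For a partition $\lambda$ of $r$ with at most $n$ parts, $\Delta(\lambda)$ is the (integral) Weyl module of $S(n,r)$ of highest weight $\lambda$. With $F=\mathbb{Z}^n$, $D_a=D_aF$ the divided power and $\wedge^b=\wedge^bF$ the exterior power, one has $\Delta((a))=D_a$, $\Delta((1^b))=\wedge^b$, and for a hook $(a,1^b)$ with $b\ge1$, $\Delta(a,1^b)$ is the cokernel of the composite $D_{a+1}\otimes\wedge^{b-1}\to D_a\otimes D_1\otimes\wedge^{b-1}\to D_a\otimes\wedge^b$ of comultiplication (on the first factor) and multiplication (of $D_1=\wedge^1$ with $\wedge^{b-1}$). $\mathbb{Z}_m=\mathbb{Z}/m\mathbb{Z}$ (so $\mathbb{Z}_1=0$). All tensor products are over $\mathbb{Z}$. *)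

(* Defs.v *)
From HB Require Import structures.
From mathcomp Require Import all_boot all_order all_fingroup all_algebra.
From mathcomp Require Import generic_quotient ring_quotient boolp functions.
From mathcomp Require Import ring.

Set Implicit Arguments.
Unset Strict Implicit.
Unset Printing Implicit Defensive.

Import GRing.Theory.
Local Open Scope ring_scope.
Local Open Scope quotient_scope.

Section QuotientModule.
Variables (R : pzRingType) (V : lmodType R) (U : submodClosed V).

(* A [submodClosed] over a ring is closed under opposites, but the hierarchy
   does not make it a [zmodClosed]. *)
Definition submod_mem : {pred V} := fun x => x \in U.
Fact submod_mem_zmod_closed : zmod_closed submod_mem.
Proof. exact: GRing.subsemimod_closedB (GRing.subsemimodClosedP U). Qed.
HB.instance Definition _ :=
  GRing.isZmodClosed.Build V submod_mem submod_mem_zmod_closed.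

Definition quotmod := @Quotient.quot V submod_mem.

HB.instance Definition _ : EqQuotient V (Quotient.equiv submod_mem) quotmod :=
  EqQuotient.on quotmod.
HB.instance Definition _ := Choice.on quotmod.
HB.instance Definition _ :
    ZmodQuotient V (Quotient.equiv submod_mem) 0 -%R +%R quotmod :=
  ZmodQuotient.on quotmod.

Definition quot_proj : V -> quotmod := \pi_quotmod.

Lemma quot_projP (x y : V) : (quot_proj x == quot_proj y) = (x - y \in U).
Proof. by rewrite -Quotient.idealrBE. Qed.

Lemma quot_reprK (x : quotmod) : quot_proj (repr x) = x.
Proof. exact: reprK. Qed.

Let scaleq (a : R) : quotmod -> quotmod := fun x => quot_proj (a *: repr x).

Let projD x y : quot_proj (x + y) = quot_proj x + quot_proj y.
Proof. exact: (raddfD \pi_quotmod). Qed.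

Let proj_scale a (x : V) : quot_proj (a *: x) = scaleq a (quot_proj x).
Proof.
by apply/eqP; rewrite quot_projP -scalerBr rpredZ // -quot_projP quot_reprK.
Qed.

Let scaleqA a b x : scaleq a (scaleq b x) = scaleq (a * b) x.
Proof. by rewrite -[x]quot_reprK -!proj_scale scalerA. Qed.

Let scaleq1 : left_id 1 scaleq.
Proof. by move=> x; rewrite -[x]quot_reprK -proj_scale scale1r. Qed.

Let scaleqDr : right_distributive scaleq +%R.
Proof.
move=> a x y; rewrite -[x]quot_reprK -[y]quot_reprK -projD -!proj_scale.
by rewrite scalerDr projD.
Qed.

Let scaleqDl x : {morph scaleq^~ x : a b / a + b}.
Proof.
by move=> a b; rewrite -[x]quot_reprK -!proj_scale scalerDl projD.
Qed.

HB.instance Definition _ := GRing.Zmodule_isLmodule.Build R quotmod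
  scaleqA scaleq1 scaleqDr scaleqDl.

Fact quot_proj_is_linear : linear quot_proj.
Proof. by move=> a x y; rewrite projD proj_scale. Qed.
HB.instance Definition _ :=
  GRing.isLinear.Build R V quotmod *:%R quot_proj quot_proj_is_linear.

End QuotientModule.
Arguments quotmod {R} V U.

Section QuotientMap.
Variables (R : pzRingType) (V W : lmodType R).
Variables (U : submodClosed V) (X : submodClosed W) (f : {linear V -> W}).

Definition quot_map of (forall u, u \in U -> f u \in X) :
    quotmod V U -> quotmod W X :=
  fun x => quot_proj X (f (repr x)).

Hypothesis fUX : forall u, u \in U -> f u \in X.

Lemma quot_mapE x : quot_map fUX (quot_proj U x) = quot_proj X (f x).
Proof.
by apply/eqP; rewrite quot_projP -raddfB fUX // -quot_projP quot_reprK.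
Qed.

Fact quot_map_is_linear : linear (quot_map fUX).
Proof.
move=> a x y; rewrite -[x]quot_reprK -[y]quot_reprK.
by rewrite -linearP !quot_mapE !linearP.
Qed.
HB.instance Definition _ :=
  GRing.isLinear.Build R (quotmod V U) (quotmod W X) *:%R (quot_map fUX)
    quot_map_is_linear.

End QuotientMap.

Definition projective (R : pzRingType) (P : lmodType R) : Prop :=
  forall (V W : lmodType R) (g : {linear V -> W}) (f : {linear P -> W}),
    (forall w, exists v, g v = w) ->
    exists h : {linear P -> V}, forall x, g (h x) = f x.

Record proj_resolution (R : pzRingType) (M : lmodType R) := ProjResolution {
  res_mod :> nat -> lmodType R;
  res_d : forall i, {linear res_mod i.+1 -> res_mod i};
  res_aug : {linear res_mod 0 -> M};
  res_proj : forall i, projective (res_mod i);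
  res_aug_surj : forall m, exists x, res_aug x = m;
  res_exact0 : forall x, res_aug x = 0 <-> exists y, res_d 0 y = x;
  res_exact : forall i x, res_d i x = 0 <-> exists y, res_d i.+1 y = x
}.

Section Ext.
Variables (R : pzRingType) (M : lmodType R) (P : proj_resolution M).
Variables (N : lmodType R) (k : nat).

Definition cocycles : {pred (P k -> N)} :=
  fun f => `[< linear f /\ forall x, f (res_d P k x) = 0 >].

Fact cocycles_zmod_closed : zmod_closed cocycles.
Proof.
split=> [|f g /asboolP[fl fd] /asboolP[gl gd]]; apply/asboolP; split => //.
- by move=> a x y /=; rewrite scaler0 addr0.
- move=> a x y; rewrite [LHS]/= -[(f - g) x]/(f x - g x) -[(f - g) y]/(f y - g y).
  rewrite -[LHS]/(f (a *: x + y) - g (a *: x + y)) fl gl scalerBr.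
  by rewrite opprD addrACA.
- by move=> x; rewrite -[LHS]/(f _ - g _) fd gd subrr.
Qed.
HB.instance Definition _ :=
  GRing.isZmodClosed.Build (P k -> N) cocycles cocycles_zmod_closed.

Record cocycle := Cocycle { cocycle_fun : P k -> N; _ : cocycle_fun \in cocycles }.
HB.instance Definition _ := [isSub for cocycle_fun].
HB.instance Definition _ := [Choice of cocycle by <:].
HB.instance Definition _ := [SubChoice_isSubZmodule of cocycle by <:].

End Ext.

Section ExtGroup.
Variables (R : pzRingType) (M : lmodType R) (P : proj_resolution M).
Variable (N : lmodType R).

Definition coboundaries (k : nat) : {pred cocycle P N k} :=
  match k with
  | 0 => fun f => f == 0
  | j.+1 => fun f => `[< exists g : {linear P j -> N},
                         forall x, cocycle_fun f x = g (res_d P j x) >]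
  end.

Fact coboundaries_zmod_closed k : zmod_closed (@coboundaries k).
Proof.
case: k => [|k]; split => /=.
- by rewrite unfold_in /=.
- by move=> f g; rewrite !unfold_in /= => /eqP-> /eqP->; rewrite subr0.
- by apply/asboolP; exists \0.
- move=> f g /asboolP[f' Ef] /asboolP[g' Eg]; apply/asboolP.
  exists (f' \- g') => x /=; rewrite -Ef -Eg.
  by [].
Qed.
HB.instance Definition _ k :=
  GRing.isZmodClosed.Build (cocycle P N k) (@coboundaries k)
    (@coboundaries_zmod_closed k).

(* H^k(Hom_R(P, N)), that is Ext^k_R(M, N) computed from the resolution P. *)
Definition ext (k : nat) := @Quotient.quot (cocycle P N k) (@coboundaries k).

HB.instance Definition _ k := GRing.Zmodule.on (ext k).

End ExtGroup.

Definition zmod_iso (A B : zmodType) : Prop :=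
  exists f : {additive A -> B}, bijective f.

(* Z/mZ; ['Z_m] would be Z/2Z for m = 1. *)
Definition Zmod (m : nat) := @Quotient.quot int (dvdz m : {pred int}).
HB.instance Definition _ m := GRing.Zmodule.on (Zmod m).

Section SchurAlgebra.
Variables n r : nat.

(* Indices of the basis e_{i_1} (x) ... (x) e_{i_r} of F^{(x) r}, F = Z^n. *)
Definition mindex := {ffun 'I_r -> 'I_n}.

(* F^{(x) r}, as column vectors of coordinates in this basis. *)
Definition tensor := 'cV[int]_#|{: mindex}|.
HB.instance Definition _ := GRing.Zmodule.on tensor.

Definition tcoef (t : tensor) (i : mindex) : int := t (enum_rank i) 0.

Lemma tcoefP (t u : tensor) : tcoef t =1 tcoef u -> t = u.
Proof.
move=> tu; apply/matrixP => i j; rewrite (ord1 j) -(enum_valK i).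
exact: tu.
Qed.

(* Place permutation: the coordinate of s.t at i is that of t at i \o s. *)
Definition place_mx (s : 'S_r) : 'M[int]_#|{: mindex}| :=
  \matrix_(i, j) ((enum_val j : mindex) == [ffun p => (enum_val i : mindex) (s p)])%:R.

Lemma place_mxE s (t : tensor) i :
  tcoef (place_mx s *m t) i = tcoef t [ffun p => i (s p)].
Proof.
rewrite /tcoef mxE (bigD1 (enum_rank [ffun p => i (s p)])) //= big1.
  by rewrite addr0 mxE !enum_rankK eqxx mul1r.
move=> j; rewrite mxE enum_rankK -(inj_eq enum_val_inj) enum_rankK => /negbTE->.
by rewrite mul0r.
Qed.

(* S(n,r) = End_{Z S_r}(F^{(x) r}) *)
Definition schur_pred : {pred 'M[int]_#|{: mindex}|} :=
  fun A => [forall s : 'S_r, comm_mxb A (place_mx s)].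

Lemma schurP A : reflect (forall s, A *m place_mx s = place_mx s *m A) (schur_pred A).
Proof. exact: 'forall_eqP. Qed.

Fact schur_subring_closed : subring_closed schur_pred.
Proof.
split.
- by apply/schurP => s; rewrite -[1]/(1%:M) mul1mx mulmx1.
- move=> A B /schurP sA /schurP sB; apply/schurP => s.
  by rewrite mulmxBl mulmxBr sA sB.
- move=> A B /schurP sA /schurP sB; apply/schurP => s.
  by rewrite -[A * B]/(A *m B) -mulmxA sB mulmxA sA mulmxA.
Qed.
HB.instance Definition _ :=
  GRing.isSubringClosed.Build _ schur_pred schur_subring_closed.

Record schur := Schur { schur_mx :> 'M[int]_#|{: mindex}|;
                        _ : schur_mx \in schur_pred }.
HB.instance Definition _ := [isSub for schur_mx].
HB.instance Definition _ := [Choice of schur by <:].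
HB.instance Definition _ := GRing.SubChoice_isSubPzRing.Build _ _ schur
  schur_subring_closed.

Lemma schur_comm (A : schur) s : A *m place_mx s = place_mx s *m A.
Proof. by case: A => A /= /schurP. Qed.

Let tscale (A : schur) (t : tensor) : tensor := schur_mx A *m t.

Fact tscaleA A B t : tscale A (tscale B t) = tscale (A * B) t.
Proof. exact: mulmxA. Qed.
Fact tscale1 : left_id 1 tscale.
Proof. exact: mul1mx. Qed.
Fact tscaleDr : right_distributive tscale +%R.
Proof. by move=> A t u; apply: mulmxDr. Qed.
Fact tscaleDl t : {morph tscale^~ t : A B / A + B}.
Proof. by move=> A B; apply: mulmxDl. Qed.
HB.instance Definition _ := GRing.Zmodule_isLmodule.Build schur tensor
  tscaleA tscale1 tscaleDr tscaleDl.

Definition pure (v : 'I_r -> 'cV[int]_n) : tensor :=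
  \col_i \prod_p v p ((enum_val i : mindex) p) 0.

Lemma pureE v i : tcoef (pure v) i = \prod_p v p (i p) 0.
Proof. by rewrite /tcoef mxE enum_rankK. Qed.

(* Tensors symmetric in the first a places: D_a F (x) F^{(x) (r - a)}, the
   divided power D_a F of the free module F being the module of symmetric
   tensors of degree a. *)
Definition sym (a : nat) : {pred tensor} :=
  fun t => [forall s : 'S_r,
    perm_on [set p : 'I_r | (p < a)%N] s ==> (place_mx s *m t == t)].

Lemma symP a t :
  reflect (forall s : 'S_r, perm_on [set p : 'I_r | (p < a)%N] s ->
             place_mx s *m t = t) (sym a t).
Proof.
by apply: (iffP 'forall_implyP) => H s Hs; apply/eqP/H.
Qed.

Fact sym_submod_closed a : submod_closed (sym a).
Proof.
split; first by apply/symP => s _; rewrite mulmx0.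
move=> A t u /symP st /symP su; apply/symP => s Hs.
rewrite -[A *: t]/(schur_mx A *m t) mulmxDr (su s Hs); congr (_ + _).
by rewrite mulmxA -schur_comm -mulmxA st.
Qed.
HB.instance Definition _ a :=
  GRing.isSubmodClosed.Build schur tensor (sym a) (sym_submod_closed a).

Record sym_tensor a := SymTensor { sym_val : tensor; _ : sym_val \in sym a }.
HB.instance Definition _ a := [isSub for @sym_val a].
HB.instance Definition _ a := [Choice of sym_tensor a by <:].
HB.instance Definition _ a := [SubChoice_isSubLmodule of sym_tensor a by <:].

(* The kernel of F^{(x) r} -> F^{(x) c} (x) /\^{r - c} F: the Z-span of the pure
   tensors with equal factors at two distinct places p, q >= c. *)
Definition alt (c : nat) (t : tensor) : Prop :=
  exists2 s : seq (int * ('I_r -> 'cV[int]_n)),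
    forall x, x \in s -> exists p q : 'I_r, (c <= p < q)%N /\ x.2 p = x.2 q
    & t = \sum_(x <- s) pure x.2 *~ x.1.

Lemma altD c t u : alt c t -> alt c u -> alt c (t + u).
Proof.
move=> [s Hs ->] [s' Hs' ->]; exists (s ++ s'); last by rewrite big_cat.
by move=> x; rewrite mem_cat => /orP[/Hs|/Hs'].
Qed.

Lemma alt0 c : alt c 0.
Proof. by exists [::]; rewrite ?big_nil. Qed.

Lemma alt_pure c v (p q : 'I_r) z : (c <= p < q)%N -> v p = v q -> alt c (pure v *~ z).
Proof.
move=> cpq vpq; exists [:: (z, v)]; last by rewrite big_seq1.
by move=> x; rewrite mem_seq1 => /eqP->; exists p, q.
Qed.

Lemma altMz c t z : alt c t -> alt c (t *~ z).
Proof.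
move=> [s Hs ->]; exists [seq (x.1 * z, x.2) | x <- s].
  by move=> _ /mapP[x /Hs xs ->].
by rewrite big_map mulrz_suml; apply: eq_bigr => x _; rewrite mulrzA.
Qed.

Lemma alt_sum c (I : Type) (l : seq I) (Q : pred I) (E : I -> tensor) :
  (forall i, Q i -> alt c (E i)) -> alt c (\sum_(i <- l | Q i) E i).
Proof. by move=> H; elim/big_ind: _ => //; [apply: alt0 | apply: altD]. Qed.

Lemma tcoefD t u i : tcoef (t + u) i = tcoef t i + tcoef u i.
Proof. by rewrite /tcoef mxE. Qed.
Lemma tcoefN t i : tcoef (- t) i = - tcoef t i.
Proof. by rewrite /tcoef mxE. Qed.
Lemma tcoef0 i : tcoef 0 i = 0.
Proof. by rewrite /tcoef mxE. Qed.
Lemma tcoefMz t z i : tcoef (t *~ z) i = tcoef t i * z.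
Proof.
have tB x y : tcoef (x - y) i = tcoef x i - tcoef y i by rewrite tcoefD tcoefN.
elim/int_rec: z => [|m IH|m IH]; first by rewrite !mulr0z tcoef0 mulr0.
- by rewrite -addn1 PoszD !mulrzDr tcoefD IH mulrDr !mulr1z mulr1.
- by rewrite -addn1 PoszD opprD !mulrzDr tcoefD IH mulrDr !mulrN1z tcoefN mulrN1.
Qed.

Definition tbasis (i : mindex) : tensor := pure (fun p => delta_mx (i p) 0).

Lemma tbasisE i j : tcoef (tbasis i) j = (j == i)%:R.
Proof.
rewrite pureE; case: eqP => [->|/eqP ji].
  by rewrite big1 // => p _; rewrite mxE !eqxx.
have [p jp] : exists p, j p != i p.
  apply/existsP; rewrite -negb_forall; apply: contra ji => /forallP H.
  by apply/eqP/ffunP => p; apply/eqP.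
by rewrite (bigD1 p) //= mxE (negbTE jp) mul0r.
Qed.

Lemma tensor_basis t : t = \sum_i tbasis i *~ tcoef t i.
Proof.
apply: tcoefP => j.
rewrite (big_morph (tcoef^~ j) (fun x y => tcoefD x y j) (tcoef0 j)).
rewrite (bigD1 j) //= tcoefMz tbasisE eqxx mul1r big1 ?addr0 // => i ij.
by rewrite tcoefMz tbasisE eq_sym (negbTE ij) mul0r.
Qed.

Lemma alt_swap c (p q : 'I_r) (t : tensor) : (c <= p < q)%N ->
  place_mx (tperm p q) *m t = t -> alt c t.
Proof.
move=> cpq st; have pq : p != q by case/andP: cpq => _; rewrite neq_ltn => ->.
pose sw (i : mindex) : mindex := [ffun k => i (tperm p q k)].
have swK : involutive sw by move=> i; apply/ffunP => k; rewrite !ffunE tpermK.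
have swt i : tcoef t (sw i) = tcoef t i by rewrite -[in RHS]st place_mxE.
rewrite (tensor_basis t) (bigID (fun i : mindex => i p == i q)) /=.
apply: altD.
  apply: alt_sum => i /eqP ipq; apply: (alt_pure _ cpq).
  by rewrite ipq.
rewrite (bigID (fun i : mindex => (i p < i q)%N)) /=.
rewrite [X in _ + X](reindex_inj (inv_inj swK)) /=.
rewrite [X in _ + X](eq_bigl (fun i : mindex => (i p != i q) && (i p < i q)%N)); last first.
  move=> i; rewrite !ffunE tpermL tpermR eq_sym -leqNgt.
  by rewrite (ltn_neqAle (i p)) -val_eqE andbA andbb.
rewrite -big_split /=; apply: alt_sum => i _; rewrite swt -mulrzDl.
apply: altMz.
pose x : 'cV[int]_n := delta_mx (i p) 0; pose y : 'cV[int]_n := delta_mx (i q) 0.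
pose w u (k : 'I_r) : 'cV[int]_n :=
  if (k == p) || (k == q) then u else delta_mx (i k) 0.
have wpq u : w u p = w u q by rewrite /w !eqxx orbT.
have -> : tbasis i + tbasis (sw i) =
    pure (w (x + y)) *~ 1 + (pure (w x) *~ -1 + pure (w y) *~ -1).
  apply: tcoefP => j; rewrite !tcoefD !tcoefMz !pureE.
  pose rest := \prod_(k | (k != p) && (k != q)) (delta_mx (i k) 0 : 'cV[int]_n) (j k) 0.
  have E v : (forall k, k != p -> k != q -> v k = delta_mx (i k) 0) ->
      \prod_k (v k : 'cV[int]_n) (j k) 0 = v p (j p) 0 * v q (j q) 0 * rest.
    move=> Hv; rewrite (bigD1 p) //= (bigD1 q) 1?eq_sym //= mulrA; congr (_ * _).
    by apply: eq_bigr => k /andP[kp kq]; rewrite Hv.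
  have Ew u : \prod_k (w u k) (j k) 0 = u (j p) 0 * u (j q) 0 * rest.
    rewrite E /w ?eqxx ?orbT // => k kp kq.
    by rewrite (negbTE kp) (negbTE kq).
  rewrite !Ew !E //; last first.
    by move=> k kp kq; rewrite ffunE tpermD // eq_sym.
  rewrite !ffunE tpermL tpermR -/x -/y [(x + y) _ _]mxE [(x + y) (j q) 0]mxE.
  ring.
apply: altD; first exact: alt_pure cpq (wpq _).
by apply: altD; apply: alt_pure cpq (wpq _).
Qed.

Lemma place_pure (v : 'I_r -> 'cV[int]_n) p q : v p = v q ->
  place_mx (tperm p q) *m pure v = pure v.
Proof.
move=> vpq; apply: tcoefP => i; rewrite place_mxE !pureE.
rewrite [LHS](reindex_inj (@perm_inj _ (tperm p q))) /=; apply: eq_bigr => k _.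
rewrite ffunE tpermK; case: tpermP => [->|->|//]; by rewrite vpq.
Qed.

Lemma alt_scale c (A : schur) t : alt c t -> alt c (A *: t).
Proof.
move=> [s Hs ->]; rewrite scaler_sumr big_seq; apply: alt_sum => x /Hs.
move=> [p [q [cpq vpq]]]; apply: (alt_swap cpq).
rewrite -[A *: _]/(schur_mx A *m _) mulmxA -schur_comm -mulmxA; congr (_ *m _).
have -> : place_mx (tperm p q) *m (pure x.2 *~ x.1) =
    (place_mx (tperm p q) *m pure x.2 : tensor) *~ x.1.
  exact: (raddfMz (mulmx (place_mx (tperm p q)))).
by rewrite place_pure.
Qed.

Definition sym_alt (a c : nat) : {pred sym_tensor a} :=
  fun t => `[< alt c (sym_val t) >].
Arguments sym_alt : clear implicits.

Fact sym_alt_submod_closed a c : submod_closed (sym_alt a c).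
Proof.
split; first by apply/asboolP/alt0.
move=> A t u /asboolP ct /asboolP cu; apply/asboolP.
exact: altD (alt_scale A ct) cu.
Qed.
HB.instance Definition _ a c :=
  GRing.isSubmodClosed.Build schur (sym_tensor a) (sym_alt a c)
    (sym_alt_submod_closed a c).

(* D_a F (x) F^{(x) (c - a)} (x) /\^{r - c} F, for a <= c <= r. The Z-module
   F^{(x) r} / alt c being free, the tensors of alt c that are symmetric in the
   first a places form D_a F (x) (F^{(x) (c - a)} (x) J), where J is the kernel of
   F^{(x) (r - c)} -> /\^{r - c} F. *)
Definition DTE (a c : nat) := quotmod (sym_tensor a) (sym_alt a c).
HB.instance Definition _ a c := GRing.Lmodule.on (DTE a c).

Section Maps.
Variable a : nat.

Lemma sym_le (t : sym_tensor a.+1) : sym_val t \in sym a.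
Proof.
case: t => t /= /symP st; apply/symP => s sa; apply: st.
by apply: subset_trans sa _; apply/subsetP => p; rewrite !inE => /ltnW.
Qed.

Definition sym_incl (t : sym_tensor a.+1) : sym_tensor a := SymTensor (sym_le t).

Fact sym_incl_is_linear : linear sym_incl.
Proof. by move=> A t u; apply: val_inj. Qed.
HB.instance Definition _ :=
  GRing.isLinear.Build schur (sym_tensor a.+1) (sym_tensor a) *:%R sym_incl
    sym_incl_is_linear.

Fact sym_incl_alt t : t \in sym_alt a.+1 a.+1 -> sym_incl t \in sym_alt a a.+1.
Proof. by []. Qed.

(* D_{a+1} (x) /\^{b-1} -> D_a (x) D_1 (x) /\^{b-1}, a + b = r: in terms of
   symmetric tensors, the comultiplication D_{a+1} -> D_a (x) D_1 is the
   inclusion. *)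
Definition comult : {linear DTE a.+1 a.+1 -> DTE a a.+1} :=
  quot_map sym_incl_alt.

Fact alt_le (t : sym_tensor a) : t \in sym_alt a a.+1 -> idfun t \in sym_alt a a.
Proof.
move=> /asboolP[s Hs Et]; apply/asboolP; exists s => // x /Hs[p [q [cpq E]]].
by exists p, q; split=> //; case/andP: cpq => /ltnW-> ->.
Qed.

(* D_a (x) D_1 (x) /\^{b-1} -> D_a (x) /\^b, a + b = r: the multiplication
   D_1 (x) /\^{b-1} -> /\^b is induced by the identity of F^{(x) b}. *)
Definition mult : {linear DTE a a.+1 -> DTE a a} := quot_map alt_le.

(* The image of the composite of the two maps when b = r - a >= 1. When b = 0 (a
   row) the Weyl module is D_r itself. *)
Definition hook_rel : {pred DTE a a} :=
  fun x => if (a < r)%N then `[< exists y, mult (comult y) = x >] else x == 0.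

Fact hook_rel_submod_closed : submod_closed hook_rel.
Proof.
split; first rewrite unfold_in; last move=> A x y; rewrite ?unfold_in /hook_rel;
  case: ifP => _ //.
- by apply/asboolP; exists 0; rewrite !linear0.
- move=> /asboolP[x' <-] /asboolP[y' <-].
  by apply/asboolP; exists (A *: x' + y'); rewrite !linearP.
- by move=> /eqP-> /eqP->; rewrite scaler0 addr0.
Qed.
HB.instance Definition _ :=
  GRing.isSubmodClosed.Build schur (DTE a a) hook_rel hook_rel_submod_closed.

(* Delta(a, 1^(r - a)), for 1 <= a <= r. *)
Definition hook_weyl := quotmod (DTE a a) hook_rel.
HB.instance Definition _ := GRing.Lmodule.on hook_weyl.

End Maps.

End SchurAlgebra.

Section FreeModule.
Variables (R : pzRingType) (X : choiceType).

Definition finsupp : {pred (X -> R^o)} :=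
  fun f => `[< exists s : seq X, forall x, x \notin s -> f x = 0 >].

Fact finsupp_submod_closed : submod_closed finsupp.
Proof.
split; first by apply/asboolP; exists [::].
move=> a f g /asboolP[s Hs] /asboolP[t Ht]; apply/asboolP; exists (s ++ t) => x.
rewrite mem_cat negb_or => /andP[xs xt].
by rewrite -[LHS]/(a *: f x + g x) Hs // Ht // scaler0 addr0.
Qed.
HB.instance Definition _ :=
  GRing.isSubmodClosed.Build R (X -> R^o) finsupp finsupp_submod_closed.

Record free_module := FreeModule { free_fun : X -> R^o; _ : free_fun \in finsupp }.
HB.instance Definition _ := [isSub for free_fun].
HB.instance Definition _ := [Choice of free_module by <:].
HB.instance Definition _ := [SubChoice_isSubLmodule of free_module by <:].

Variables (V : lmodType R) (phi : X -> V).

Lemma free_supp_ex (f : free_module) :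
  exists s : seq X, forall x, x \notin s -> free_fun f x = 0.
Proof. by case: f => f /= /asboolP. Qed.

Definition free_supp f := undup (projT1 (cid (free_supp_ex f))).

Definition free_lift (f : free_module) : V :=
  \sum_(x <- free_supp f) (free_fun f x : R) *: phi x.

Lemma free_liftE (f : free_module) (s : seq X) : uniq s ->
  (forall x, x \notin s -> free_fun f x = 0) ->
  free_lift f = \sum_(x <- s) (free_fun f x : R) *: phi x.
Proof.
move=> us Hs; rewrite /free_lift.
have Ht x : x \notin free_supp f -> free_fun f x = 0.
  by rewrite /free_supp; case: (cid _) => t Ht /=; rewrite mem_undup; apply: Ht.
have ut : uniq (free_supp f) by apply: undup_uniq.
move: (free_supp f) ut Ht => t ut Ht.
have aux (u v : seq X) : uniq u -> uniq v ->
    (forall x, x \notin v -> free_fun f x = 0) ->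
    \sum_(x <- u) (free_fun f x : R) *: phi x =
    \sum_(x <- [seq x <- u | x \in v]) (free_fun f x : R) *: phi x.
  move=> uu uv Hv; rewrite big_filter [RHS]big_mkcond /=; apply: eq_bigr => x _.
  by case: ifPn => // /Hv ->; rewrite scale0r.
rewrite (aux t s) // (aux s t) //; apply: perm_big; apply: uniq_perm.
- exact: filter_uniq.
- exact: filter_uniq.
- by move=> x; rewrite !mem_filter andbC.
Qed.

Fact free_lift_is_linear : linear free_lift.
Proof.
move=> a f g; set s := undup (free_supp f ++ free_supp g).
have us : uniq s by apply: undup_uniq.
have H h x : x \notin free_supp h -> free_fun h x = 0.
  by rewrite /free_supp; case: (cid _) => t Ht /=; rewrite mem_undup; apply: Ht.
have Hf x : x \notin s -> free_fun f x = 0.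
  by rewrite mem_undup mem_cat negb_or => /andP[/H].
have Hg x : x \notin s -> free_fun g x = 0.
  by rewrite mem_undup mem_cat negb_or => /andP[_ /H].
have E x : free_fun (a *: f + g) x = a * free_fun f x + free_fun g x by [].
rewrite (free_liftE us Hf) (free_liftE us Hg) (@free_liftE _ s) //; last first.
  by move=> x xs; rewrite [LHS]E Hf // Hg // mulr0 addr0.
rewrite scaler_sumr -big_split /=; apply: eq_bigr => x _.
transitivity ((a * free_fun f x + free_fun g x) *: phi x); first by [].
by rewrite scalerDl scalerA.
Qed.
HB.instance Definition _ :=
  GRing.isLinear.Build R free_module V *:%R free_lift free_lift_is_linear.

Fact free_gen_subproof (x : X) :
  (fun y => if y == x then 1 else 0 : R^o) \in finsupp.
Proof.
by apply/asboolP; exists [:: x] => y; rewrite mem_seq1 => /negbTE->.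
Qed.
Definition free_gen x := FreeModule (free_gen_subproof x).

Lemma free_lift_gen x : free_lift (free_gen x) = phi x.
Proof.
rewrite (@free_liftE _ [:: x]) //; last first.
  by move=> y; rewrite mem_seq1 /= => /negbTE->.
by rewrite big_seq1 /= eqxx scale1r.
Qed.

End FreeModule.

Lemma free_module_projective (R : pzRingType) (X : choiceType) :
  projective (free_module R X : lmodType R).
Proof.
move=> V W g f gsurj.
pose phi x := projT1 (cid (gsurj (f (free_gen R x)))).
have Ephi x : g (phi x) = f (free_gen R x).
  by rewrite /phi; case: (cid _).
exists (free_lift phi) => u.
rewrite /free_lift linear_sum.
transitivity (f (\sum_(x <- free_supp u) (free_fun u x : R) *: free_gen R x)).
  by rewrite linear_sum; apply: eq_bigr => x _; rewrite !linearZ /= Ephi.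
congr (f _); apply: val_inj; apply/funext => y.
have -> : val (\sum_(x <- free_supp u) (free_fun u x : R) *: free_gen R x) =
   \sum_(x <- free_supp u) val ((free_fun u x : R) *: free_gen R x).
  exact: (raddf_sum (val : {linear free_module R X -> (X -> R^o)})).
rewrite fct_sumE.
have us : uniq (free_supp u) by apply: undup_uniq.
have [yu|yu] := boolP (y \in free_supp u).
  rewrite (bigD1_seq y) //= big1 ?addr0.
    by rewrite -[LHS]/(free_fun u y * (if y == y then 1 else 0)) eqxx mulr1.
  move=> x xy; rewrite -[LHS]/(free_fun u x * (if y == x then 1 else 0)).
  by rewrite eq_sym (negbTE xy) mulr0.
rewrite big_seq big1 => [|x xu].
  move: yu; rewrite /free_supp; case: (cid _) => t Ht /=; rewrite mem_undup.
  by move/Ht.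
rewrite -[LHS]/(free_fun u x * (if y == x then 1 else 0)).
by case: eqP yu => [->|]; rewrite ?xu ?mulr0.
Qed.

Section StandardResolution.
Variables (R : pzRingType) (M : lmodType R).

Section Kernel.
Variables (V W : lmodType R) (f : {linear V -> W}).
Definition kernel : {pred V} := fun x => f x == 0.
Fact kernel_submod_closed : submod_closed kernel.
Proof.
split; first by rewrite unfold_in linear0.
move=> a x y; rewrite !unfold_in => /eqP fx /eqP fy.
by rewrite linearP fx fy scaler0 addr0.
Qed.
HB.instance Definition _ :=
  GRing.isSubmodClosed.Build R V kernel kernel_submod_closed.
Record ker_mod := KerMod { ker_val : V; _ : ker_val \in kernel }.
HB.instance Definition _ := [isSub for ker_val].
HB.instance Definition _ := [Choice of ker_mod by <:].
HB.instance Definition _ := [SubChoice_isSubLmodule of ker_mod by <:].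
End Kernel.

Definition free_cover (V : lmodType R) : {linear free_module R V -> V} :=
  free_lift (@id V).

Fixpoint syzygy (i : nat) : lmodType R :=
  if i is j.+1 then ker_mod (free_cover (syzygy j)) else M.

Definition std_mod i : lmodType R := free_module R (syzygy i).

Definition std_d i : {linear std_mod i.+1 -> std_mod i} :=
  (val : {linear syzygy i.+1 -> std_mod i}) \o free_cover (syzygy i.+1).

Lemma free_cover_surj (V : lmodType R) (v : V) : exists x, free_cover V x = v.
Proof. by exists (free_gen R v); apply: free_lift_gen. Qed.

Lemma std_exact (i : nat) (x : std_mod i) :
  free_cover (syzygy i) x = 0 <-> exists y, std_d i y = x.
Proof.
split=> [/eqP x0|[y <-]].
  have [y Ey] := free_cover_surj (KerMod x0 : syzygy i.+1).
  by exists y; rewrite -[LHS]/(ker_val (free_cover (syzygy i.+1) y)) Ey.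
rewrite -[std_d i y]/(ker_val (free_cover (syzygy i.+1) y)).
by case: (free_cover _ y) => z /= /eqP.
Qed.

(* Projective resolutions always exist, so a statement about every one of them is
   not vacuous. *)
Definition std_resolution : proj_resolution M.
Proof.
apply: (@ProjResolution R M std_mod std_d (free_cover M)).
- by move=> i; apply: free_module_projective.
- exact: free_cover_surj.
- exact: std_exact 0%N.
- move=> i x; rewrite -std_exact; split=> [dx0|x0].
    exact: val_inj.
  by rewrite -[LHS]/(ker_val (free_cover (syzygy i.+1) x)) x0.
Defined.

End StandardResolution.

(* Main.v *)
(* Let h = (a, 1^b) and r = a + b. The tensor products of divided powers
   D_alpha, alpha a composition of r with first part at least a, are the modules
   of tensors invariant under Young subgroups. They form a cube of inclusions
   whose total complex resolves Delta(h): filtering words by their moment, the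
   graded pieces are contractible cubes, except for the words that are
   semistandard hook tableaux. Each D_alpha is projective, being generated by a
   weight vector, and Hom(D_alpha, N) is the alpha-weight space of N.

   For N = Delta(a + k, 1^(b-k)) this weight space is 0 when alpha has fewer than
   m = b - k + 1 parts and is Z when it has m parts, so Ext^k is the cokernel of an
   integer matrix between the weight spaces for m + 1 and m parts. With partial
   sums N_0 < N_1 < ... < N_(m-1) = r of alpha, let
     lambda(alpha) = prod_(1 <= i < m) C(N_i - 1, N_(i-1)).
   Pascal's rule shows that lambda kills all relations, except those merging with
   the last block, whose image is a multiple of C(r, j) with 1 <= j <= k.
   Conversely, relations with a unit coefficient push the cuts of alpha to the
   right and reduce every generator to that of (a + k, 1, ..., 1), of weight 1;
   there the remaining relations are exactly C(r, j) = 0 for 1 <= j <= k. *)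
Require Import Defs.
From HB Require Import structures.
From mathcomp Require Import all_boot all_order all_fingroup all_algebra.
From mathcomp Require Import generic_quotient ring_quotient boolp.
From mathcomp Require Import zify ring.

Set Implicit Arguments.
Unset Strict Implicit.
Unset Printing Implicit Defensive.

Import GRing.Theory.

(** * Comparison of projective resolutions *)

(** A quotient such as Delta(a', 1^c) shows no coordinates. Alternating over the corner and the leg
    ([tail_alt]) supplies them: it kills exactly the defining relations, and its values at the
    terminal words are integer coordinates, dual to the classes of head orbits. Every coefficient in
    the complex Hom(resolution, Delta) thus becomes a signed count of words.

    The moment filters well because a sorted word is the only word of least moment in its orbit
    under a Young subgroup: orbit sums are unitriangular, and nothing has to be divided over the
    integers. The hypothesis n >= b + 1 gives distinct letters to the at most b + 1 blocks; the
    stabilizer of such a word is exactly the Young subgroup, whence the projectivity of D_alpha.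

    All cochains of degree k are cocycles, so only the image of the differential from degree k - 1
    matters. The numbers lambda(alpha) are forced: the relations with a unit coefficient reduce
    every generator to that of (a + k, 1, ..., 1), so a functional killing them is fixed by its
    value there. *)

Section QuotientIso.
Local Open Scope ring_scope.
Local Open Scope quotient_scope.

Lemma zmod_iso_trans (A B C : zmodType) :
  zmod_iso A B -> zmod_iso B C -> zmod_iso A C.
Proof.
move=> [f bf] [g bg]; exists (g \o f : {additive A -> C}).
exact: bij_comp.
Qed.

Lemma first_iso (V G : zmodType) (U : zmodClosed V) (h : {additive V -> G}) :
  (forall x, (h x == 0) = (x \in U)) -> (forall y, exists x, h x = y) ->
  zmod_iso (Quotient.quot U) G.
Proof.
move=> ker surj; pose f (x : Quotient.quot U) := h (repr x).
have fE x : f (\pi_(Quotient.quot U) x) = h x.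
  apply/eqP; rewrite -subr_eq0 -raddfB ker Quotient.idealrBE reprK.
  exact: eqxx.
have fadd : zmod_morphism f.
  move=> x y; rewrite -[x]reprK -[y]reprK -raddfB.
  by rewrite !fE raddfB.
pose fM := GRing.isZmodMorphism.Build _ _ f fadd.
pose fA : {additive Quotient.quot U -> G} := HB.pack f fM.
exists fA; pose g y := \pi_(Quotient.quot U) (projT1 (cid (surj y))).
exists g => [x|y]; last first.
  by rewrite -[LHS]/(f (g y)) fE; case: (cid _).
rewrite -[fA x]/(f x) /g; case: (cid _) => z /= Ez.
rewrite -[x in RHS]reprK; apply/eqP; rewrite -Quotient.idealrBE -ker raddfB.
by rewrite Ez subrr.
Qed.

End QuotientIso.

Section Comparison.
Local Open Scope ring_scope.
Local Open Scope quotient_scope.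
Variable R : pzRingType.

Section Corestriction.
Variables (U V W : lmodType R) (e : {linear V -> W}) (f : {linear U -> V}).
Hypothesis ef0 : forall x, f x \in kernel e.

Definition corestr (x : U) : ker_mod e := KerMod (ef0 x).

Fact corestr_is_linear : linear corestr.
Proof. by move=> a x y; apply: val_inj; rewrite /= linearP. Qed.
HB.instance Definition _ :=
  GRing.isLinear.Build R U (ker_mod e) *:%R corestr corestr_is_linear.
End Corestriction.

(** [projective] lifts only through surjections; exactness at [B] says that [d], corestricted to the
    kernel of [e], is one. *)
Lemma projective_lift (P A B C : lmodType R) (d : {linear A -> B})
    (e : {linear B -> C}) (f : {linear P -> B}) :
  projective P -> (forall x, e x = 0 <-> exists y, d y = x) ->
  (forall x, e (f x) = 0) ->
  exists h : {linear P -> A}, forall x, d (h x) = f x.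
Proof.
move=> projP exact ef0.
have kf x : f x \in kernel e by rewrite unfold_in; apply/eqP.
have kd y : d y \in kernel e by rewrite unfold_in; apply/eqP/exact; exists y.
have [|h Eh] := projP _ _ (corestr kd : {linear A -> ker_mod e}) (corestr kf).
  case=> x kx; have [y Ey] := (exact x).1 (eqP kx).
  by exists y; apply: val_inj.
by exists h => x; have := congr1 val (Eh x).
Qed.

Variable M : lmodType R.

Section ChainMap.
Variables P Q : proj_resolution M.

Lemma res_dd i x : res_d P i (res_d P i.+1 x) = 0.
Proof. by apply/res_exact; exists x. Qed.

Definition chain_map (phi : forall i, {linear P i -> Q i}) :=
  (forall x, res_aug Q (phi 0 x) = res_aug P x) /\
  forall i x, res_d Q i (phi i.+1 x) = phi i (res_d P i x).

Lemma chain_map_ex : exists phi, chain_map phi.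
Proof.
have [phi0 E0] : exists phi0 : {linear P 0 -> Q 0},
    forall x, res_aug Q (phi0 x) = res_aug P x.
  exact: (@res_proj _ _ P 0 _ _ _ _ (@res_aug_surj _ _ Q)).
have [phi1 E1] : exists phi1 : {linear P 1 -> Q 1},
    forall x, res_d Q 0 (phi1 x) = phi0 (res_d P 0 x).
  pose f : {linear P 1 -> Q 0} := phi0 \o res_d P 0.
  apply: (projective_lift (f := f) (@res_proj _ _ P 1) (@res_exact0 _ _ Q)) => x.
  by rewrite /= E0; apply/res_exact0; exists x.
(* Lifting in degree i + 2 needs the square below it to commute, so the recursion carries two
   consecutive components together with their square. *)
pose T i := {u : {linear P i -> Q i} * {linear P i.+1 -> Q i.+1} |
  forall x, res_d Q i (u.2 x) = u.1 (res_d P i x)}.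
have step i (u : T i) : {v : {linear P i.+2 -> Q i.+2} |
    forall x, res_d Q i.+1 (v x) = (sval u).2 (res_d P i.+1 x)}.
  apply: cid; pose f : {linear P i.+2 -> Q i.+1} := (sval u).2 \o res_d P i.+1.
  apply: (projective_lift (f := f) (@res_proj _ _ P i.+2) (@res_exact _ _ Q i)) => x.
  by rewrite /= (svalP u) res_dd linear0.
pose next i (u : T i) : T i.+1 :=
  exist _ ((sval u).2, sval (step i u)) (svalP (step i u)).
pose F : forall i, T i := nat_rect T (exist _ (phi0, phi1) E1) next.
exists (fun i => (sval (F i)).1); split=> [|i x]; first exact: E0.
exact: svalP (F i) x.
Qed.

Section Pullback.
Variables (phi : forall i, {linear P i -> Q i}).
Hypothesis phiP : chain_map phi.
Variables (N : lmodType R) (k : nat).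

Fact pull_subproof (f : cocycle Q N k) : cocycle_fun f \o phi k \in @cocycles _ _ P N k.
Proof.
case: f => f /= /asboolP[fl fd]; apply/asboolP; split=> [a x y|x] /=.
  by rewrite linearP fl.
by rewrite -phiP.2 fd.
Qed.

Definition pull (f : cocycle Q N k) : cocycle P N k := Cocycle (pull_subproof f).

Fact pull_is_zmod_morphism : zmod_morphism pull.
Proof. by move=> f g; apply: val_inj. Qed.
HB.instance Definition _ :=
  GRing.isZmodMorphism.Build _ _ pull pull_is_zmod_morphism.
End Pullback.
Arguments pull {phi} phiP {N k} f.

Lemma pull_coboundary phi (phiP : chain_map phi) N k (f : cocycle Q N k) :
  f \in @coboundaries _ _ Q N k -> pull phiP f \in @coboundaries _ _ P N k.
Proof.
case: k f => [|k] f.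
  by rewrite !unfold_in /= => /eqP->; rewrite raddf0.
rewrite !unfold_in /= => /asboolP[g Eg]; apply/asboolP.
by exists (g \o phi k) => x /=; rewrite Eg phiP.2.
Qed.

End ChainMap.
Arguments pull {P Q phi} phiP {N k} f.

Lemma chain_map_comp (P Q T : proj_resolution M) phi psi :
  @chain_map P Q phi -> @chain_map Q T psi ->
  @chain_map P T (fun i => psi i \o phi i).
Proof.
move=> [phi0 phid] [psi0 psid]; split=> [x|i x] /=; first by rewrite psi0.
by rewrite psid phid.
Qed.

Section Homotopy.
Variables (P : proj_resolution M) (psi : forall i, {linear P i -> P i}).
Hypothesis psiP : chain_map psi.

(** The summand h d of a homotopy identity, with h from degree i - 1. As a property it covers degree
    0, where the summand vanishes, without a module in degree -1. *)
Definition factors_d i : {linear P i -> P i} -> Prop :=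
  match i with
  | 0 => fun s => forall x, s x = 0
  | j.+1 => fun s => exists h : {linear P j -> P j.+1},
                       forall x, s x = h (res_d P j x)
  end.

Lemma homotopy_ex i : exists (h : {linear P i -> P i.+1}) (s : {linear P i -> P i}),
  factors_d s /\ forall x, psi i x - x = res_d P i (h x) + s x.
Proof.
elim: i => [|i [h [s [Hs E]]]].
  pose f : {linear P 0 -> P 0} := psi 0 \- idfun.
  have [x|h Eh] := projective_lift (f := f) (@res_proj _ _ P 0) (@res_exact0 _ _ P).
    by rewrite /= raddfB /= psiP.1 subrr.
  exists h, \0; split=> // x; rewrite Eh /= addr0.
  by [].
pose s' : {linear P i.+1 -> P i.+1} := h \o res_d P i.
(* This map lands in the cycles: psi commutes with d, and the summand [s] of the previous degree
   dies on boundaries. *)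
pose f : {linear P i.+1 -> P i.+1} := (psi i.+1 \- idfun) \- s'.
have [x|h' Eh] := projective_lift (f := f) (@res_proj _ _ P i.+1) (@res_exact _ _ P i).
  rewrite /f /s' /= !raddfB /= psiP.2.
  have s0 : s (res_d P i x) = 0.
    case: (i) x s Hs {E f s'} => [|j] x s /= Hs; first by rewrite Hs.
    by case: Hs => h0 ->; rewrite res_dd linear0.
  by have := E (res_d P i x); rewrite s0 addr0 => <-; rewrite subrr.
exists h', s'; split; first by exists h.
by move=> x; rewrite Eh /f /= subrK.
Qed.

(** A cocycle kills the part d h of the homotopy; the part factoring through d is a coboundary, and
    zero in degree 0. *)
Lemma pull_homotopic N k (f : cocycle P N k) :
  pull psiP f - f \in @coboundaries _ _ P N k.
Proof.
have [h [s [Hs E]]] := homotopy_ex k.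
have /asboolP[fl fd] := valP f.
pose fA := GRing.isLinear.Build R (P k) N *:%R (cocycle_fun f) fl.
pose fL : {linear P k -> N} := HB.pack (cocycle_fun f) fA.
have fLd y : fL (res_d P k y) = 0 := fd y.
have Ef x : cocycle_fun (pull psiP f - f) x = fL (s x).
  rewrite -[LHS]/(fL (psi k x) - fL x) -raddfB E raddfD.
  by rewrite [X in X + _]fLd add0r.
case: k f h s Hs E fl fd fA fL fLd Ef => [|k] f h s Hs E fl fd fA fL fLd Ef.
  rewrite unfold_in /=; apply/eqP/val_inj/funext => x.
  by rewrite [LHS]Ef Hs linear0.
case: Hs => h' Es; rewrite unfold_in /=; apply/asboolP.
by exists (fL \o h') => x; rewrite [LHS]Ef Es.
Qed.

End Homotopy.

(** There are chain maps both ways, and both composites act as the identity modulo coboundaries: one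
    gives the kernel of the comparison, the other its surjectivity. *)
Lemma ext_iso (P Q : proj_resolution M) N k : zmod_iso (ext P N k) (ext Q N k).
Proof.
have [phi phiP] := chain_map_ex Q P; have [psi psiP] := chain_map_ex P Q.
pose U := [the zmodClosed _ of @coboundaries _ _ P N k].
pose U' := [the zmodClosed _ of @coboundaries _ _ Q N k].
pose h : {additive cocycle P N k -> ext Q N k} :=
  \pi_(Quotient.quot U') \o @pull _ _ _ phiP N k.
apply: (@first_iso _ _ U h) => [f|y].
  rewrite -[h f]/(\pi_(Quotient.quot U') (pull phiP f)) -(raddf0 \pi_(Quotient.quot U')).
  rewrite -Quotient.idealrBE subr0; apply/idP/idP; last exact: pull_coboundary.
  move/(pull_coboundary psiP) => Hf.
  have := pull_homotopic (chain_map_comp psiP phiP) f.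
  have -> : pull (chain_map_comp psiP phiP) f = pull psiP (pull phiP f).
    exact: val_inj.
  by move=> /(rpredB Hf); rewrite opprB addrC subrK.
exists (pull psiP (repr y)); rewrite -[LHS]/(\pi_(Quotient.quot U') (pull phiP (pull psiP (repr y)))).
rewrite -[y in RHS]reprK; apply/eqP; rewrite -Quotient.idealrBE.
have := pull_homotopic (chain_map_comp phiP psiP) (repr y).
have -> : pull (chain_map_comp phiP psiP) (repr y) = pull phiP (pull psiP (repr y)).
  exact: val_inj.
by [].
Qed.

End Comparison.

(** * Words and the cube of block-invariant functions *)

Section Words.
Variables (n r : nat).
Implicit Types (w v : mindex n r) (s t : 'S_r).

Definition wact (w : mindex n r) (s : 'S_r) : mindex n r := [ffun p => w (s p)].

Lemma wactM w s t : wact (wact w s) t = wact w (t * s)%g.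
Proof. by apply/ffunP => p; rewrite !ffunE permM. Qed.

Lemma wact1 w : wact w 1%g = w.
Proof. by apply/ffunP => p; rewrite !ffunE perm1. Qed.

Lemma wactK w s : wact (wact w s) s^-1%g = w.
Proof. by rewrite wactM mulVg wact1. Qed.

(** Exchanging an increasing pair of letters lowers this number, so sorted means weakly decreasing
    throughout. *)
Definition moment (w : mindex n r) : nat := \sum_(p < r) p * w p.

Lemma moment_tperm w (p q : 'I_r) : p < q -> w p < w q ->
  moment (wact w (tperm p q)) < moment w.
Proof.
move=> pq wpq; have qp : q != p by rewrite -val_eqE /= gtn_eqF.
rewrite /moment (bigD1 p) //= (bigD1 q) //= [X in _ < X](bigD1 p) //=.
rewrite [X in _ < _ + X](bigD1 q) //= !ffunE tpermL tpermR.
rewrite (eq_bigr (fun i : 'I_r => i * w i)) => [|i /andP[ip iq]]; last first.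
  by rewrite ffunE tpermD // eq_sym.
nia.
Qed.

Variable a : nat.
Local Notation b := (r - a).
Implicit Types D : {set 'I_b}.

(* A cut set [D] cuts the r places, for each [i] in [D], before the place [a + i];
   its blocks are the parts of a composition of r with first part >= a, and
   [blk D p] is the index of the block of the place [p]. *)
Definition blk D (p : nat) : nat := #|[set i : 'I_b in D | a + i <= p]|.

Lemma leq_blk D p q : p <= q -> blk D p <= blk D q.
Proof.
move=> pq; apply/subset_leq_card/subsetP => i; rewrite !inE.
by move=> /andP[-> /leq_trans->].
Qed.

Lemma blk_eqP D p q : p <= q ->
  reflect (forall i : 'I_b, i \in D -> ~~ (p < a + i <= q)) (blk D p == blk D q).
Proof.
move=> pq; have sub : [set i : 'I_b in D | a + i <= p] \subset [set i : 'I_b in D | a + i <= q].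
  by apply/subsetP => i; rewrite !inE => /andP[-> /leq_trans->].
rewrite /blk eqn_leq (subset_leq_card sub) /=.
apply: (iffP idP) => [le i iD|H].
  have /eqP/setP/(_ i) : [set i : 'I_b in D | a + i <= p] == [set i : 'I_b in D | a + i <= q].
    by rewrite eqEcard sub.
  by rewrite !inE iD /=; lia.
apply/subset_leq_card/subsetP => i; rewrite !inE => /andP[iD iq].
by rewrite iD /=; have := H i iD; lia.
Qed.

Lemma blk_sub D D' (p q : nat) : D \subset D' ->
  blk D' p = blk D' q -> blk D p = blk D q.
Proof.
move=> /subsetP DD'; wlog pq : p q / p <= q => [H E|/eqP/(blk_eqP _ pq) H].
  by case: (leqP p q) => [/H->//|/ltnW/H->].
by apply/eqP/blk_eqP => // i /DD'/H.
Qed.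

Definition blkperm D (s : 'S_r) := [forall p : 'I_r, blk D (s p) == blk D p].

Lemma blkpermP D (s : 'S_r) :
  reflect (forall p : 'I_r, blk D (s p) = blk D p) (blkperm D s).
Proof. exact: 'forall_eqP. Qed.

Lemma blkperm1 D : blkperm D 1%g.
Proof. by apply/blkpermP => p; rewrite perm1. Qed.

Lemma blkpermM D s t : blkperm D s -> blkperm D t -> blkperm D (s * t)%g.
Proof.
by move=> /blkpermP Hs /blkpermP Ht; apply/blkpermP => p; rewrite permM Ht Hs.
Qed.

Lemma blkpermV D s : blkperm D s -> blkperm D s^-1%g.
Proof. by move=> /blkpermP Hs; apply/blkpermP => p; rewrite -Hs permKV. Qed.

Lemma blkperm_tperm D (p q : 'I_r) : blk D p = blk D q -> blkperm D (tperm p q).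
Proof. by move=> E; apply/blkpermP => x; case: tpermP => [->|->|]. Qed.

Lemma blkperm_sub D D' s : D \subset D' -> blkperm D' s -> blkperm D s.
Proof.
move=> DD' /blkpermP Hs; apply/blkpermP => p.
exact: blk_sub DD' (Hs p).
Qed.

Definition prv (p : 'I_r) : 'I_r := Ordinal (leq_ltn_trans (leq_pred p) (ltn_ord p)).

Lemma cutp_subproof (i : 'I_b) : a + i < r.
Proof. by have := ltn_ord i; lia. Qed.
Definition cutp (i : 'I_b) : 'I_r := Ordinal (cutp_subproof i).

Definition head_sorted (w : mindex n r) :=
  [forall p : 'I_r, (0 < p < a) ==> (w p <= w (prv p))].

(** A head-sorted word [w] is sorted for exactly those D that contain the complement of this set.
    These D form a cube of dimension #|descents w|, a single point when there is no descent. *)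
Definition descents (w : mindex n r) : {set 'I_b} :=
  [set i | w (cutp i) <= w (prv (cutp i))].

Definition blk_sorted D w := head_sorted w && (~: D \subset descents w).

Lemma blk_sortedD1 D w i : i \in D ->
  blk_sorted (D :\ i) w = blk_sorted D w && (i \in descents w).
Proof.
move=> iD; rewrite /blk_sorted -andbA; congr (_ && _).
by rewrite setCD subUset sub1set.
Qed.

Hypothesis a_gt0 : 0 < a.
Hypothesis a_le : a <= r.

Lemma blk_sortedP D w : reflect
  (forall p q : 'I_r, p <= q -> blk D p = blk D q -> w q <= w p) (blk_sorted D w).
Proof.
apply: (iffP andP) => [[/forall_inP ws /subsetP sD] p q|H]; last first.
  split; [apply/forall_inP => p /andP[p0 pa] | apply/subsetP => i; rewrite !inE => iD].
    apply: H; first by rewrite /= leq_pred.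
    by apply/eqP/blk_eqP => [|i _]; rewrite /= ?leq_pred //; lia.
  apply: H; first by rewrite /= leq_pred.
  apply/eqP/blk_eqP => [|j jD]; rewrite /= ?leq_pred //.
  by case: (eqVneq i j) iD jD => [->/negbTE->//|]; rewrite -(inj_eq val_inj) /=; lia.
case: q => q qr; elim: q qr => [|q IH] qr /= pq.
  by have -> : p = Ordinal qr by apply: val_inj => /=; lia.
case: ltngtP pq => // [pq _|pq _ _]; last first.
  by have -> : p = Ordinal qr by apply: val_inj.
move=> /eqP/blk_eqP-/(_ (ltnW pq)) E.
have qr' : q < r by apply: ltnW.
apply: (leq_trans _ (IH qr' _ _)) => //; last first.
  by apply/eqP/blk_eqP => // i iD; have := E i iD; rewrite /=; lia.
have -> : Ordinal qr' = prv (Ordinal qr) by apply: val_inj.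
case: (ltnP q.+1 a) => qa; first by apply: ws.
have ib : q.+1 - a < b by lia.
have Eq : Ordinal qr = cutp (Ordinal ib) by apply: val_inj => /=; lia.
rewrite Eq; have := sD (Ordinal ib); rewrite !inE; apply.
by apply/negP => /E /=; lia.
Qed.

(** In a block of a sorted word the letters >= c fill an initial segment, and initial segments of
    equal size coincide. *)
Lemma blk_sorted_inj D v w : blk_sorted D v -> blk_sorted D w ->
  (forall (p : 'I_r) c, #|[set q : 'I_r | (blk D q == blk D p) && (c <= v q)]| =
               #|[set q : 'I_r | (blk D q == blk D p) && (c <= w q)]|) ->
  v = w.
Proof.
move=> /blk_sortedP sv /blk_sortedP sw E; apply/ffunP => p; apply: val_inj => /=.
pose A (u : mindex n r) c := [set q : 'I_r | (blk D q == blk D p) && (c <= u q)].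
have Adown (u : mindex n r) c : (forall p q : 'I_r, p <= q -> blk D p = blk D q -> u q <= u p) ->
    forall q q' : 'I_r, q' \in A u c -> blk D q = blk D p -> q <= q' -> q \in A u c.
  move=> su q q'; rewrite !inE => /andP[/eqP Eq' cq'] Eq qq'; rewrite Eq eqxx /=.
  by apply: leq_trans cq' (su _ _ qq' _); rewrite Eq Eq'.
have AE c : A v c = A w c.
  have cardE : #|A v c| = #|A w c| by apply: E.
  have [sub|/subsetPn[x xv xw]] := boolP (A v c \subset A w c).
    by apply/eqP; rewrite eqEcard sub cardE leqnn.
  apply/eqP; rewrite eq_sym eqEcard cardE leqnn andbT.
  apply/subsetP => y yw; case: (leqP y x) => xy.
    apply: Adown sv _ _ xv _ xy.
    by move: yw; rewrite inE => /andP[/eqP].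
  case/negP: xw; apply: Adown sw _ _ yw _ (ltnW xy).
  by move: xv; rewrite inE => /andP[/eqP].
have H c : (c <= v p) = (c <= w p).
  by have /setP/(_ p) := AE c; rewrite !inE eqxx.
by apply/eqP; rewrite eqn_leq -H leqnn H leqnn.
Qed.

Lemma blk_sorted_act_inj D w s : blk_sorted D (wact w s) -> blk_sorted D w ->
  blkperm D s -> wact w s = w.
Proof.
move=> sv sw /blkpermP Hs; apply: blk_sorted_inj sv sw _ => p c.
rewrite -(card_imset _ (@perm_inj _ s)); apply: eq_card => q.
apply/imsetP/idP => [[q' + ->]|]; first by rewrite !inE ffunE Hs.
rewrite inE => Hq; exists (s^-1%g q); rewrite ?permKV // inE ffunE permKV.
by rewrite -(Hs (s^-1%g q)) permKV.
Qed.

(** Sorting by exchanges, with the moment as termination measure. The strict drop is what places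
    unsorted words lower in the filtration. *)
Lemma blk_sort D w : exists2 s, blkperm D s &
  blk_sorted D (wact w s) /\ (wact w s = w \/ moment (wact w s) < moment w).
Proof.
have [m] := ubnP (moment w); elim: m w => // m IH w /ltnSE wm.
have [sw|/blk_sortedP nsw] := boolP (blk_sorted D w).
  by exists 1%g; rewrite ?blkperm1 // wact1; split; [|left].
have [p [q [pq Epq wpq]]] : exists p q : 'I_r, [/\ p < q, blk D p = blk D q & w p < w q].
  apply: contrapT => H; apply: nsw => p q pq E; rewrite leqNgt; apply/negP => wpq.
  apply: H; exists p, q; split=> //; rewrite ltn_neqAle pq andbT.
  by apply/eqP => /val_inj Epq; rewrite Epq ltnn in wpq.
have lt := moment_tperm pq wpq.
have [|s Hs [sws mom]] := IH (wact w (tperm p q)); first exact: leq_trans lt wm.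
exists (s * tperm p q)%g; first by rewrite blkpermM ?blkperm_tperm.
rewrite -wactM; split=> //; right.
by case: mom => [->//|/ltn_trans]; apply.
Qed.

Lemma moment_blk_sorted D w s : blk_sorted D w -> blkperm D s ->
  wact w s = w \/ moment w < moment (wact w s).
Proof.
move=> sw Hs; have [t Ht []] := blk_sort D (wact w s).
rewrite wactM => st; have E := blk_sorted_act_inj st sw (blkpermM Ht Hs).
by rewrite E => -[<-|]; [left|right].
Qed.

Local Open Scope ring_scope.

Definition blk_inv D (f : mindex n r -> int) :=
  forall s, blkperm D s -> forall w, f (wact w s) = f w.

Lemma blk_inv_sub D D' f : D \subset D' -> blk_inv D f -> blk_inv D' f.
Proof. by move=> DD' Hf s /(blkperm_sub DD'); apply: Hf. Qed.

Lemma blk_inv_eq0 D f : blk_inv D f ->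
  (forall w, blk_sorted D w -> f w = 0) -> forall w, f w = 0.
Proof.
move=> Hf f0 w; have [s Hs [sws _]] := blk_sort D w.
by rewrite -(Hf s Hs) f0.
Qed.

Definition orb D w (v : mindex n r) : int :=
  [exists s, blkperm D s && (v == wact w s)]%:R.

Lemma orb_inv D w : blk_inv D (orb D w).
Proof.
move=> s Hs v; rewrite /orb; congr (_%:R); congr nat_of_bool.
apply/existsP/existsP => -[t /andP[Ht /eqP E]].
  exists (s^-1 * t)%g; rewrite blkpermM ?blkpermV //=.
  by rewrite -wactM -E wactK.
by exists (s * t)%g; rewrite blkpermM //= E wactM.
Qed.

(** Unitriangularity of orbit sums: all other words of the orbit have larger moment. *)
Lemma orbE D w v : blk_sorted D w -> (moment v <= moment w)%N ->
  orb D w v = (v == w)%:R.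
Proof.
move=> sw vw; rewrite /orb; congr (_%:R); congr nat_of_bool.
apply/existsP/eqP => [[s /andP[Hs /eqP E]]|->].
  by case: (moment_blk_sorted sw Hs); rewrite -E // ltnNge vw.
by exists 1%g; rewrite blkperm1 wact1 eqxx.
Qed.

Lemma orb_sorted D w v : blk_sorted D w -> blk_sorted D v ->
  orb D w v = (v == w)%:R.
Proof.
move=> sw sv; rewrite /orb; congr (_%:R); congr nat_of_bool.
apply/existsP/eqP => [[s /andP[Hs /eqP E]]|->].
  by rewrite E; apply: blk_sorted_act_inj Hs => //; rewrite -E.
by exists 1%g; rewrite blkperm1 wact1 eqxx.
Qed.

Definition csgn D (i : 'I_b) : int := (-1) ^+ #|[set j in D | (j < i)%N]|.

Definition cbd (f : {set 'I_b} -> mindex n r -> int) D w : int :=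
  \sum_(i in D) csgn D i * f (D :\ i) w.

Lemma csgnM D i : csgn D i * csgn D i = 1.
Proof. by rewrite -expr2 sqrr_sign. Qed.

Lemma csgnD1 D i : csgn (D :\ i) i = csgn D i.
Proof.
congr (_ ^+ _); apply: eq_card => j; rewrite !inE.
by case: eqVneq => [->|//]; rewrite ltnn !andbF.
Qed.

Lemma csgnD1E D i j : i \in D -> csgn (D :\ i) j = csgn D j * (-1) ^+ (i < j)%N.
Proof.
move=> iD; rewrite /csgn; case ij: (i < j)%N; last first.
  rewrite mulr1; congr (_ ^+ _); apply: eq_card => k; rewrite !inE.
  by case: eqVneq => [->|//]; rewrite ij !andbF.
rewrite (cardsD1 i [set _ in D | _]) !inE iD ij /= exprD !expr1 mulrAC mulrNN !mul1r.
by congr (_ ^+ _); apply: eq_card => k; rewrite !inE andbA.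
Qed.

Lemma csgn_anti D i j : i \in D -> j \in D -> i != j ->
  csgn D i * csgn (D :\ i) j = - (csgn D j * csgn (D :\ j) i).
Proof.
move=> iD jD ij; rewrite !csgnD1E //.
have : (i < j)%N = ~~ (j < i)%N.
  by rewrite -leqNgt ltn_neqAle -(inj_eq val_inj) in ij *; rewrite ij.
by case: (j < i)%N => /= ->; rewrite ?expr1 ?expr0; ring.
Qed.

Lemma cbd_cbd f D w : cbd (cbd f) D w = 0.
Proof.
pose F i j := csgn D i * csgn (D :\ i) j * f (D :\ i :\ j) w.
have E : cbd (cbd f) D w = \sum_(i in D) \sum_(j in D | i != j) F i j.
  apply: eq_bigr => i iD; rewrite mulr_sumr; apply: eq_big => [j|j _].
    by rewrite !inE andbC eq_sym.
  by rewrite mulrA.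
suff : cbd (cbd f) D w = - cbd (cbd f) D w.
  by move=> H; lia.
rewrite {2}E (exchange_big_dep (mem D)) /=; last by move=> i j _ /andP[].
rewrite -sumrN E; apply: eq_bigr => i iD; rewrite -sumrN.
apply: eq_big => [j|j /andP[jD ij]].
  by rewrite iD eq_sym /= andbC.
by rewrite /F csgn_anti // setDDl setUC -setDDl mulNr.
Qed.

Lemma cbd_inv f D : (forall D, blk_inv D (f D)) -> blk_inv D (cbd f D).
Proof.
move=> Hf s Hs w; apply: eq_bigr => i _; congr (_ * _).
by apply: Hf; apply: blkperm_sub Hs; apply: subsetDl.
Qed.

(* Modulo words of larger moment, the complex splits into contractible cubes,
   one for each word [w] with [descents w != set0]. *)
Lemma cube_contract (f : {set 'I_b} -> mindex n r -> int) :
  (forall D, blk_inv D (f D)) -> (forall D w, cbd f D w = 0) ->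
  exists2 g, forall D, blk_inv D (g D) &
    forall D w, blk_sorted D w -> descents w != set0 -> f D w = cbd g D w.
Proof.
move=> Hf df.
suff [g Hg E] : exists2 g, forall D, blk_inv D (g D) &
    forall D w, blk_sorted D w -> descents w != set0 ->
      (moment w < (\max_w moment w).+1)%N -> f D w = cbd g D w.
  by exists g => // D w sw dw; apply: E => //; rewrite ltnS; apply: leq_bigmax.
elim: (\max_w _).+1 => [|m [g Hg E]]; first by exists (fun _ _ => 0).
(* The error of the approximation [g] is again a cycle; this round corrects it at the words of
   moment [m]. *)
pose h D w := f D w - cbd g D w.
have Hh D : blk_inv D (h D).
  by move=> s Hs w; rewrite /h (Hf D s Hs) (cbd_inv Hg Hs).
have dh D w : cbd h D w = 0.
  transitivity (cbd f D w - cbd (cbd g) D w); last by rewrite df cbd_cbd subr0.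
  by rewrite -sumrB; apply: eq_bigr => i _; rewrite mulrBr.
have h0 D w : blk_sorted D w -> descents w != set0 -> (moment w < m)%N -> h D w = 0.
  by move=> sw dw wm; rewrite /h E ?subrr.
(* Without the cut j the word [w] is unsorted. Sorting it lowers the moment below [m] and creates a
   descent at j, and there [h] already vanishes. *)
have h0' D w j : j \in D -> blk_sorted D w -> moment w = m ->
    j \notin descents w -> h (D :\ j) w = 0.
  move=> jD sw wm jw; have [s Hs [sws]] := blk_sort (D :\ j) w.
  rewrite -(Hh _ s Hs) => -[Ew|lt].
    by move: sws; rewrite Ew blk_sortedD1 // (negbTE jw) andbF.
  apply: h0 => //; last by rewrite -wm.
  move: sws; rewrite blk_sortedD1 // => /andP[_ js].
  by apply/set0Pn; exists j.
(* The cube of [w] is contracted along one chosen descent j: the correction at D is, up to sign, the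
   value of [h] at j |: D, spread over the orbit to keep invariance. *)
pose lead D w := [&& moment w == m, blk_sorted D w &
  if [pick j in descents w] is Some j then j \notin D else false].
pose c D w : int :=
  if [pick j in descents w] is Some j then csgn D j * h (j |: D) w else 0.
pose g' D v := \sum_(w | lead D w) c D w * orb D w v.
have Hg' D : blk_inv D (g' D).
  by move=> s Hs v; apply: eq_bigr => w _; rewrite (orb_inv w Hs).
have g'E D v : (moment v <= m)%N -> g' D v = (lead D v)%:R * c D v.
  move=> vm; rewrite /g'.
  rewrite (eq_bigr (fun w => c D w * (v == w)%:R)); last first.
    by move=> w /and3P[/eqP wm sw _]; rewrite orbE // wm.
  case: (boolP (lead D v)) => lv.
    rewrite (bigD1 v) //= eqxx mulr1 mul1r big1 ?addr0 // => w /andP[_ wv].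
    by rewrite eq_sym (negbTE wv) mulr0.
  rewrite mul0r big1 // => w lw; case: eqVneq => [vw|]; last by rewrite mulr0.
  by rewrite vw lw in lv.
exists (fun D v => g D v + g' D v).
  by move=> D s Hs w; rewrite (Hg D s Hs) (Hg' D s Hs).
move=> D v sv dv /ltnSE vm; apply/eqP; rewrite -subr_eq0.
suff : h D v = cbd g' D v.
  move=> /eqP; rewrite /h -subr_eq0 => /eqP <-; apply/eqP.
  rewrite -!addrA -opprD; congr (_ - _).
  by rewrite -big_split; apply: eq_bigr => i _; rewrite mulrDr.
move: vm; rewrite leq_eqVlt => /orP[/eqP vm|vm]; last first.
  rewrite h0 // /cbd big1 // => i iD.
  by rewrite g'E ?(ltnW vm) // /lead (ltn_eqF vm) mul0r mulr0.
rewrite /cbd (eq_bigr (fun i => csgn D i * ((lead (D :\ i) v)%:R * c (D :\ i) v))); last first.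
  by move=> i _; rewrite g'E // vm.
rewrite /lead /c vm eqxx /=; case: pickP => [j jv|none]; last first.
  by case/set0Pn: dv => j; have := none j => /= ->.
(* If j is in D, only the face D :\ j contributes and returns [h D v]. Otherwise the cycle condition
   of [h] at j |: D expresses [h D v] by the other faces. *)
have [jD|jD] := boolP (j \in D).
  rewrite (bigD1 j) //= big1 => [|i /andP[iD ij]]; last first.
    by rewrite !inE jD eq_sym ij andbF mul0r mulr0.
  rewrite !inE eqxx /= andbT blk_sortedD1 // sv jv mul1r addr0 setD1K //.
  by rewrite csgnD1 mulrA csgnM mul1r.
have sjv : blk_sorted (j |: D) v.
  by move: sv; rewrite /blk_sorted => /andP[-> sD] /=; apply: subset_trans sD; rewrite setCS subsetUr.
have := dh (j |: D) v; rewrite /cbd (bigD1 j) ?setU11 //= setU1K //.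
rewrite -(csgnD1 (j |: D) j) setU1K // => /eqP; rewrite addr_eq0 => /eqP H.
rewrite -[LHS]mul1r -[X in X * _ = _](csgnM D j) -mulrA H mulrN mulr_sumr -sumrN.
apply: eq_big => [i|i /andP[]].
  by rewrite !inE; case: eqVneq => [->|_]; rewrite ?andbT ?andbF // (negbTE jD).
rewrite !inE => /orP[->//|iD] ij.
have ijD : i \in j |: D by rewrite !inE iD orbT.
have [iv|iv] := boolP (i \in descents v); last first.
  by rewrite blk_sortedD1 // sv (negbTE iv) h0' ?mul0r ?mulr0 ?oppr0.
rewrite blk_sortedD1 // sv iv (negbTE jD) andbF mul1r.
have -> : j |: (D :\ i) = (j |: D) :\ i.
  by apply/setP => k; rewrite !inE; case: eqVneq => [->|//]; rewrite eq_sym ij.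
rewrite !mulrA -mulNr; congr (_ * _).
have := csgn_anti ijD (setU11 j D) ij; rewrite setU1K // => A.
have D1 : csgn (j |: D) j = csgn D j by rewrite -csgnD1 setU1K.
have Di : csgn D i = csgn (j |: D) i * (-1) ^+ (j < i)%N.
  by rewrite -(csgnD1E _ (setU11 j D)) setU1K.
rewrite Di csgnD1E //.
have : (j < i)%N = ~~ (i < j)%N.
  by rewrite -leqNgt ltn_neqAle -(inj_eq val_inj) in ij *; rewrite eq_sym ij.
by case: (i < j)%N => /= ->; rewrite ?expr1 ?expr0; ring.
Qed.

End Words.

(** * Antisymmetrization of the tail *)

Section CubeCorollaries.
Local Open Scope ring_scope.
Variables (n r a : nat).
Hypotheses (a_gt0 : (0 < a)%N) (a_le : (a <= r)%N).
Local Notation b := (r - a)%N.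
Implicit Types (v w : mindex n r) (D : {set 'I_b}).

(** In positive degree some cut is missing from D, and it is a descent of every D-sorted word; hence
    [cube_contract] reaches all sorted words. Its [g] is then truncated to degree i + 1. *)
Lemma cube_exact i (f : {set 'I_b} -> mindex n r -> int) : (0 < i)%N ->
  (forall D, blk_inv D (f D)) ->
  (forall D w, (#|D| + i != b)%N -> f D w = 0) ->
  (forall D w, cbd f D w = 0) ->
  exists g, [/\ forall D, blk_inv D (g D),
                forall D w, (#|D| + i.+1 != b)%N -> g D w = 0
              & forall D w, f D w = cbd g D w].
Proof.
move=> i0 Hf f0 df; have [g Hg E] := cube_contract a_gt0 a_le Hf df.
pose g' D w := if (#|D| + i.+1 == b)%N then g D w else 0.
exists g'; split=> [D|D w /negbTE|].
- by move=> s Hs w; rewrite /g' (Hg D s Hs).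
- by rewrite /g' => ->.
have g'E D w : cbd g' D w = if (#|D| + i == b)%N then cbd g D w else 0.
  case: ifP => Db; last first.
    rewrite /cbd big1 // => j jD; rewrite /g' ifN ?mulr0 //.
    by move: Db; rewrite (cardsD1 j D) jD => /negbT; lia.
  apply: eq_bigr => j jD; rewrite /g' ifT //.
  by move: Db; rewrite (cardsD1 j D) jD => /eqP; lia.
move=> D w; rewrite g'E; case: ifPn => [/eqP Db|/f0//].
apply/eqP; rewrite -subr_eq0; apply/eqP.
apply: (blk_inv_eq0 a_gt0 a_le (D := D) (f := fun w => f D w - cbd g D w)).
  by move=> s Hs u; rewrite (Hf D s Hs) (cbd_inv Hg Hs).
move=> u su; rewrite E ?subrr //; move: su => /andP[_ su].
have : (0 < #|~: D|)%N by move: (cardsC D); rewrite card_ord; lia.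
by case/card_gt0P => j jD; apply/set0Pn; exists j; apply: (subsetP su).
Qed.

(* Reading a tableau of shape (a, 1^b) along its row towards the corner and then
   down the column turns the semistandard tableaux into these words. *)
Definition terminal w := blk_sorted [set: 'I_b] w && (descents a w == set0).

(** A function placed at the full cut set is a cycle for free, so the contraction applies to it
    wherever the word has a descent. *)
Lemma terminal_reduction (f : mindex n r -> int) : blk_inv [set: 'I_b] f ->
  exists2 g : 'I_b -> mindex n r -> int,
    forall i, blk_inv [set~ i] (g i) &
    forall w, blk_sorted [set: 'I_b] w -> ~~ terminal w -> f w = \sum_i g i w.
Proof.
move=> Hf; pose F D w := if D == setT then f w else 0.
have [|D w|g Hg E] := cube_contract (f := F) a_gt0 a_le.
- move=> D s Hs w; rewrite /F; case: eqP => // DT.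
  by rewrite Hf // -DT.
- rewrite /cbd big1 // => i iD; rewrite /F ifN ?mulr0 //.
  by apply/eqP => /setP/(_ i); rewrite !inE eqxx.
exists (fun i w => csgn setT i * g [set~ i] w) => [i s Hs w|w sw tw].
  by rewrite (Hg _ s Hs).
have := E setT w sw; rewrite /F eqxx => ->; last by move: tw; rewrite /terminal sw.
by apply: eq_big => [i|i _]; rewrite ?inE // setTD.
Qed.

Lemma tailp_subproof (i : 'I_b.+1) : (a.-1 + i < r)%N.
Proof. by have := ltn_ord i; lia. Qed.
(** The tail consists of the corner, place a - 1, and the b places of the leg. *)
Definition tailp (i : 'I_b.+1) : 'I_r := Ordinal (tailp_subproof i).

Definition tail_perm (s : 'S_b.+1) (p : 'I_r) : 'I_r :=
  if (p < a.-1)%N then p else tailp (s (inord (p - a.-1))).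

Definition tail_act w (s : 'S_b.+1) : mindex n r := [ffun p => w (tail_perm s p)].

(* The coordinates of the embedding of Delta(a, 1^b) in D_(a-1) (x) /\^(b+1). *)
Definition tail_alt w (f : mindex n r -> int) : int :=
  \sum_(s : 'S_b.+1) (-1) ^+ s * f (tail_act w s).

Lemma tail_permE s i : tail_perm s (tailp i) = tailp (s i).
Proof.
rewrite /tail_perm /= ltnNge leq_addr /=; congr (tailp (s _)).
by apply: val_inj; rewrite /= addKn inord_val.
Qed.

Lemma tailp_surj (p : 'I_r) : (a.-1 <= p)%N -> exists i, p = tailp i.
Proof.
move=> ap; have pb : (p - a.-1 < b.+1)%N by have := ltn_ord p; lia.
by exists (Ordinal pb); apply: val_inj => /=; lia.
Qed.

Lemma tailp_inj : injective tailp.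
Proof. by move=> i j /(congr1 val) /= /addnI/val_inj. Qed.

Lemma tail_alt_tperm (p q : 'I_r) (f : mindex n r -> int) w :
  (a.-1 <= p < q)%N -> (forall v, f (wact v (tperm p q)) = f v) -> tail_alt w f = 0.
Proof.
case/andP=> ap pq Hf.
have [i Ei] := tailp_surj ap.
have [j Ej] := tailp_surj (leq_trans ap (ltnW pq)).
have ij : i != j by apply: contraTneq pq => ij; rewrite Ei Ej ij ltnn.
suff E : tail_alt w f = - tail_alt w f by lia.
rewrite {1}/tail_alt (reindex_inj (mulgI (tperm i j))) /= -sumrN.
apply: eq_bigr => s _; rewrite odd_permM odd_tperm ij signr_addb expr1 mulN1r mulNr.
congr (- (_ * _)); rewrite -(Hf (tail_act w s)); congr f; apply/ffunP => x.
rewrite !ffunE; congr (w _); case: (ltnP x a.-1) => xa.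
  rewrite tpermD; first by rewrite /tail_perm xa.
    by apply: contraTneq xa => <-; rewrite -leqNgt.
  by apply: contraTneq xa => <-; rewrite -leqNgt (leq_trans ap (ltnW pq)).
have [k ->] := tailp_surj xa; rewrite Ei Ej !tail_permE.
rewrite permM; case: (tpermP i j k) => [->|->|/eqP ki /eqP kj].
- by rewrite tpermL tail_permE.
- by rewrite tpermR tail_permE.
- by rewrite tpermD ?(inj_eq tailp_inj) 1?eq_sym // tail_permE.
Qed.

Lemma tail_altD w f g : tail_alt w (fun v => f v + g v) = tail_alt w f + tail_alt w g.
Proof. by rewrite -big_split; apply: eq_bigr => s _; rewrite mulrDr. Qed.

Lemma tail_alt_sum w (I : Type) (l : seq I) (P : pred I) (F : I -> mindex n r -> int) :
  tail_alt w (fun v => \sum_(i <- l | P i) F i v) = \sum_(i <- l | P i) tail_alt w (F i).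
Proof. by rewrite exchange_big /=; apply: eq_bigr => s _; rewrite mulr_sumr. Qed.

Lemma tail_altMl w c f : tail_alt w (fun v => c * f v) = c * tail_alt w f.
Proof. by rewrite mulr_sumr; apply: eq_bigr => s _; rewrite mulrCA. Qed.

(** Without the cut i two adjacent tail places share a block. For i = 0 this is the Weyl relation,
    joining row and leg; for i > 0 it is a relation of the exterior power. *)
Lemma tail_alt_inv w (i : 'I_b) f : blk_inv [set~ i] f -> tail_alt w f = 0.
Proof.
move=> Hf; have lt : (a.-1 <= prv (cutp i) < cutp i)%N by rewrite /=; lia.
apply: (tail_alt_tperm w lt) => v; apply: Hf; apply: blkperm_tperm.
apply/eqP/blk_eqP => [|j]; first by case/andP: lt => _ /ltnW.
by rewrite !inE -(inj_eq val_inj) /=; lia.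
Qed.

Lemma perm_increasing m (s : 'S_m) :
  (forall i j : 'I_m, (i < j)%N -> (s i < s j)%N) -> s = 1%g.
Proof.
move=> Hs; have le (i j : 'I_m) : (i <= j)%N -> (s i + (j - i) <= s j)%N.
  case: j => j jm; elim: j jm => [|j IH] jm /=.
    rewrite leqn0 => /eqP i0; have -> : i = Ordinal jm by apply: val_inj.
    by rewrite /= subnn addn0.
  case: ltngtP => // [ij|ij] _; last first.
    have -> : i = Ordinal jm by apply: val_inj.
    by rewrite /= subnn addn0.
  have jm' : (j < m)%N by apply: ltnW.
  have := IH jm' ij; have := Hs (Ordinal jm') (Ordinal jm) (leqnn _).
  by rewrite /=; lia.
apply/permP => i; rewrite perm1; apply: val_inj => /=.
have m0 : (0 < m)%N by apply: leq_trans (ltn_ord i).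
have ml : (m.-1 < m)%N by lia.
have := le (Ordinal m0) i; have := le i (Ordinal ml); have := ltn_ord (s (Ordinal ml)).
by have := ltn_ord i; rewrite /=; lia.
Qed.

Lemma terminal_head w (p : 'I_r) : blk_sorted [set: 'I_b] w -> (p < a)%N ->
  (w (tailp ord0) <= w p)%N.
Proof.
move=> /(blk_sortedP a_gt0 a_le) sw pa.
have pt : (p <= tailp ord0)%N by rewrite /=; lia.
by apply: sw => //; apply/eqP/blk_eqP => // i _; rewrite /=; lia.
Qed.

Lemma terminal_tail w (i j : 'I_b.+1) : terminal w -> (i < j)%N ->
  (w (tailp i) < w (tailp j))%N.
Proof.
case/andP=> _ /eqP dw; case: j => j jb; elim: j jb => // j IH jb ij.
have jb' : (j < b)%N by [].
have lt : (w (tailp (Ordinal (ltnW jb))) < w (tailp (Ordinal jb)))%N.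
  have /setP/(_ (Ordinal jb')) := dw; rewrite !inE => /negbT; rewrite -ltnNge.
  have -> : cutp (Ordinal jb') = tailp (Ordinal jb) by apply: val_inj => /=; lia.
  have -> : prv (tailp (Ordinal jb)) = tailp (Ordinal (ltnW jb)).
    by apply: val_inj => /=; lia.
  by [].
move: ij; rewrite /= ltnS leq_eqVlt => /orP[/eqP ij|ij].
  by have -> : i = Ordinal (ltnW jb) by apply: val_inj.
by apply: ltn_trans lt; apply: IH.
Qed.

Lemma blkperm_tail s (p : 'I_r) : blkperm [set: 'I_b] s -> (a <= p)%N -> s p = p.
Proof.
move=> /blkpermP Hs ap; apply: val_inj => /=.
have pb : (p - a < b)%N by have := ltn_ord p; lia.
case: (ltngtP (s p) p) => // lt.
  have /eqP/(blk_eqP _ (ltnW lt))/(_ (Ordinal pb)) := Hs p.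
  by rewrite inE /= => /(_ isT); lia.
have spb : (s p - a < b)%N by have := ltn_ord (s p); lia.
have /esym/eqP/(blk_eqP _ (ltnW lt))/(_ (Ordinal spb)) := Hs p.
by rewrite inE /= => /(_ isT); lia.
Qed.

Lemma blkperm_head s (p : 'I_r) : blkperm [set: 'I_b] s -> (p < a)%N -> (s p < a)%N.
Proof.
move=> Hs pa; rewrite ltnNge; apply/negP => asp.
have := blkperm_tail (blkpermV Hs) asp; rewrite permK => E.
by move: asp; rewrite -E leqNgt pa.
Qed.

(** Only the identity contributes to the alternating sum: if [tail_act w s] becomes terminal after
    sorting its head, then [s] is increasing. *)
Lemma tail_alt_terminal w f : blk_inv [set: 'I_b] f ->
  (forall v, blk_sorted [set: 'I_b] v -> ~~ terminal v -> f v = 0) ->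
  terminal w -> tail_alt w f = f w.
Proof.
move=> Hf f0 tw; have sw : blk_sorted [set: 'I_b] w by case/andP: tw.
have w1 : tail_act w 1%g = w.
  apply/ffunP => p; rewrite ffunE; congr (w _); case: (ltnP p a.-1) => pa.
    by rewrite /tail_perm pa.
  by have [i ->] := tailp_surj pa; rewrite tail_permE perm1.
rewrite /tail_alt (bigD1 1%g) //= odd_perm1 expr0 mul1r w1 big1 ?addr0 // => s s1.
suff -> : f (tail_act w s) = 0 by rewrite mulr0.
have [t Ht [st _]] := blk_sort a_gt0 a_le [set: 'I_b] (tail_act w s).
rewrite -(Hf t Ht); apply: f0 => //; apply: contra s1 => tv; apply/eqP.
set v := wact _ t in st tv.
have vE (i : 'I_b.+1) : (0 < i)%N -> v (tailp i) = w (tailp (s i)).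
  move=> i0; rewrite !ffunE blkperm_tail //=; first by rewrite tail_permE.
  by lia.
have lts (i j : 'I_b.+1) : (0 < i)%N -> (i < j)%N -> (s i < s j)%N.
  move=> i0 ij; rewrite ltnNge leq_eqVlt; apply/negP => /orP[/eqP/val_inj/perm_inj E|lt].
    by rewrite E ltnn in ij.
  have := terminal_tail tv ij; rewrite !vE ?(leq_ltn_trans (leq0n _) ij) //.
  by rewrite ltnNge ltnW // terminal_tail.
(* The corner letter of [w] is its least letter. If [s] moved it into the leg of [v], it would have
   to exceed the corner letter of [v]. *)
have s0 : s ord0 = ord0.
  apply/eqP/negPn/negP => s0; pose i := s^-1%g ord0.
  have i0 : (0 < i)%N.
    rewrite lt0n; apply: contra s0 => /eqP i0; apply/eqP.
    have Ei : i = ord0 by apply: val_inj.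
    by rewrite -{1}Ei /i permKV.
  have v0 : (w (tailp ord0) <= v (tailp ord0))%N.
    rewrite !ffunE; have : (t (tailp ord0) < a)%N by apply: blkperm_head => //=; lia.
    move: (t _) => q qa; case: (ltnP q a.-1) => qa'.
      by rewrite /tail_perm qa' terminal_head.
    have [j ->] := tailp_surj qa'; rewrite tail_permE.
    case: (posnP (s j)) => [sj|sj]; last by apply/ltnW/terminal_tail.
    by have -> : s j = ord0 by apply: val_inj.
  have := terminal_tail tv (i := ord0) (j := i) i0.
  by rewrite (vE i) // permKV ltnNge v0.
apply: perm_increasing => i j ij.
case: (posnP i) => [i0|i0]; last exact: lts.
have -> : i = ord0 by apply: val_inj.
rewrite s0 lt0n; apply/negP => /eqP sj.
have : s j = s ord0 by rewrite s0; apply: val_inj.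
by move=> /perm_inj E; rewrite E in ij.
Qed.

(** [terminal_reduction] leaves a remainder that, among sorted words, lives on terminal ones; there
    the alternation reads off the values of the remainder. *)
Lemma tail_alt_detect f : blk_inv [set: 'I_b] f ->
  (forall w, terminal w -> tail_alt w f = 0) ->
  exists2 g : 'I_b -> mindex n r -> int,
    forall i, blk_inv [set~ i] (g i) & forall w, f w = \sum_i g i w.
Proof.
move=> Hf f0; have [g Hg E] := terminal_reduction Hf.
exists g => // w; apply/eqP; rewrite -subr_eq0; apply/eqP; move: w.
pose f' w := f w - \sum_i g i w.
have Hg' : blk_inv [set: 'I_b] (fun w => \sum_i g i w).
  by move=> s Hs w; apply: eq_bigr => i _; apply: Hg; apply: blkperm_sub Hs.
have Hf' : blk_inv [set: 'I_b] f' by move=> s Hs w; rewrite /f' Hf // Hg'.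
have f'0 w : blk_sorted [set: 'I_b] w -> ~~ terminal w -> f' w = 0.
  by move=> sw tw; rewrite /f' E ?subrr.
apply: (blk_inv_eq0 a_gt0 a_le Hf') => w sw.
have [tw|/f'0->//] := boolP (terminal w).
rewrite -(tail_alt_terminal Hf' f'0 tw).
transitivity (tail_alt w f - tail_alt w (fun w => \sum_i g i w)).
  by rewrite -sumrB; apply: eq_bigr => s _; rewrite mulrBr.
rewrite f0 // tail_alt_sum big1 ?subr0 // => i _.
exact: tail_alt_inv (Hg i).
Qed.

End CubeCorollaries.

(** * Hook Weyl modules by coordinates *)

Section HookClass.
Local Open Scope ring_scope.
Variables (n r a : nat).
Hypotheses (a_gt0 : (0 < a)%N) (a_le : (a <= r)%N).
Local Notation b := (r - a)%N.
Implicit Types (v w : mindex n r) (D : {set 'I_b}).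

Local Notation tail_alt := (tail_alt a_gt0 a_le).

Definition tens (f : mindex n r -> int) : tensor n r := \col_i f (enum_val i).

Lemma tensE f i : tcoef (tens f) i = f i.
Proof. by rewrite /tcoef mxE enum_rankK. Qed.

Lemma tcoef_sum (I : Type) (l : seq I) (P : pred I) (E : I -> tensor n r) w :
  tcoef (\sum_(i <- l | P i) E i) w = \sum_(i <- l | P i) tcoef (E i) w.
Proof. by elim/big_rec2: _ => [|i x y _ <-]; rewrite ?tcoef0 ?tcoefD. Qed.

(** Needed for c = a and c = a + 1, the two divided powers in the presentation of the Weyl module: D
    cuts before the place c and before every later one. *)
Lemma perm_on_blkperm (c : nat) D (s : 'S_r) :
  (forall i, (i \in D) = (c <= a + i)%N) -> (a <= c)%N ->
  perm_on [set p : 'I_r | (p < c)%N] s = blkperm D s.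
Proof.
move=> DE ac; have blkE (p q : 'I_r) : (p <= q)%N ->
    (blk D p == blk D q) = (p == q) || (q < c)%N.
  move=> pq; apply/(blk_eqP _ pq)/idP => [H|/orP[/eqP->|qc] i].
  - case: (ltnP q c) => qc; rewrite ?orbT // orbF -val_eqE /= eqn_leq pq leqNgt.
    apply/negP => lt; have qb : (q - a < b)%N by have := ltn_ord q; lia.
    by have := H (Ordinal qb); rewrite DE /=; lia.
  - by move=> _; lia.
  by rewrite DE; lia.
apply/idP/blkpermP => [Hs p|Hs].
  have [pc|pc] := ltnP p c.
    have := perm_closed p Hs; rewrite !inE pc => spc.
    apply/eqP; case: (leqP (s p) p) => lt; first by rewrite blkE // pc orbT.
    by rewrite eq_sym blkE ?(ltnW lt) // spc orbT.
  by rewrite (out_perm Hs) // inE -leqNgt.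
apply/subsetP => p; rewrite !inE => sp; rewrite ltnNge; apply: contra sp => cp.
have /eqP := Hs p; case: (leqP (s p) p) => lt; first by rewrite blkE // ltnNge cp orbF.
rewrite eq_sym blkE ?(ltnW lt) // eq_sym => /orP[//|].
by rewrite ltnNge (leq_trans cp) // ltnW.
Qed.

Lemma sym_blk_inv c D (t : tensor n r) :
  (forall i, (i \in D) = (c <= a + i)%N) -> (a <= c)%N ->
  t \in sym c <-> blk_inv D (tcoef t).
Proof.
move=> DE ac; split=> [/symP Ht s|Ht].
  by rewrite -(perm_on_blkperm _ DE ac) => /Ht E w; rewrite -{2}E place_mxE.
apply/symP => s; rewrite (perm_on_blkperm _ DE ac) => Hs.
by apply: tcoefP => w; rewrite place_mxE; apply: Ht.
Qed.

Lemma sym_setT (t : tensor n r) : t \in sym a <-> blk_inv [set: 'I_b] (tcoef t).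
Proof. by apply: sym_blk_inv => // i; rewrite inE leq_addr. Qed.

Lemma tail_alt_pure w (v : 'I_r -> 'cV[int]_n) (p q : 'I_r) : (a <= p < q)%N ->
  v p = v q -> tail_alt w (tcoef (pure v)) = 0.
Proof.
move=> /andP[ap pq] E; apply: (@tail_alt_tperm _ _ _ a_gt0 a_le p q) => // [|u].
  by rewrite pq andbT; lia.
by rewrite -[in RHS](place_pure E) place_mxE.
Qed.

Lemma tail_alt_alt w (t : tensor n r) : alt a t -> tail_alt w (tcoef t) = 0.
Proof.
move=> [s Hs ->].
have -> : tail_alt w (tcoef (\sum_(x <- s) pure x.2 *~ x.1)) =
    \sum_(x <- s) tail_alt w (fun v => x.1 * tcoef (pure x.2) v).
  rewrite -tail_alt_sum; apply: eq_bigr => u _; congr (_ * _).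
  by rewrite tcoef_sum; apply: eq_bigr => x _; rewrite tcoefMz mulrC.
rewrite big_seq big1 // => x /Hs[p [q [cpq E]]].
by rewrite (tail_altMl a_gt0 a_le) (tail_alt_pure _ cpq E) mulr0.
Qed.

Lemma tail_alt_tcoefD w (t u : tensor n r) :
  tail_alt w (tcoef (t + u)) = tail_alt w (tcoef t) + tail_alt w (tcoef u).
Proof. by rewrite -tail_altD; apply: eq_bigr => s _; rewrite tcoefD. Qed.

Lemma tail_alt_tcoefN w (t : tensor n r) :
  tail_alt w (tcoef (- t)) = - tail_alt w (tcoef t).
Proof. by rewrite -sumrN; apply: eq_bigr => s _; rewrite tcoefN mulrN. Qed.

Lemma alt_blk_inv (i : 'I_b) (t : tensor n r) : (0 < i)%N ->
  blk_inv [set~ i] (tcoef t) -> alt a t.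
Proof.
move=> i0 Ht; have lt : (a <= prv (cutp i) < cutp i)%N by rewrite /=; lia.
apply: (alt_swap lt); apply: tcoefP => w; rewrite place_mxE.
apply: Ht; apply: blkperm_tperm.
apply/eqP/blk_eqP => [|j]; first by case/andP: lt => _ /ltnW.
by rewrite !inE -(inj_eq val_inj) /=; lia.
Qed.

Lemma mult_comultE (y : sym_tensor n r a.+1) :
  mult n r a (comult n r a (quot_proj (@sym_alt n r a.+1 a.+1) y)) =
  quot_proj (@sym_alt n r a a) (sym_incl y).
Proof.
transitivity (mult n r a (quot_proj (@sym_alt n r a a.+1) (sym_incl y))).
  by congr (mult n r a _); apply: (quot_mapE (@sym_incl_alt n r a)).
exact: (quot_mapE (@alt_le n r a)).
Qed.

Definition hook_class (t : sym_tensor n r a) : hook_weyl n r a :=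
  quot_proj _ (quot_proj _ t).

Fact hook_class_is_linear : linear hook_class.
Proof.
move=> A t u; rewrite /hook_class (quot_proj_is_linear (@sym_alt n r a a)).
exact: quot_proj_is_linear.
Qed.
HB.instance Definition _ := GRing.isLinear.Build (schur n r) (sym_tensor n r a)
  (hook_weyl n r a) *:%R hook_class hook_class_is_linear.

Lemma hook_class_surj (x : hook_weyl n r a) : hook_class (repr (repr x)) = x.
Proof. by rewrite /hook_class !quot_reprK. Qed.

Lemma hook_class_tail_alt t w : hook_class t = 0 -> tail_alt w (tcoef (sym_val t)) = 0.
Proof.
move=> /eqP; rewrite -(linear0 (quot_proj (@hook_rel n r a))) quot_projP subr0.
have aux (u v : sym_tensor n r a) : quot_proj (@sym_alt n r a a) u = quot_proj (@sym_alt n r a a) v ->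
    tail_alt w (tcoef (sym_val u)) = tail_alt w (tcoef (sym_val v)).
  move=> /eqP; rewrite quot_projP => /asboolP Huv.
  apply/eqP; rewrite -subr_eq0 -tail_alt_tcoefN -tail_alt_tcoefD; apply/eqP.
  exact: tail_alt_alt Huv.
have tail0 : tail_alt w (tcoef (sym_val (0 : sym_tensor n r a))) = 0.
  by rewrite /tail_alt big1 // => s _; rewrite tcoef0 mulr0.
rewrite unfold_in /hook_rel; case: ifPn => [ar /asboolP[y]|_ /eqP]; last first.
  by rewrite -(linear0 (quot_proj (@sym_alt n r a a))) => /aux ->.
rewrite -[y]quot_reprK mult_comultE => /aux <-.
have b0 : (0 < b)%N by lia.
apply: (@tail_alt_inv _ _ _ a_gt0 a_le _ (Ordinal b0)).
apply/(@sym_blk_inv a.+1) => [i|//|]; last exact: valP (repr y).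
by rewrite !inE -(inj_eq val_inj) /=; lia.
Qed.

(** Of the summands given by [tail_alt_detect], the one lacking the cut 0 comes from D_(a+1) and is
    a Weyl relation; the others are symmetric in two leg places and vanish in the exterior power. *)
Lemma hook_class_eq0 t :
  (forall w, terminal a w -> tail_alt w (tcoef (sym_val t)) = 0) ->
  hook_class t = 0.
Proof.
move=> Ht; have st := (sym_setT _).1 (valP t).
have [g Hg E] := tail_alt_detect st Ht.
apply/eqP; rewrite -(linear0 (quot_proj (@hook_rel n r a))) quot_projP subr0.
rewrite unfold_in /hook_rel; case: ifPn => [ar|ar]; last first.
  (* Without a leg there are no cuts, so the sum in [E] is empty. *)
  apply/eqP; suff -> : t = 0 by rewrite linear0.
  apply: val_inj; apply: tcoefP => w; rewrite tcoef0 E big1 // => i _.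
  by have := ltn_ord i; lia.
have b0 : (0 < b)%N by lia.
have Hy : tens (g (Ordinal b0)) \in sym a.+1.
  apply/(@sym_blk_inv a.+1 [set~ (Ordinal b0)]) => //.
    by move=> i; rewrite !inE -(inj_eq val_inj) /=; lia.
  by move=> s Hs w; rewrite !tensE Hg.
apply/asboolP; exists (quot_proj _ (SymTensor Hy)).
rewrite mult_comultE; apply/eqP; rewrite quot_projP; apply/asboolP.
have -> : sym_val (sym_incl (SymTensor Hy) - t) =
    - (\sum_(i | i != Ordinal b0) tens (g i)).
  apply: tcoefP => w; rewrite tcoefN tcoef_sum /=.
  rewrite -[LHS]/(tcoef (tens (g (Ordinal b0)) - sym_val t) w).
  rewrite tcoefD tcoefN E (bigD1 (Ordinal b0)) //= tensE opprD addNKr.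
  by congr (- _); apply: eq_bigr => i _; rewrite tensE.
rewrite -sumrN; apply: alt_sum => i; rewrite -(inj_eq val_inj) /= => i0.
have Hi : blk_inv [set~ i] (tcoef (tens (g i))) by move=> s Hs w; rewrite !tensE Hg.
rewrite -mulrN1z; apply: altMz; apply: alt_blk_inv Hi; lia.
Qed.

Definition hook_tail w (x : hook_weyl n r a) : int :=
  tail_alt w (tcoef (sym_val (repr (repr x)))).

Lemma hook_tailE w t : hook_tail w (hook_class t) = tail_alt w (tcoef (sym_val t)).
Proof.
apply/eqP; rewrite /hook_tail -subr_eq0 -tail_alt_tcoefN -tail_alt_tcoefD.
apply/eqP; apply: (hook_class_tail_alt (t := repr (repr (hook_class t)) - t)).
by rewrite linearB /= hook_class_surj subrr.
Qed.

Fact hook_tail_is_zmod_morphism w : zmod_morphism (hook_tail w).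
Proof.
move=> x y; rewrite -[x]hook_class_surj -[y]hook_class_surj -linearB !hook_tailE.
by rewrite -tail_alt_tcoefN -tail_alt_tcoefD.
Qed.
HB.instance Definition _ w := GRing.isZmodMorphism.Build (hook_weyl n r a) int
  (hook_tail w) (hook_tail_is_zmod_morphism w).

Lemma hook_eq0 (x : hook_weyl n r a) :
  (forall w, terminal a w -> hook_tail w x = 0) -> x = 0.
Proof.
by move=> H; rewrite -[x]hook_class_surj; apply: hook_class_eq0.
Qed.

End HookClass.

(** * The resolution by tensor products of divided powers *)

Section SchurEntries.
Local Open Scope ring_scope.
Variables (n r : nat).
Implicit Types (v w : mindex n r).

Definition entry (M : 'M[int]_#|{: mindex n r}|) v w := M (enum_rank v) (enum_rank w).

Lemma sum_rank (F : 'I_#|{: mindex n r}| -> int) :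
  \sum_k F k = \sum_(w : mindex n r) F (enum_rank w).
Proof.
rewrite (reindex (@enum_rank {: mindex n r})) //=.
exact/onW_bij/enum_rank_bij.
Qed.

Lemma entryP M M' : (forall v w, entry M v w = entry M' v w) -> M = M'.
Proof.
move=> E; apply/matrixP => i j; rewrite -[i]enum_valK -[j]enum_valK.
exact: E.
Qed.

Lemma entry_mul M M' v w : entry (M *m M') v w = \sum_u entry M v u * entry M' u w.
Proof. by rewrite /entry mxE sum_rank. Qed.

Lemma tcoef_mul M (t : tensor n r) w :
  tcoef (M *m t) w = \sum_u entry M w u * tcoef t u.
Proof. by rewrite /tcoef mxE sum_rank. Qed.

Lemma tcoef_scale (A : schur n r) (t : tensor n r) w :
  tcoef (A *: t) w = \sum_u entry A w u * tcoef t u.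
Proof. exact: tcoef_mul. Qed.

Lemma entry_place s v w : entry (place_mx n s) v w = (w == wact v s)%:R.
Proof. by rewrite /entry mxE !enum_rankK. Qed.

Lemma schur_entryP M :
  reflect (forall s v w, entry M (wact v s) (wact w s) = entry M v w)
          (M \in @schur_pred n r).
Proof.
have E1 s v w : entry (M *m place_mx n s) v (wact w s) = entry M v w.
  rewrite entry_mul (bigD1 w) //= entry_place eqxx mulr1 big1 ?addr0 // => u uw.
  rewrite entry_place; case: eqVneq => [E|]; last by rewrite mulr0.
  by move: uw; rewrite -[u](wactK u s) -E wactK eqxx.
have E2 s v w : entry (place_mx n s *m M) v w = entry M (wact v s) w.
  rewrite entry_mul (bigD1 (wact v s)) //= entry_place eqxx mul1r big1 ?addr0 // => u uw.
  by rewrite entry_place (negbTE uw) mul0r.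
apply: (iffP (schurP M)) => H s.
  by move=> v w; rewrite -E2 -H E1.
apply: entryP => v w; rewrite -[w](wactK w s^-1) invgK E1 E2.
by rewrite H.
Qed.

Lemma schur_entry (A : schur n r) s v w : entry A (wact v s) (wact w s) = entry A v w.
Proof. by case: A => A HA /=; apply: (schur_entryP A). Qed.

End SchurEntries.

Section CubeResolution.
Local Open Scope ring_scope.
Variables (n r a : nat).
Local Notation b := (r - a)%N.
Implicit Types (v w : mindex n r) (D : {set 'I_b}).

Lemma blk_inv_place D (t : tensor n r) :
  blk_inv D (tcoef t) <-> forall s, blkperm D s -> place_mx n s *m t = t.
Proof.
split=> Ht s /Ht H; last by move=> w; rewrite -[in RHS]H place_mxE.
by apply: tcoefP => w; rewrite place_mxE; apply: H.
Qed.

(** Families over all cut sets, zero off the degree #|D| = b - i, avoid a product over an index type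
    depending on i. *)
Definition cube_pred (i : nat) : {pred {ffun {set 'I_b} -> tensor n r}} :=
  fun f => `[< (forall D, blk_inv D (tcoef (f D))) /\
               forall D, (#|D| + i != b)%N -> f D = 0 >].

Fact cube_submod_closed i : submod_closed (cube_pred i).
Proof.
split.
  apply/asboolP; split=> D; last by rewrite ffunE.
  by move=> s _ w; rewrite ffunE !tcoef0.
move=> A f g /asboolP[Hf f0] /asboolP[Hg g0]; apply/asboolP; split=> D.
  apply/blk_inv_place => s Hs; rewrite !ffunE mulmxDr.
  rewrite (blk_inv_place D (g D)).1 //; congr (_ + _).
  rewrite -[A *: f D]/(schur_mx A *m f D) mulmxA -schur_comm -mulmxA.
  by rewrite (blk_inv_place D (f D)).1.
by move=> DN; rewrite !ffunE f0 // g0 // scaler0 addr0.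
Qed.
HB.instance Definition _ i := GRing.isSubmodClosed.Build (schur n r)
  {ffun {set 'I_b} -> tensor n r} (cube_pred i) (cube_submod_closed i).

Record cube i := Cube { cube_fun : {ffun {set 'I_b} -> tensor n r};
                        _ : cube_fun \in cube_pred i }.
HB.instance Definition _ i := [isSub for @cube_fun i].
HB.instance Definition _ i := [Choice of cube i by <:].
HB.instance Definition _ i := [SubChoice_isSubLmodule of cube i by <:].

Lemma cube_inv i (x : cube i) D : blk_inv D (tcoef (cube_fun x D)).
Proof. by case: x => f /= /asboolP[H _]; apply: H. Qed.

Lemma cube_supp i (x : cube i) D : (#|D| + i != b)%N -> cube_fun x D = 0.
Proof. by case: x => f /= /asboolP[_]; apply. Qed.

Lemma cube_eqP i (x y : cube i) : (forall D, cube_fun x D = cube_fun y D) -> x = y.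
Proof. by move=> E; apply/val_inj/ffunP. Qed.

Lemma cube_funP i A (x y : cube i) D :
  cube_fun (A *: x + y) D = A *: cube_fun x D + cube_fun y D.
Proof. by rewrite -[LHS]/((A *: cube_fun x + cube_fun y) D) !ffunE. Qed.

Definition cube_bd i (x : cube i) : {ffun {set 'I_b} -> tensor n r} :=
  [ffun D : {set 'I_b} => \sum_(j in D) cube_fun x (D :\ j) *~ csgn D j].

Lemma tcoef_cube_bd i (x : cube i) D w :
  tcoef (cube_bd x D) w = cbd (fun D w => tcoef (cube_fun x D) w) D w.
Proof.
by rewrite ffunE tcoef_sum; apply: eq_bigr => j _; rewrite tcoefMz mulrC.
Qed.

Fact cube_d_subproof i (x : cube i.+1) : cube_bd x \in cube_pred i.
Proof.
apply/asboolP; split=> D.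
  by move=> s Hs w; rewrite !tcoef_cube_bd (cbd_inv (cube_inv x)).
move=> DN; rewrite ffunE big1 // => j jD; rewrite cube_supp ?mul0rz //.
by move: DN; rewrite (cardsD1 j D) jD; lia.
Qed.

Definition cube_d i (x : cube i.+1) : cube i := Cube (cube_d_subproof x).

Fact cube_d_is_linear i : linear (@cube_d i).
Proof.
move=> A x y; apply: cube_eqP => D; rewrite cube_funP /= !ffunE scaler_sumr.
rewrite -big_split /=; apply: eq_bigr => j _.
by rewrite cube_funP mulrzDl scalerMzr.
Qed.
HB.instance Definition _ i := GRing.isLinear.Build (schur n r) (cube i.+1) (cube i)
  *:%R (@cube_d i) (@cube_d_is_linear i).

Hypotheses (a_gt0 : (0 < a)%N) (a_le : (a <= r)%N).

Lemma cube_d_exact i (x : cube i.+1) :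
  cube_d x = 0 <-> exists y : cube i.+2, cube_d y = x.
Proof.
split=> [x0|[y <-]]; last first.
  apply: cube_eqP => D; apply: tcoefP => w; rewrite [LHS]tcoef_cube_bd.
  rewrite [cube_fun 0]/(0 : {ffun _ -> tensor n r}) ffunE tcoef0.
  rewrite -[RHS](cbd_cbd a_gt0 a_le (fun D w => tcoef (cube_fun y D) w) D w).
  by apply: eq_bigr => j _; rewrite tcoef_cube_bd.
have [//|D|D w DN|D w|g [Hg g0 E]] := @cube_exact n r a a_gt0 a_le i.+1
    (fun D w => tcoef (cube_fun x D) w).
- exact: cube_inv.
- by rewrite cube_supp // tcoef0.
- by rewrite -tcoef_cube_bd -[cube_bd x]/(cube_fun (cube_d x)) x0 ffunE tcoef0.
have Hy : [ffun D => tens (g D)] \in cube_pred i.+2.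
  apply/asboolP; split=> D; last first.
    by move=> DN; rewrite ffunE; apply: tcoefP => w; rewrite tensE tcoef0 g0.
  by move=> s Hs w; rewrite ffunE !tensE Hg.
exists (Cube Hy); apply: cube_eqP => D; apply: tcoefP => w.
rewrite [LHS]tcoef_cube_bd E; apply: eq_bigr => j _.
by rewrite /= ffunE tensE.
Qed.

Fact cube_aug_subproof (x : cube 0) : cube_fun x setT \in @sym n r a.
Proof. by apply/(sym_setT a_gt0 a_le)/cube_inv. Qed.

Definition cube_top (x : cube 0) : sym_tensor n r a := SymTensor (cube_aug_subproof x).

Fact cube_top_is_linear : linear cube_top.
Proof. by move=> A x y; apply: val_inj; rewrite /= cube_funP. Qed.
HB.instance Definition _ := GRing.isLinear.Build (schur n r) (cube 0)
  (sym_tensor n r a) *:%R cube_top cube_top_is_linear.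

Definition cube_aug : {linear cube 0 -> hook_weyl n r a} :=
  @hook_class n r a \o cube_top.

Lemma cube_top_surj t : exists x, cube_top x = t.
Proof.
have Hx : [ffun D : {set 'I_b} => if D == setT then sym_val t else 0] \in cube_pred 0.
  apply/asboolP; split=> D; rewrite ffunE; case: (eqVneq D setT) => [->|DT] //.
  - by apply/(sym_setT a_gt0 a_le)/valP.
  - by move=> s _ w; rewrite !tcoef0.
  - by rewrite cardsT card_ord addn0 eqxx.
by exists (Cube Hx); apply: val_inj; rewrite /= ffunE eqxx.
Qed.

Lemma cube_aug_surj m : exists x, cube_aug x = m.
Proof.
have [x Ex] := cube_top_surj (repr (repr m)).
by exists x; rewrite /= Ex hook_class_surj.
Qed.

Lemma cube_aug_exact x : cube_aug x = 0 <-> exists y : cube 1, cube_d y = x.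
Proof.
split=> [x0|[y <-]].
  have [|g Hg E] := tail_alt_detect (a_gt0 := a_gt0) (a_le := a_le)
      (cube_inv x (D := setT)).
    move=> w _; exact: (hook_class_tail_alt a_gt0 a_le w x0).
  (* In degree 1 the cut sets are the complements of single cuts; the sign cancels that of the
     differential. *)
  pose y D : tensor n r := if [pick j | j \notin D] is Some j then
    if D == [set~ j] then tens (g j) *~ csgn setT j else 0 else 0.
  have yE j : y [set~ j] = tens (g j) *~ csgn setT j.
    rewrite /y; case: pickP => [k|/(_ j)]; last by rewrite !inE eqxx.
    by rewrite !inE negbK => /eqP ->; rewrite eqxx.
  have Hy : [ffun D => y D] \in cube_pred 1.
    apply/asboolP; split=> D.
      rewrite ffunE /y; case: pickP => [j _|_]; last by move=> s _ w; rewrite !tcoef0.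
      case: eqP => [->|_]; last by move=> s _ w; rewrite !tcoef0.
      by move=> s Hs w; rewrite !tcoefMz !tensE Hg.
    move=> DN; rewrite ffunE /y; case: pickP => [j _|//]; case: eqP => // DE.
    by move: DN; rewrite DE; have := cardsC1 j; rewrite card_ord; have := ltn_ord j; lia.
  exists (Cube Hy); apply: cube_eqP => D; apply: tcoefP => w.
  have [->|DT] := eqVneq D setT; last first.
    rewrite !cube_supp //= addn0; apply: contraNneq DT => Db;
    by rewrite eqEcard subsetT cardsT card_ord Db leqnn.
  rewrite [LHS]tcoef_cube_bd E; apply: eq_big => [j|j _]; first by rewrite inE.
  by rewrite /= ffunE setTD yE tcoefMz tensE mulrCA csgnM mulr1.
apply: (@hook_class_eq0 _ _ _ a_gt0 a_le (cube_top (cube_d y))) => w _ /=.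
transitivity (tail_alt a_gt0 a_le w (fun w => cbd (fun D w => tcoef (cube_fun y D) w) setT w)).
  by apply: eq_bigr => s _; rewrite tcoef_cube_bd.
rewrite tail_alt_sum big1 // => j _; rewrite tail_altMl.
rewrite (@tail_alt_inv _ _ _ a_gt0 a_le w j) ?mulr0 // -setTD.
exact: cube_inv.
Qed.

Hypothesis b_lt : (b < n)%N.

Lemma wcut_subproof D p : (blk D p < n)%N.
Proof.
apply: leq_ltn_trans b_lt; apply: leq_trans (subset_leq_card (subsetT _)) _.
by rewrite cardsT card_ord.
Qed.

(* The generator e_0^{alpha_0} e_1^{alpha_1} ... of D_alpha, for the composition
   alpha of the block sizes of [D]. *)
Definition wcut D : mindex n r := [ffun p : 'I_r => Ordinal (wcut_subproof D p)].

Lemma wcut_stab D s : (wact (wcut D) s == wcut D) = blkperm D s.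
Proof.
apply/eqP/blkpermP => [/ffunP E p|E].
  by have := congr1 val (E p); rewrite !ffunE.
by apply/ffunP => p; apply: val_inj; rewrite !ffunE /= E.
Qed.

(** Sends the basis tensor of [wcut D] to [t], continues equivariantly along its orbit and kills all
    other basis tensors. It is well defined because the stabilizer of [wcut D] fixes [t]. *)
Definition proj_mx D (t : tensor n r) : 'M[int]_#|{: mindex n r}| :=
  \matrix_(i, j) if [pick s | wact (enum_val j) s == wcut D] is Some s
                 then tcoef t (wact (enum_val i) s) else 0.

Lemma proj_mxE D t s v w : blk_inv D (tcoef t) -> wact w s = wcut D ->
  entry (proj_mx D t) v w = tcoef t (wact v s).
Proof.
move=> Ht ws; rewrite /entry mxE !enum_rankK.
case: pickP => [u /eqP wu|/(_ s)]; last by rewrite ws eqxx.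
rewrite -[RHS](Ht (u * s^-1)%g) ?wactM ?mulgKV //.
by rewrite -wcut_stab -{1}ws wactM mulgKV wu.
Qed.

Lemma proj_mx0 D t v w : (forall s, wact w s != wcut D) -> entry (proj_mx D t) v w = 0.
Proof.
move=> H; rewrite /entry mxE !enum_rankK.
by case: pickP => [s|//]; rewrite (negbTE (H s)).
Qed.

Lemma proj_mx_schur D t : blk_inv D (tcoef t) -> proj_mx D t \in @schur_pred n r.
Proof.
move=> Ht; apply/schur_entryP => s v w.
have [[u wu]|none] := pselect (exists u, wact w u = wcut D).
  rewrite (proj_mxE v Ht wu) (@proj_mxE _ _ (u * s^-1)%g) //.
    by rewrite wactM mulgKV.
  by rewrite wactM mulgKV.
rewrite !proj_mx0 // => u; apply/eqP => E; apply: none; first by exists u.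
by exists (u * s)%g; rewrite -wactM.
Qed.

Definition proj_schur D t : schur n r := insubd (0 : schur n r) (proj_mx D t).

Lemma proj_schurE D t : blk_inv D (tcoef t) -> proj_schur D t = proj_mx D t :> 'M_ _.
Proof.
move=> Ht; rewrite -[LHS]/(val (proj_schur D t)) /proj_schur val_insubd.
by rewrite proj_mx_schur.
Qed.

Lemma proj_schur_wcut D t : blk_inv D (tcoef t) ->
  proj_schur D t *: tbasis (wcut D) = t.
Proof.
move=> Ht; apply: tcoefP => w; rewrite tcoef_scale proj_schurE //.
rewrite (bigD1 (wcut D)) //= tbasisE eqxx mulr1 big1 ?addr0.
  by rewrite (@proj_mxE _ _ 1%g) ?wact1.
by move=> u uw; rewrite tbasisE (negbTE uw) mulr0.
Qed.

(** With [proj_schur_wcut], this makes [proj_schur D] a linear section of the evaluation at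
    [tbasis (wcut D)]; so D_alpha is a direct summand of S(n,r). *)
Lemma proj_schur_linear D A t u : blk_inv D (tcoef t) -> blk_inv D (tcoef u) ->
  proj_schur D (A *: t + u) = A * proj_schur D t + proj_schur D u.
Proof.
move=> Ht Hu.
have Htu : blk_inv D (tcoef (A *: t + u)).
  apply/blk_inv_place => s Hs; rewrite mulmxDr ((blk_inv_place D u).1 Hu) //.
  rewrite -[A *: t]/(schur_mx A *m t) mulmxA -schur_comm -mulmxA.
  by rewrite ((blk_inv_place D t).1 Ht).
apply: val_inj; rewrite /= proj_schurE //.
rewrite -[RHS]/(schur_mx A *m schur_mx (proj_schur D t) + schur_mx (proj_schur D u)).
rewrite !proj_schurE //; apply: entryP => v w.
rewrite {2}/entry mxE -!/(entry _ _ _) entry_mul.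
have [[s ws]|none] := pselect (exists s, wact w s = wcut D).
  rewrite !(@proj_mxE _ _ s) // tcoefD tcoef_scale; congr (_ + _).
  have wact_inj : injective (fun x : mindex n r => wact x s).
    by move=> x y E; rewrite -[x](wactK x s) E wactK.
  rewrite (reindex_inj wact_inj) /=; apply: eq_bigr => x _.
  by rewrite schur_entry (@proj_mxE _ _ s).
have none' s : wact w s != wcut D by apply/eqP => E; apply: none; exists s.
rewrite !proj_mx0 // addr0 big1 // => x _.
by rewrite proj_mx0 // mulr0.
Qed.

Lemma wcut_inv D : blk_inv D (tcoef (tbasis (wcut D))).
Proof.
move=> s; rewrite -wcut_stab => /eqP Es w; rewrite !tbasisE; congr (_%:R); congr nat_of_bool.
apply/eqP/eqP => [E|->//].
by rewrite -[w](wactK w s) E -{1}Es wactK.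
Qed.

Definition cube_gen i D : cube i := insubd (0 : cube i)
  [ffun D' => if D' == D then tbasis (wcut D) else 0].

Lemma cube_genE i D D' : (#|D| + i)%N = b ->
  cube_fun (cube_gen i D) D' = if D' == D then tbasis (wcut D) else 0.
Proof.
move=> Db; rewrite -[cube_fun _]/(val (cube_gen i D)) val_insubd.
rewrite ifT ?ffunE //; apply/asboolP; split=> D''; rewrite ffunE.
  by case: eqP => [->|_]; [apply: wcut_inv | move=> s _ w; rewrite !tcoef0].
by case: (eqVneq D'' D) => [->|//]; rewrite Db eqxx.
Qed.

Section Hom.
Variables (i : nat) (N : lmodType (schur n r)) (u : {set 'I_b} -> N).

(** The values [u D] may be arbitrary: multiplication by [proj_schur] sees only their components of
    weight alpha. *)
Definition cube_hom (x : cube i) : N :=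
  \sum_(D : {set 'I_b} | (#|D| + i == b)%N) proj_schur D (cube_fun x D) *: u D.

Fact cube_hom_is_linear : linear cube_hom.
Proof.
move=> A x y; rewrite scaler_sumr -big_split; apply: eq_bigr => D _ /=.
by rewrite cube_funP proj_schur_linear ?scalerDl ?scalerA //; apply: cube_inv.
Qed.
HB.instance Definition _ := GRing.isLinear.Build (schur n r) (cube i) N *:%R
  cube_hom cube_hom_is_linear.
End Hom.

Lemma cube_homE i (N : lmodType (schur n r)) (f : {linear cube i -> N}) x :
  f x = cube_hom (fun D => f (cube_gen i D)) x.
Proof.
have {1}-> : x = \sum_(D : {set 'I_b} | (#|D| + i == b)%N)
    proj_schur D (cube_fun x D) *: cube_gen i D.
  apply: cube_eqP => D.
  have funS (P : pred {set 'I_b}) (F : {set 'I_b} -> cube i) :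
      cube_fun (\sum_(D' | P D') F D') D = \sum_(D' | P D') cube_fun (F D') D.
    apply: (big_ind2 (fun (x : cube i) y => cube_fun x D = y)) => //.
      by rewrite [LHS]ffunE.
    by move=> x1 x2 y1 y2 <- <-; rewrite -[x1]scale1r cube_funP !scale1r.
  have funZ A (y : cube i) : cube_fun (A *: y) D = A *: cube_fun y D.
    by rewrite -[A *: y]addr0 cube_funP [cube_fun 0 D]ffunE addr0.
  rewrite funS; case: (eqVneq (#|D| + i)%N b) => [Db|DN]; last first.
    rewrite cube_supp // big1 // => D' /eqP D'b; rewrite funZ cube_genE //.
    rewrite (_ : (D == D') = false) ?scaler0 //.
    by apply: contraNF DN => /eqP ->; apply/eqP.
  rewrite (bigD1 D) ?Db //= funZ cube_genE // eqxx proj_schur_wcut ?big1 ?addr0 //.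
    by move=> D' /andP[/eqP D'b D'D]; rewrite funZ cube_genE // eq_sym (negbTE D'D) scaler0.
  exact: cube_inv.
by rewrite linear_sum; apply: eq_bigr => D _; rewrite linearZ.
Qed.

Lemma cube_projective i : projective (cube i : lmodType (schur n r)).
Proof.
move=> V W g f gsurj; pose u D := projT1 (cid (gsurj (f (cube_gen i D)))).
exists (@cube_hom i V u) => x; rewrite [RHS]cube_homE [LHS]linear_sum.
apply: eq_bigr => D _; rewrite linearZ /=; congr (_ *: _).
by rewrite /u; case: (cid _).
Qed.

Definition cube_resolution : proj_resolution (hook_weyl n r a).
Proof.
apply: (@ProjResolution (schur n r) (hook_weyl n r a) cube
  (fun i => (@cube_d i : {linear cube i.+1 -> cube i})) cube_aug).
- exact: cube_projective.
- exact: cube_aug_surj.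
- exact: cube_aug_exact.
- move=> i x; exact: cube_d_exact.
Defined.

End CubeResolution.

(** * Terminal words of a given weight *)

Section BlockLetters.
Variables (r a : nat).
Hypothesis a_le : a <= r.
Local Notation b := (r - a).
Implicit Types D : {set 'I_b}.

Lemma blk_le_card D p : blk D p <= #|D|.
Proof. by apply/subset_leq_card/subsetP => i; rewrite inE => /andP[]. Qed.

Lemma blk_max D p : r <= p.+1 -> blk D p = #|D|.
Proof.
move=> rp; apply: eq_card => i; rewrite inE andb_idr // => _.
by have := ltn_ord i; lia.
Qed.

Lemma blkS D p : blk D p.+1 <= (blk D p).+1.
Proof.
have [/existsP[i /andP[iD /eqP Ei]]|/existsPn none] :=
    boolP [exists i in D, a + i == p.+1].
  rewrite [X in X <= _](cardsD1 i) !inE iD Ei leqnn ltnS.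
  apply/subset_leq_card/subsetP => j; rewrite !inE -(inj_eq val_inj) /=.
  by move=> /andP[ji /andP[-> jp]]; lia.
apply: leqW; apply/subset_leq_card/subsetP => j; rewrite !inE => /andP[jD jp].
by rewrite jD /=; have := none j; rewrite jD /=; lia.
Qed.

Lemma blk0 D : 0 < a -> blk D 0 = 0.
Proof. by move=> a0; apply/eqP; rewrite cards_eq0; apply/eqP/setP => i; rewrite !inE; lia. Qed.

Lemma blk_surj D l : 0 < a -> l <= #|D| -> exists p : 'I_r, blk D p = l.
Proof.
move=> a0 lD; have r0 : 0 < r by lia.
have ex : exists p, l <= blk D p by exists r.-1; rewrite blk_max //; lia.
case: (ex_minnP ex) => p lp pmin; have pr : p < r.
  have : p <= r.-1 by apply: pmin; rewrite blk_max //; lia.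
  lia.
exists (Ordinal pr); apply/eqP; rewrite eqn_leq lp andbT /=.
case: p lp pmin {pr} => [|p] lp pmin; first by rewrite blk0.
apply: leq_trans (blkS D p) _; rewrite ltnNge; apply/negP => lp'.
by have := pmin _ lp'; lia.
Qed.

Lemma blk_cut D (i : 'I_b) p : i \in D -> (blk D p < blk D (a + i)) = (p < a + i).
Proof.
move=> iD; case: (ltnP p (a + i)) => pi; last by rewrite ltnNge leq_blk.
rewrite ltn_neqAle (leq_blk D (ltnW pi)) andbT.
by apply/negP => /(blk_eqP D (ltnW pi))/(_ i iD); lia.
Qed.

Lemma cut_ex D l : 0 < a -> 0 < l <= #|D| ->
  exists2 i : 'I_b, i \in D & blk D (a + i) = l.
Proof.
move=> a0 /andP[l0 lD]; have ex : exists p, l <= blk D p by exists r; rewrite blk_max //; lia.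
case: (ex_minnP ex) => p lp pmin.
case: p lp pmin => [|p] lp pmin; first by rewrite blk0 // leqNgt l0 in lp.
have lt : blk D p < l by rewrite ltnNge; apply/negP => /pmin; lia.
have : blk D p != blk D p.+1 by rewrite neq_ltn (leq_trans lt).
move=> /(blk_eqP D (leqnSn p)) H; have [i iD pi] : exists2 i : 'I_b, i \in D & a + i = p.+1.
  apply: contrapT => none; apply: H => i iD; apply/negP => pi.
  by apply: none; exists i => //; lia.
exists i => //; rewrite pi; apply/eqP; rewrite eqn_leq lp andbT.
exact: leq_trans (blkS D p) lt.
Qed.

Lemma blkD1 D (i : 'I_b) p : i \in D ->
  blk (D :\ i) p = unbump (blk D (a + i)).-1 (blk D p).
Proof.
move=> iD; have pos : 0 < blk D (a + i).
  by apply/card_gt0P; exists i; rewrite !inE iD leqnn.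
rewrite /unbump prednK //; have -> : (blk D (a + i) <= blk D p) = (a + i <= p).
  by rewrite leqNgt blk_cut // -leqNgt.
rewrite /blk [in RHS](cardsD1 i) !inE iD addKn; apply: eq_card => j.
by rewrite !inE andbA.
Qed.

End BlockLetters.

Lemma perm_extend (T : finType) m (f g : 'I_m -> T) : injective f -> injective g ->
  exists s : {perm T}, forall i, s (g i) = f i.
Proof.
elim: m f g => [|m IH] f g fi gi; first by exists 1%g => -[].
have [||s Hs] := IH (f \o lift ord_max) (g \o lift ord_max).
- exact: inj_comp fi (@lift_inj _ _).
- exact: inj_comp gi (@lift_inj _ _).
exists (s * tperm (s (g ord_max)) (f ord_max))%g => i; rewrite permM.
case: (unliftP ord_max i) => [j|] ->; last by rewrite tpermL.
have E := Hs j; rewrite /= in E; rewrite E tpermD //.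
  by rewrite -E (inj_eq perm_inj) (inj_eq gi) neq_lift.
by rewrite (inj_eq fi) neq_lift.
Qed.

(** * Orbits under permutations of the head *)

Section HeadOrbit.
Variables (n r a : nat).
Hypotheses (a_gt0 : 0 < a) (a_le : a <= r).
Local Notation b := (r - a).
Implicit Types (v w : mindex n r).

Lemma card_act w s (P : pred 'I_n) :
  #|[set p | P (wact w s p)]| = #|[set p | P (w p)]|.
Proof.
rewrite -(card_imset _ (@perm_inj _ s)); apply: eq_card => p.
apply/imsetP/idP => [[q + ->]|]; rewrite !inE ?ffunE // => Hp.
by exists (s^-1%g p); rewrite ?inE ?ffunE permKV.
Qed.

Lemma card_head v w (P : pred 'I_n) :
  #|[set p | P (v p)]| = #|[set p | P (w p)]| ->
  (forall p : 'I_r, a <= p -> v p = w p) ->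
  #|[set p : 'I_r | (p < a) && P (v p)]| = #|[set p : 'I_r | (p < a) && P (w p)]|.
Proof.
pose H : {set 'I_r} := [set p : 'I_r | p < a].
rewrite -(cardsID H) -[in RHS](cardsID H) => E vw; move: E.
have -> : [set p | P (v p)] :\: H = [set p | P (w p)] :\: H.
  apply/setP => p; rewrite !inE -leqNgt; case: (leqP a p) => //= ap.
  by rewrite vw.
move/addIn => E; transitivity #|[set p | P (v p)] :&: H|.
  by apply: eq_card => p; rewrite !inE andbC.
by rewrite E; apply: eq_card => p; rewrite !inE andbC.
Qed.

Lemma blk_setT_head (p q : 'I_r) : p < a ->
  (blk [set: 'I_b] q == blk [set: 'I_b] p) = (q < a).
Proof.
move=> pa; have blkz (x : nat) : x < a -> blk [set: 'I_b] x = 0.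
  by move=> xa; apply/eqP; rewrite cards_eq0; apply/eqP/setP => i; rewrite !inE /=; lia.
rewrite (blkz p pa); case: (ltnP q a) => qa; first by rewrite blkz.
apply/negbTE; rewrite -lt0n; have qb : q - a < b by have := ltn_ord q; lia.
by apply/card_gt0P; exists (Ordinal qb); rewrite !inE /=; lia.
Qed.

Lemma blk_setT_tail (p q : 'I_r) : a <= p ->
  (blk [set: 'I_b] q == blk [set: 'I_b] p) = (q == p).
Proof.
move=> ap; have pb : p - a < b by have := ltn_ord p; lia.
have Ep : a + Ordinal pb = p by rewrite /= subnKC.
apply/eqP/eqP => [E|->//]; apply: val_inj => /=; apply/eqP; rewrite eqn_leq.
have nqp : p <= q by rewrite leqNgt -{1}Ep -(blk_cut a_le q (in_setT (Ordinal pb))) Ep E ltnn.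
rewrite nqp andbT leqNgt; apply/negP => pq.
have aq : a <= q by apply: leq_trans nqp.
have qb : q - a < b by have := ltn_ord q; lia.
have Eq : a + Ordinal qb = q by rewrite /= subnKC.
by have := blk_cut a_le p (in_setT (Ordinal qb)); rewrite Eq E ltnn pq.
Qed.

(** Both words sort to the same word, since the letter counts in the head determine its sorted
    form. *)
Lemma head_orbit v w :
  (forall p : 'I_r, a <= p -> v p = w p) ->
  (forall c, #|[set p : 'I_r | (p < a) && (c <= v p)]| =
             #|[set p : 'I_r | (p < a) && (c <= w p)]|) ->
  exists2 s, blkperm [set: 'I_b] s & v = wact w s.
Proof.
move=> vw E; have [s Hs [sv _]] := blk_sort a_gt0 a_le [set: 'I_b] v.
have [t Ht [sw _]] := blk_sort a_gt0 a_le [set: 'I_b] w.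
suff Est : wact v s = wact w t.
  exists (s^-1 * t)%g; first by rewrite blkpermM ?blkpermV.
  by rewrite -wactM -Est wactK.
have count_head (u : mindex n r) x c : blkperm [set: 'I_b] x ->
    #|[set p : 'I_r | (p < a) && (c <= wact u x p)]| =
    #|[set p : 'I_r | (p < a) && (c <= u p)]|.
  move=> Hx; rewrite -(card_imset _ (@perm_inj _ x)); apply: eq_card => p.
  apply/imsetP/idP => [[q + ->]|].
    by rewrite !inE ffunE => /andP[qa ->]; rewrite (blkperm_head a_gt0 a_le Hx qa).
  rewrite inE => /andP[pa Hp]; exists (x^-1%g p); rewrite ?permKV // inE ffunE permKV Hp.
  by rewrite (blkperm_head a_gt0 a_le (blkpermV Hx) pa).
apply: (blk_sorted_inj a_gt0 a_le sv sw) => p c; case: (ltnP p a) => pa.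
  transitivity #|[set q : 'I_r | (q < a) && (c <= wact v s q)]|.
    by apply: eq_card => q; rewrite !inE blk_setT_head.
  rewrite count_head // E -(@count_head w t) //.
  by apply: eq_card => q; rewrite !inE blk_setT_head.
apply: eq_card => q; rewrite !inE blk_setT_tail //; case: eqP => //= ->.
by rewrite !ffunE !(blkperm_tail a_gt0 a_le) // vw.
Qed.

End HeadOrbit.

Section TerminalWords.
Variables (n r a a' : nat).
Hypotheses (a_gt0 : 0 < a) (a_le : a <= a') (a'_le : a' <= r) (b_lt : r - a < n).
Local Notation b := (r - a).
Local Notation c := (r - a').
Implicit Types (v w : mindex n r) (D : {set 'I_b}).

Lemma head_gt0 : 0 < a'. Proof. exact: leq_trans a_le. Qed.
Lemma base_le : a <= r. Proof. exact: leq_trans a'_le. Qed.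

Local Notation a'_gt0 := head_gt0.
Local Notation a_ler := base_le.
Local Notation tailp := (tailp a'_gt0 a'_le).
Local Notation wcut := (wcut b_lt).

(** That is, [w] has weight alpha: the letter l occurs as often as the block l has places. *)
Definition cut_orbit D w := [exists s, wact (wcut D) s == w].

Lemma cut_orbit_le D w p : cut_orbit D w -> w p <= #|D|.
Proof. by move=> /existsP[s /eqP <-]; rewrite !ffunE /= blk_le_card. Qed.

Lemma cut_orbit_surj D w l : cut_orbit D w -> l <= #|D| -> exists p, w p = l :> nat.
Proof.
move=> /existsP[s /eqP <-] /(blk_surj a_ler a_gt0)[p Ep].
by exists (s^-1%g p); rewrite !ffunE permKV.
Qed.

Lemma cut_orbit_act D w s : cut_orbit D (wact w s) = cut_orbit D w.
Proof.
apply/existsP/existsP => -[t /eqP E].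
  by exists (s^-1 * t)%g; rewrite -wactM E wactK.
by exists (s * t)%g; rewrite -wactM E.
Qed.

Lemma cut_orbit_count D w (P : pred nat) : cut_orbit D w ->
  #|[set p | P (w p)]| = #|[set p : 'I_r | P (blk D p)]|.
Proof.
move=> /existsP[s /eqP <-]; rewrite (card_act _ s (fun x => P x)).
by apply: eq_card => p; rewrite !inE ffunE.
Qed.

Lemma terminalP w : terminal a' w <->
  blk_sorted [set: 'I_c] w /\
  forall i j : 'I_c.+1, i < j -> w (tailp i) < w (tailp j).
Proof.
split=> [tw|[sw tw]]; first by split=> [|i j]; [case/andP: tw | apply: terminal_tail].
rewrite /terminal sw; apply/eqP/setP => i; rewrite !inE; apply/negbTE; rewrite -ltnNge.
have ic : i < c.+1 by apply: ltnW; apply: ltn_ord.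
have -> : cutp i = tailp (lift ord0 i).
  by apply: val_inj; rewrite /= /bump leq0n; have := a'_gt0; lia.
have -> : prv (tailp (lift ord0 i)) = tailp (Ordinal ic).
  by apply: val_inj; rewrite /= /bump leq0n; lia.
exact: tw.
Qed.

(** The tail is a strictly increasing sequence of c + 1 letters between 0 and #|D|, so its slack is
    #|D| - c. Negative slack is impossible; slack 0 and slack 1 describe the two degrees that
    matter. *)
Lemma tail_letter_bounds w D (i : 'I_c.+1) : terminal a' w -> cut_orbit D w ->
  i <= w (tailp i) /\ w (tailp i) + (c - i) <= #|D|.
Proof.
move=> /terminalP[_ tw] wD.
have step (x y : 'I_c.+1) : x <= y -> w (tailp x) + (y - x) <= w (tailp y).
  case: y => j jc; elim: j jc => [|j IH] jc /= ij.
    have -> : x = Ordinal jc by apply: val_inj => /=; lia.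
    by rewrite /= subnn addn0.
  case: ltngtP ij => // [ij|ij] _; last first.
    have -> : x = Ordinal jc by apply: val_inj.
    by rewrite /= subnn addn0.
  have jc' : j < c.+1 by apply: ltnW.
  have := IH jc' ij; have := tw (Ordinal jc') (Ordinal jc) (leqnn _).
  by rewrite /=; lia.
split; first by have := step ord0 i (leq0n _); rewrite /=; lia.
have ic : i <= @ord_max c by rewrite -ltnS.
by apply: leq_trans (step i ord_max ic) (cut_orbit_le _ wD).
Qed.

Lemma terminal_corner w D : terminal a' w -> cut_orbit D w -> w (tailp ord0) = 0 :> nat.
Proof.
move=> tw wD; have [p wp] := cut_orbit_surj wD (leq0n _).
case: (ltnP p a') => pa.
  apply/eqP; rewrite -leqn0 -wp; apply: terminal_head => //.
  by case/andP: tw.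
have [|i Ei] := @tailp_surj _ _ a'_gt0 a'_le p; first by lia.
move: wp; rewrite Ei => wi; case: (posnP i) => i0.
  by rewrite -wi; congr (w (tailp _)); apply: val_inj.
by have := (terminalP w).1 tw; case=> _ /(_ ord0 i i0); rewrite wi.
Qed.

Lemma terminal_card w D : terminal a' w -> cut_orbit D w -> c <= #|D|.
Proof.
move=> tw wD; have := tail_letter_bounds ord0 tw wD.
by rewrite /= subn0 => -[_]; apply: leq_trans; rewrite leq_addl.
Qed.

Lemma terminal_tail_id w D i : #|D| = c -> terminal a' w -> cut_orbit D w ->
  w (tailp i) = i :> nat.
Proof.
move=> Dc tw wD; have := tail_letter_bounds i tw wD; rewrite Dc.
by have := ltn_ord i; lia.
Qed.

(** With slack 1 the tail skips one letter [s], which is not 0 because 0 stands in the corner. The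
    case s = c + 1 means that the last letter is skipped. *)
Lemma terminal_tail_bump w D : #|D| = c.+1 -> terminal a' w -> cut_orbit D w ->
  exists2 s, 0 < s <= c.+1 & forall i, w (tailp i) = bump s i :> nat.
Proof.
move=> Dc tw wD.
have bd (i : 'I_c.+1) : i <= w (tailp i) <= i.+1.
  by have := tail_letter_bounds i tw wD; rewrite Dc; have := ltn_ord i; lia.
(* [s] is the least index from which on no tail letter equals its index. *)
have ex : exists s, [forall i : 'I_c.+1, (s <= i) ==> (w (tailp i) != i :> nat)].
  by exists c.+1; apply/forallP => i; rewrite leqNgt ltn_ord.
case: (ex_minnP ex) => s /forallP Hs smin.
have sc : s <= c.+1.
  by apply: smin; apply/forallP => i; rewrite leqNgt ltn_ord.
exists s; last first.
  move=> i; rewrite /bump; case: (leqP s i) => si.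
    by have := bd i; have := Hs i; rewrite si /=; lia.
  have [j /andP[ij /eqP Ej]] : exists j : 'I_c.+1, (i <= j) && (w (tailp j) == j :> nat).
    apply/existsP; apply: contraT; rewrite negb_exists => /forallP none.
    have : s <= i; last by rewrite leqNgt si.
    by apply: smin; apply/forallP => j; apply/implyP => ij; have := none j; rewrite ij.
  case: (ltngtP i j) ij => // [ij|/val_inj Eij] _; last by rewrite Eij Ej.
  have : w (tailp i) + (j - i) <= w (tailp j).
    have := tail_letter_bounds i tw wD.
    case: (j) ij => j' jc' /=; rewrite /= => ij'.
    elim: j' jc' ij' => // j' IH jc' ij'.
    have jc : j' < c.+1 by apply: ltnW.
    have := (terminalP w).1 tw; case=> _ /(_ (Ordinal jc) (Ordinal jc') (leqnn _)).
    move: ij'; rewrite ltnS leq_eqVlt => /orP[/eqP Eij|ij'].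
      have -> : i = Ordinal jc by apply: val_inj.
      by rewrite /=; lia.
    by move=> lt H; have := IH jc ij' H; lia.
  by rewrite Ej; have := bd i; lia.
rewrite sc andbT lt0n; apply/negP => /eqP s0.
by have := Hs ord0; rewrite s0 /= (terminal_corner tw wD).
Qed.

Lemma terminal_uniq v w D : #|D| = c -> terminal a' v -> terminal a' w ->
  cut_orbit D v -> cut_orbit D w -> v = w.
Proof.
move=> Dc tv tw vD wD.
have vw (p : 'I_r) : a' <= p -> v p = w p.
  move=> ap; have [|i ->] := @tailp_surj _ _ a'_gt0 a'_le p; first by lia.
  by apply: val_inj; rewrite /= !(terminal_tail_id _ Dc).
have [s Hs E] := head_orbit a'_gt0 a'_le vw (fun x =>
  card_head (P := fun y => x <= y) (etrans (cut_orbit_count (fun y => x <= y) vD)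
    (esym (cut_orbit_count (fun y => x <= y) wD))) vw).
rewrite E; apply: (blk_sorted_act_inj a'_gt0 a'_le (D := [set: 'I_c])) => //.
  by rewrite -E; case/andP: tv.
by case/andP: tw.
Qed.

Lemma terminal_ex D (l : 'I_c.+1 -> nat) : (forall i, l i <= #|D|) -> l ord0 = 0 ->
  (forall i j : 'I_c.+1, i < j -> l i < l j) ->
  exists w, [/\ terminal a' w, cut_orbit D w & forall i, w (tailp i) = l i :> nat].
Proof.
move=> lD l0 linc.
pose f i := sval (cid (blk_surj a_ler a_gt0 (lD i))).
have Hf i : blk D (f i) = l i by rewrite /f; case: cid.
have linj (i j : 'I_c.+1) : l i = l j -> i = j.
  move=> E; apply: val_inj; case: (ltngtP i j) => // /linc; rewrite E ltnn //.
have [||s Hs] := @perm_extend _ _ f tailp.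
- by move=> i j E; apply: linj; rewrite -!Hf E.
- exact: tailp_inj.
pose w0 := wact (wcut D) s.
have w0E i : w0 (tailp i) = l i :> nat by rewrite !ffunE Hs /= Hf.
(* Sorting the head may move the corner letter, but puts the least head letter there, and this is
   0. *)
have [t Ht [sw _]] := blk_sort a'_gt0 a'_le [set: 'I_c] w0.
exists (wact w0 t).
have wE i : wact w0 t (tailp i) = l i :> nat.
  case: (posnP i) => i0; last first.
    by rewrite ffunE (blkperm_tail a'_gt0 a'_le Ht) //=; have := a'_gt0; lia.
  have -> : i = ord0 by apply: val_inj.
  apply/eqP; rewrite l0 -leqn0.
  have Ht' := blkpermV Ht.
  have ta : t^-1%g (tailp ord0) < a'.
    by apply: blkperm_head => //=; have := a'_gt0; lia.
  apply: leq_trans (terminal_head a'_gt0 a'_le sw ta) _.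
  by rewrite ffunE permKV w0E l0.
split=> //; last by rewrite !cut_orbit_act; apply/existsP; exists 1%g; rewrite wact1.
by apply/terminalP; split=> // i j ij; rewrite !wE linc.
Qed.

End TerminalWords.

(** * Merging two blocks *)

Section Merge.
Variables (n r a a' : nat).
Hypotheses (a_gt0 : 0 < a) (a_le : a <= a') (a'_le : a' <= r) (b_lt : r - a < n).
Local Notation b := (r - a).
Local Notation c := (r - a').
Implicit Types (v w x u : mindex n r) (D K : {set 'I_b}).

Local Notation a'_gt0 := (head_gt0 a_gt0 a_le).
Local Notation a_ler := (base_le a_le a'_le).
Local Notation tailp := (tailp a'_gt0 a'_le).
Local Notation tail_act := (tail_act a'_gt0 a'_le).
Local Notation wcut := (wcut b_lt).
Local Notation cut_orbit := (cut_orbit b_lt).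

Lemma tail_act_wact v s : exists t, tail_act v s = wact v t.
Proof.
have inj : injective (tail_perm a'_gt0 a'_le s).
  have surj (p : 'I_r) : (p < a'.-1) || [exists i, p == tailp i].
    case: (ltnP p a'.-1) => // pa; apply/existsP.
    by have [i ->] := tailp_surj a'_gt0 a'_le pa; exists i.
  move=> p q; case/orP: (surj p) => [pa|/existsP[i /eqP->]];
    case/orP: (surj q) => [qa|/existsP[j /eqP->]].
  - by rewrite /tail_perm pa qa.
  - rewrite tail_permE /tail_perm pa => E.
    by move: pa; rewrite E /=; lia.
  - rewrite tail_permE /tail_perm qa => E.
    by move: qa; rewrite -E /=; lia.
  - by rewrite !tail_permE => /(tailp_inj) /perm_inj ->.
by exists (perm inj); apply/ffunP => p; rewrite !ffunE permE.
Qed.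

Lemma merge_word_subproof h w p : unbump h (w p) < n.
Proof. exact: leq_ltn_trans (leq_subr _ _) (ltn_ord (w p)). Qed.

Definition merge_word h w : mindex n r := [ffun p => Ordinal (merge_word_subproof h w p)].

Lemma merge_word_wact h w s : merge_word h (wact w s) = wact (merge_word h w) s.
Proof. by apply/ffunP => p; apply: val_inj; rewrite !ffunE /= !ffunE. Qed.

Lemma merge_wcut K j : j \in K ->
  merge_word (blk K (a + j)).-1 (wcut K) = wcut (K :\ j).
Proof.
move=> jK; have wcutE D p : wcut D p = blk D p :> nat by rewrite ffunE.
by apply/ffunP => p; apply: val_inj; rewrite ffunE /= !wcutE (blkD1 a_ler).
Qed.

Lemma merge_cut_orbit K j w : j \in K -> cut_orbit K w ->
  cut_orbit (K :\ j) (merge_word (blk K (a + j)).-1 w).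
Proof.
move=> jK /existsP[s /eqP <-]; apply/existsP; exists s.
by rewrite merge_word_wact merge_wcut.
Qed.

Definition head_count w (l : nat) := #|[set p : 'I_r | (p < a') && (w p == l :> nat)]|.

Definition in_head_orbit w x :=
  [exists s, blkperm [set: 'I_c] s && (x == wact w s)].

Lemma in_head_orbit_tail w x (p : 'I_r) : in_head_orbit w x -> a' <= p -> x p = w p.
Proof.
move=> /existsP[s /andP[Hs /eqP->]] ap.
by rewrite ffunE (blkperm_tail a'_gt0 a'_le Hs).
Qed.

Lemma card_merge h w u D : cut_orbit D u -> cut_orbit D (merge_word h w) ->
  #|D|.+1 < n -> h <= #|D| ->
  (forall p : 'I_r, a' <= p -> u p = merge_word h w p) ->
  #|[set x | in_head_orbit w x & merge_word h x == u]| =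
  'C(head_count w h + head_count w h.+1, head_count w h.+1).
Proof.
move=> uD wD Dn hD tailE.
have headE (P : pred nat) : #|[set p : 'I_r | (p < a') && P (u p)]| =
    #|[set p : 'I_r | (p < a') && P (merge_word h w p)]|.
  apply: (card_head (P := fun y => P y) _ tailE).
  by rewrite (cut_orbit_count _ uD) (cut_orbit_count _ wD).
pose U := [set p : 'I_r | (p < a') && (u p == h :> nat)].
have cardU : #|U| = head_count w h + head_count w h.+1.
  rewrite /U (headE (fun y => y == h)) /head_count.
  rewrite -cardsUI [X in _ = _ + X](_ : _ = 0) ?addn0.
    by apply: eq_card => p; rewrite !inE ffunE /unbump /=; case: (p < a') => //=; lia.
  by apply/eqP; rewrite cards_eq0; apply/eqP/setP => p; rewrite !inE; lia.
rewrite -cardU -(cards_draws U).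
pose phi x := [set p in U | x p == h.+1 :> nat].
have mergeE x p : merge_word h x == u -> u p = unbump h (x p) :> nat.
  by move=> /eqP <-; rewrite ffunE.
rewrite -(card_in_imset (f := phi)); last first.
  move=> x y; rewrite !inE => /andP[xO xu] /andP[yO yu] /setP E.
  apply/ffunP => p; case: (leqP a' p) => pa.
    by rewrite (in_head_orbit_tail xO) // (in_head_orbit_tail yO).
  apply: val_inj; have := mergeE x p xu; have := mergeE y p yu.
  by have := E p; rewrite !inE pa /= /unbump; lia.
apply: eq_card => A; rewrite inE; apply/imsetP/andP.
  move=> [x]; rewrite inE => /andP[xO xu] ->; split.
    by apply/subsetP => p; rewrite inE => /andP[].
  have [s /andP[Hs /eqP xE]] := existsP xO.
  rewrite /head_count -(card_imset _ (@perm_inj _ s)); apply/eqP/eq_card => p.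
  apply/imsetP/idP => [[q + ->]|].
    rewrite !inE => /andP[/andP[qa _] xq]; rewrite (blkperm_head a'_gt0 a'_le Hs qa).
    by move: xq; rewrite xE ffunE.
  rewrite inE => /andP[pa wp].
  have qa : s^-1%g p < a' by apply: (blkperm_head a'_gt0 a'_le (blkpermV Hs)).
  have xq : x (s^-1%g p) = h.+1 :> nat by rewrite xE ffunE permKV (eqP wp).
  exists (s^-1%g p); rewrite ?permKV // !inE qa xq eqxx andbT /=.
  by have := mergeE _ (s^-1%g p) xu; rewrite xq /unbump; lia.
move=> [/subsetP AU /eqP Aq].
(* The default of [insubd] is never reached: letters of [u] are at most #|D|, so the new ones stay
   below n. *)
pose x : mindex n r := [ffun p : 'I_r => if a' <= p then w p else insubd (w p)
  (if u p < h then u p : nat else if u p == h :> nat then h + (p \in A) else (u p).+1)].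
have xtail (p : 'I_r) : a' <= p -> x p = w p by move=> pa; rewrite ffunE pa.
have xhead (p : 'I_r) : p < a' -> x p =
    (if u p < h then u p : nat else if u p == h :> nat then h + (p \in A) else (u p).+1) :> nat.
  move=> pa; rewrite ffunE leqNgt pa /= val_insubd ifT //.
  have up := cut_orbit_le p uD.
  case: ifP => _; first exact: ltn_ord.
  by case: ifP => _; [case: (p \in A) => /=; lia | lia].
have xu : merge_word h x == u.
  apply/eqP/ffunP => p; case: (leqP a' p) => pa.
    rewrite tailE //; apply: val_inj; rewrite !ffunE /=.
    by rewrite !ffunE /= pa.
  apply: val_inj; rewrite ffunE /= xhead // /unbump.
  by case: ltngtP => ? /=; try case: (p \in A) => /=; lia.
exists x; last first.
  apply/setP => p; rewrite !inE; apply/idP/andP => [pA|[]].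
    have := AU p pA; rewrite inE => /andP[pa /eqP up].
    by rewrite pa up eqxx xhead // up ltnn eqxx pA addn1.
  move=> /andP[pa /eqP up]; rewrite xhead // up ltnn eqxx.
  by case: (p \in A) => //=; lia.
rewrite inE xu andbT.
have [|t Ht E] := head_orbit a'_gt0 a'_le xtail; last first.
  by apply/existsP; exists t; rewrite Ht E eqxx.
(* Away from the threshold h + 1 the merged word decides the count; at the threshold the number of
   letters h + 1 has to be added. *)
move=> l; case: (ltngtP l h.+1) => lh.
- transitivity #|[set p : 'I_r | (p < a') && (l <= u p)]|.
    apply: eq_card => p; rewrite !inE; case: (ltnP p a') => //= pa.
    by rewrite (mergeE x p xu) /unbump; lia.
  rewrite (headE (fun y => l <= y)); apply: eq_card => p; rewrite !inE ffunE.
  by case: (ltnP p a') => //= pa; rewrite /unbump; lia.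
- transitivity #|[set p : 'I_r | (p < a') && (l.-1 <= u p)]|.
    apply: eq_card => p; rewrite !inE; case: (ltnP p a') => //= pa.
    by rewrite (mergeE x p xu) /unbump; lia.
  rewrite (headE (fun y => l.-1 <= y)); apply: eq_card => p; rewrite !inE ffunE.
  by case: (ltnP p a') => //= pa; rewrite /unbump; lia.
have split_le (y z : mindex n r) : (forall p, z p = unbump h (y p) :> nat) ->
    #|[set p : 'I_r | (p < a') && (h.+1 <= y p)]| =
    #|[set p : 'I_r | (p < a') && (y p == h.+1 :> nat)]| +
    #|[set p : 'I_r | (p < a') && (h.+1 <= z p)]|.
  move=> zE; rewrite -cardsUI [X in _ = _ + X](_ : _ = 0) ?addn0.
    by apply: eq_card => p; rewrite !inE zE /unbump; case: (p < a') => //=; lia.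
  apply/eqP; rewrite cards_eq0; apply/eqP/setP => p; rewrite !inE zE /unbump.
  by case: (p < a') => //=; lia.
rewrite lh (split_le x u) => [|p]; last exact: mergeE.
rewrite (split_le w (merge_word h w)) => [|p]; last by rewrite ffunE.
rewrite (headE (fun y => h.+1 <= y)); congr (_ + _).
rewrite -[RHS]/(head_count w h.+1) -Aq; apply: eq_card => p; rewrite !inE.
apply/andP/idP => [[pa]|pA].
  rewrite xhead //; case: ltngtP => up; first by lia.
    by move=> /eqP[]; lia.
  by case: (p \in A) => //=; lia.
have := AU p pA; rewrite inE => /andP[pa /eqP up].
by rewrite pa xhead // up ltnn eqxx pA addn1.
Qed.

Lemma perm_eq_lift m (s t : 'S_m.+1) :
  (forall i : 'I_m.+1, 0 < i -> s i = t i) -> s = t.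
Proof.
move=> E; suff st0 : s ord0 = t ord0.
  apply/permP => i; case: (posnP i) => [i0|/E//].
  by have -> : i = ord0 by apply: val_inj.
pose i := t^-1%g (s ord0).
case: (posnP i) => [i0|/[dup] i0 /E].
  have Ei : i = ord0 by apply: val_inj.
  by rewrite -{2}Ei /i permKV.
by rewrite {2}/i permKV => /perm_inj Ei; rewrite Ei in i0.
Qed.

Local Open Scope ring_scope.

(** The sign with which merging h and h + 1 turns a tail skipping [s] into 0, 1, ..., c. If [s] is
    one of the two, the leg is already 1, ..., c. If h = 0, a letter 0 enters the leg and a cycle of
    length s restores the order. Otherwise two leg letters coincide. *)
Definition merge_sign (h s : nat) : int :=
  if (h == s) || (h.+1 == s) then 1 else if h == 0%N then (-1) ^+ s.-1 else 0.

Lemma merge_sign_sum m h s : (h <= m)%N -> (0 < s <= m.+1)%N ->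
  \sum_(t : 'S_m.+1 | [forall i : 'I_m.+1, (0 < i)%N ==> (t i == unbump h (bump s i) :> nat)])
    (-1) ^+ t = merge_sign h s.
Proof.
move=> hm s0m.
have unique (t0 : 'S_m.+1) :
    (forall i : 'I_m.+1, (0 < i)%N -> t0 i = unbump h (bump s i) :> nat) ->
    \sum_(t : 'S_m.+1 | [forall i : 'I_m.+1, (0 < i)%N ==> (t i == unbump h (bump s i) :> nat)])
      (-1) ^+ t = (-1) ^+ t0 :> int.
  move=> H0; rewrite (big_pred1 t0) // => t; apply/forall_inP/eqP => [H|->].
    by apply: perm_eq_lift => i i0; apply: val_inj; rewrite /= (H0 i i0); apply/eqP/H.
  by move=> i i0; rewrite H0.
rewrite /merge_sign; case: ifPn => [hs|].
  rewrite (unique 1%g) ?odd_perm1 // => i i0; rewrite perm1 /unbump /bump.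
  by case/orP: hs => /eqP hs; lia.
rewrite negb_or => /andP[hs hs1]; case: ifPn => [/eqP h0|h0].
  have sm : (s.-1 < m.+1)%N by lia.
  (* The cycle sending 0 to s - 1 and lowering 1, ..., s - 1 by one. *)
  rewrite (unique (lift_perm ord0 (Ordinal sm) 1%g)).
    by rewrite odd_lift_perm odd_perm1 addbF /= signr_odd.
  move=> i i0; case: (unliftP ord0 i) i0 => [k ->|->//] _.
  by rewrite lift_perm_lift perm1 /= /bump /unbump h0; lia.
rewrite big_pred0 // => t; apply/negbTE/negP => /forall_inP H.
have hlt : (h < m.+1)%N by [].
have E (x y : nat) (x0 : (0 < x)%N) (y0 : (0 < y)%N) (xm : (x < m.+1)%N) (ym : (y < m.+1)%N) :
    unbump h (bump s x) = unbump h (bump s y) -> x = y.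
  have := H (Ordinal xm) x0; have := H (Ordinal ym) y0 => /eqP Ey /eqP Ex Exy.
  have : t (Ordinal xm) = t (Ordinal ym) by apply: val_inj; rewrite /= Ex Ey /= Exy.
  by move/perm_inj/(congr1 val).
(* The letters h and h + 1 both stand in the leg, at the indices h, h + 1 or h - 1, h, and become
   equal. *)
case: (ltnP h s) => hs'.
  suff : h.+1 = h by lia.
  by apply: E => //; try lia; rewrite /bump /unbump; lia.
suff : h.-1 = h by lia.
by apply: E => //; try lia; rewrite /bump /unbump; lia.
Qed.

Lemma orb_sym_subproof w : tens (orb [set: 'I_c] w) \in @sym n r a'.
Proof.
apply/(sym_setT a'_gt0 a'_le) => s Hs x; rewrite !tensE.
exact: (orb_inv w Hs).
Qed.
Definition orb_tensor w : sym_tensor n r a' := SymTensor (orb_sym_subproof w).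

(** The face map from K :\ j to K includes the generator of K :\ j as this element applied to the
    generator of K; it therefore acts on values of cochains. *)
Definition merge_op K (j : 'I_b) : schur n r :=
  proj_schur b_lt K (tbasis (wcut (K :\ j))).

Lemma tcoef_merge_op K j (t : tensor n r) u : j \in K ->
  tcoef (merge_op K j *: t) u =
  \sum_(x | cut_orbit K x && (merge_word (blk K (a + j)).-1 x == u)) tcoef t x.
Proof.
move=> jK; rewrite tcoef_scale [RHS]big_mkcond; apply: eq_bigr => x _.
have Ht : blk_inv K (tcoef (tbasis (wcut (K :\ j)))).
  by apply: blk_inv_sub (@wcut_inv _ _ _ b_lt (K :\ j)); apply: subsetDl.
rewrite /merge_op proj_schurE //.
have [/existsP[s /eqP xs]|nx] := boolP (cut_orbit K x); last first.
  rewrite proj_mx0 ?mul0r // => s; apply: contra nx => /eqP E.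
  by apply/existsP; exists s^-1%g; rewrite -E wactK.
have xsK : wact x s^-1 = wcut K by rewrite -xs wactK.
rewrite (proj_mxE _ Ht xsK) tbasisE -(merge_wcut jK) -xsK merge_word_wact /=.
have -> : (wact u s^-1 == wact (merge_word (blk K (a + j)).-1 x) s^-1) =
    (merge_word (blk K (a + j)).-1 x == u).
  apply/eqP/eqP => [E|->//].
  by rewrite -[RHS](wactK u s^-1) E wactK.
by case: eqP => _; rewrite ?mul1r ?mul0r.
Qed.

(** A permutation of the tail of [v] contributes nothing if its leg differs from the merged leg of
    [w]; the others contribute the same number of preimages, and their signs sum to [merge_sign]. *)
Lemma hook_tail_merge K j v w s : j \in K -> #|K| = c.+1 ->
  terminal a' v -> cut_orbit (K :\ j) v -> terminal a' w -> cut_orbit K w ->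
  (0 < s <= c.+1)%N -> (forall i, w (tailp i) = bump s i :> nat) ->
  let h := (blk K (a + j)).-1 in
  hook_tail a'_gt0 a'_le v (merge_op K j *: hook_class (orb_tensor w)) =
  merge_sign h s * 'C(head_count w h + head_count w h.+1, head_count w h.+1)%:R.
Proof.
move=> jK Kc tv vD tw wK s0c wE h.
have Dc : #|K :\ j| = c by move: Kc; rewrite (cardsD1 j K) jK => -[].
have hpos : (0 < blk K (a + j))%N by apply/card_gt0P; exists j; rewrite !inE jK leqnn.
have hc : (h <= c)%N by have := blk_le_card K (a + j); rewrite /h Kc; lia.
rewrite -linearZ hook_tailE.
rewrite -[sym_val _]/(merge_op K j *: tens (orb [set: 'I_c] w)).
rewrite /tail_alt -(merge_sign_sum hc s0c) big_distrl /= [RHS]big_mkcond /=.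
apply: eq_bigr => t _; rewrite tcoef_merge_op // -/h.
set u := tail_act v t.
have -> : \sum_(x | cut_orbit K x && (merge_word h x == u))
      tcoef (tens (orb [set: 'I_c] w)) x =
    #|[set x | in_head_orbit w x & merge_word h x == u]|%:R.
  rewrite -sum1_card natr_sum [RHS]big_mkcond [LHS]big_mkcond /=.
  apply: eq_bigr => x _; rewrite tensE !inE /orb -/(in_head_orbit w x).
  case: (boolP (in_head_orbit w x)) => [xO|]; last by case: ifP.
  have -> : cut_orbit K x.
    by case/existsP: xO => y /andP[_ /eqP ->]; rewrite cut_orbit_act.
  by [].
have vE i : v (tailp i) = i :> nat.
  exact: (terminal_tail_id a_gt0 a_le a'_le i Dc tv vD).
have uE i : u (tailp i) = t i :> nat by rewrite ffunE tail_permE vE.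
have uD : cut_orbit (K :\ j) u.
  by have [y Ey] := tail_act_wact v t; rewrite /u Ey cut_orbit_act.
have wD := merge_cut_orbit jK wK.
case: ifPn => [/forall_inP H|nH].
  rewrite (card_merge uD wD) ?Dc //.
    by apply: leq_ltn_trans b_lt; rewrite -Kc -[X in (_ <= X)%N]card_ord max_card.
  move=> p pa; have [|i Ei] := @tailp_surj _ _ a'_gt0 a'_le p; first by lia.
  have i0 : (0 < i)%N by move: pa; rewrite Ei /=; have := a'_gt0; lia.
  apply: val_inj; rewrite Ei -[LHS]/(nat_of_ord (u _)) uE ffunE /= wE.
  exact/eqP/H.
rewrite (_ : [set x | _] = set0) ?cards0 ?mulr0 //.
apply/setP => x; rewrite !inE; apply/negbTE/negP => /andP[xO /eqP xu].
case/negP: nH; apply/forall_inP => i i0; rewrite -uE -xu ffunE /=.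
rewrite (in_head_orbit_tail xO) ?wE //=; have := a'_gt0; lia.
Qed.

End Merge.

(** * Binomial identities for the weights *)

(** Both sides are the trinomial coefficient n! / (y! (x - y)! (n - x)!). *)
Lemma mul_bin_bin n x y : y <= x <= n -> 'C(n, x) * 'C(x, y) = 'C(n, y) * 'C(n - y, x - y).
Proof.
move=> /andP[yx xn]; have yn := leq_trans yx xn.
have F : 0 < y`! * (x - y)`! * (n - x)`! by rewrite !muln_gt0 !fact_gt0.
apply/eqP; rewrite -(eqn_pmul2r F); apply/eqP.
have E1 := bin_fact xn; have E2 := bin_fact yx; have E3 := bin_fact yn.
have le : x - y <= n - y by apply: leq_sub2r.
have E4 := bin_fact le; rewrite subnBA // subnK // in E4.
transitivity n`!; last first.
  by rewrite -E3 -E4; ring.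
by rewrite -E1 -E2; ring.
Qed.

(** Stated for any sequence of partial sums, since merging the blocks h and h + 1 deletes N_h, that
    is, composes N with [bump h]. *)
Definition lam m (N : nat -> nat) := \prod_(1 <= i < m) 'C((N i).-1, N i.-1).

Lemma lam_bump m h N : 0 < h < m -> lam m (N \o bump h) =
  \prod_(1 <= i < h) 'C((N i).-1, N i.-1) * 'C((N h.+1).-1, N h.-1) *
  \prod_(h.+2 <= i < m.+1) 'C((N i).-1, N i.-1).
Proof.
move=> /andP[h0 hm]; rewrite /lam (big_cat_nat h0 (ltnW hm)) /= -mulnA; congr (_ * _).
  by apply: eq_big_nat => i /andP[i0 ih]; rewrite /= /bump [h <= i]leqNgt ih [h <= i.-1]leqNgt (leq_ltn_trans (leq_pred i) ih).
rewrite (big_ltn hm) [in RHS]big_add1 /=; congr (_ * _).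
  by rewrite /= /bump leqnn (_ : (h <= h.-1) = false) ?add0n ?add1n //; lia.
apply: eq_big_nat => i /andP[hi im].
by rewrite /= /bump (ltnW hi) (_ : h <= i.-1) ?add1n ?prednK //; lia.
Qed.

Lemma lam_bump0 m N : lam m (N \o bump 0) = \prod_(2 <= i < m.+1) 'C((N i).-1, N i.-1).
Proof.
rewrite /lam [in RHS]big_add1 /=; apply: eq_big_nat => i /andP[i0 im].
by rewrite /bump !leq0n !add1n prednK.
Qed.

(** * Pascal's rule for the weights lambda *)

Section LamRelation.
Variables (N H : nat -> nat) (c s : nat).
Hypotheses (N0 : 0 < N 0) (Ninc : forall l, l <= c -> N l < N l.+1).
Hypotheses (s_bounds : 0 < s <= c.+1).
Hypothesis H0 : H 0 = N 0.
Hypothesis HS : forall l, l <= c -> H l.+1 + (l.+1 != s) = N l.+1 - N l.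

Let G i := 'C((N i).-1, N i.-1).
Let rest := \prod_(1 <= i < s) G i * \prod_(s.+1 <= i < c.+2) G i.

Let merges h := lam c.+1 (N \o bump h) * 'C(H h + H h.+1, H h.+1).

(** [H] counts letters in the head: every letter except 0 and [s] gives one copy to the leg. The
    case s = 1 differs because the letter 0 gives none. *)
Lemma merge_prev : merges s.-1 = 'C((N s).-1 + (s == 1), N s.-1 - (s != 1)) * rest.
Proof.
case: s s_bounds HS @rest => [//|[|t]] /andP[_ sc] HSs rst /=.
  rewrite /merges /rst lam_bump0 (big_geq (leqnn 1)) mul1n mulnC H0.
  have := HSs 0 (leq0n _); rewrite eqxx addn0 => ->.
  have := Ninc (leq0n _) => N01; rewrite subn0 addn1 prednK ?(leq_trans _ N01) //.
  by rewrite subnKC ?(ltnW N01) // bin_sub // ltnW.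
have tc : t.+1 <= c by [].
have := HSs t (ltnW tc); rewrite (_ : t.+1 != t.+2) ?neq_ltn ?ltnSn // addn1 => Ht.
have := HSs t.+1 tc; rewrite eqxx addn0 => Ht1.
have i1 := Ninc (ltnW tc); have i2 := Ninc tc.
rewrite /merges /rst lam_bump //= [in RHS]big_nat_recr //= subn1.
have key : 'C((N t.+2).-1, N t) * 'C(H t.+1 + H t.+2, H t.+2) =
    'C((N t.+2).-1, (N t.+1).-1) * G t.+1.
  have -> : H t.+1 + H t.+2 = (N t.+2).-1 - N t by lia.
  have -> : H t.+2 = (N t.+2).-1 - N t - ((N t.+1).-1 - N t) by lia.
  rewrite bin_sub; last by lia.
  by rewrite /G /= mul_bin_bin //; lia.
set P1 := \prod_(1 <= i < t.+1) _; set P2 := \prod_(_ <= i < c.+2) _.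
transitivity (P1 * P2 * ('C((N t.+2).-1, N t) * 'C(H t.+1 + H t.+2, H t.+2))).
  by rewrite /P1 /P2; ring.
by rewrite key /P1 /P2 /G; ring.
Qed.

Lemma merge_next : s <= c -> merges s = 'C(N s, N s.-1) * rest.
Proof.
move=> sc; case/andP: s_bounds => s0 _.
have s1 : s.-1.+1 = s by lia.
have Hs := HS (l := s.-1); rewrite s1 eqxx addn0 in Hs.
have := HS sc; rewrite (_ : s.+1 != s) ?neq_ltn ?ltnSn ?orbT // addn1 => Hs1.
have i1 : N s.-1 < N s by have := @Ninc s.-1; rewrite s1; apply; lia.
have i2 := Ninc sc.
rewrite /merges lam_bump ?s0 //= /rest (big_ltn (m := s.+1)) //=.
have key : 'C((N s.+1).-1, N s.-1) * 'C(H s + H s.+1, H s.+1) =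
    'C(N s, N s.-1) * G s.+1.
  rewrite Hs; last by lia.
  have -> : N s - N s.-1 + H s.+1 = (N s.+1).-1 - N s.-1 by lia.
  have -> : H s.+1 = (N s.+1).-1 - N s.-1 - (N s - N s.-1) by lia.
  rewrite bin_sub; last by lia.
  by rewrite /G /= [RHS]mulnC mul_bin_bin //; lia.
set P1 := \prod_(1 <= i < s) _; set P2 := \prod_(_ <= i < c.+2) _.
transitivity (P1 * P2 * ('C((N s.+1).-1, N s.-1) * 'C(H s + H s.+1, H s.+1))).
  by rewrite /P1 /P2; ring.
by rewrite key /P1 /P2 /G; ring.
Qed.

(** The binomial of this merge is the factor [G 1] that deleting N_0 removes from lambda. *)
Lemma merge_first : 1 < s -> merges 0 = 'C((N s).-1, N s.-1) * rest.
Proof.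
move=> s1; have sc : s <= c.+1 by case/andP: s_bounds.
have Hs := HS (leq0n _); have i1 := Ninc (leq0n _).
rewrite (_ : 1 != s) ?neq_ltn ?s1 // addn1 in Hs.
rewrite /merges lam_bump0 H0.
have -> : N 0 + H 1 = (N 1).-1 by lia.
have -> : H 1 = (N 1).-1 - N 0 by lia.
rewrite bin_sub; last by lia.
transitivity (\prod_(1 <= i < c.+2) G i); first by rewrite [RHS]big_ltn // mulnC.
rewrite (big_cat_nat (ltnW s1) (leqW sc)) /= /rest [RHS]mulnCA.
by rewrite [X in _ * X = _]big_ltn.
Qed.

Local Open Scope ring_scope.

(** Only h = s - 1, s and 0 occur. For s > 1 the terms at s - 1 and 0 have the same sign and add up,
    by Pascal's rule, to the opposite of the term at s. If s = c + 1 no block follows and the sum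
    survives. *)
Lemma lam_relation :
  \sum_(h < c.+1) (-1) ^+ h * (lam c.+1 (N \o bump h))%:R *
     (merge_sign h s * 'C(H h + H h.+1, H h.+1)%:R) =
  (if s == c.+1 then (-1) ^+ c * 'C(N c.+1, N c)%:R *
      (\prod_(1 <= i < c.+1) G i)%:R else 0) :> int.
Proof.
have signE (h : 'I_c.+1) : merge_sign h s =
    (h == s :> nat)%:R + (h == s.-1 :> nat)%:R +
    ((h == 0%N :> nat)%:R * (1 < s)%N%:R) * (-1) ^+ s.-1 :> int.
  case/andP: s_bounds => s0 _; rewrite /merge_sign -[in (h.+1 == s)%N](prednK s0) eqSS.
  case: (eqVneq (h : nat) s) => [->|hs] /=.
    by rewrite (gtn_eqF (_ : (s.-1 < s)%N)) ?ltn_predL // (gtn_eqF s0) mul0r mul0r !addr0.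
  case: (eqVneq (h : nat) s.-1) => [->|hs1] /=.
    case: (eqVneq s.-1 0%N) => [E|_]; last by rewrite !mul0r addr0 add0r.
    by rewrite (_ : (1 < s)%N = false) ?mulr0 ?mul0r ?addr0 ?add0r //; lia.
  case: eqVneq => h0; last by rewrite !mul0r !addr0.
  by rewrite (_ : (1 < s)%N) ?mulr1 ?mul1r ?add0r //; lia.
transitivity (\sum_(h < c.+1) ((-1) ^+ h * (h == s :> nat)%:R * (merges h)%:R +
   (-1) ^+ h * (h == s.-1 :> nat)%:R * (merges h)%:R +
   (-1) ^+ h * ((h == 0%N :> nat)%:R * (1 < s)%N%:R) * (-1) ^+ s.-1 * (merges h)%:R) : int).
  apply: eq_bigr => h _; rewrite signE /merges natrM.
  by ring.
rewrite !big_split /=.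
have single (k : nat) (f : nat -> int) : 
    \sum_(h < c.+1) (-1) ^+ h * (h == k :> nat)%:R * f h =
    if (k <= c)%N then (-1) ^+ k * f k else 0.
  case: (leqP k c) => kc; last first.
    rewrite big1 // => h _; rewrite (ltn_eqF (_ : (h < k)%N)) ?mulr0 ?mul0r //.
    exact: leq_trans (ltn_ord h) kc.
  rewrite (bigD1 (Ordinal (kc : (k < c.+1)%N))) //= eqxx mulr1 big1 ?addr0 // => h hk.
  by rewrite -(inj_eq val_inj) /= in hk; rewrite (negbTE hk) mulr0 mul0r.
rewrite (single s (fun h => (merges h)%:R)) (single s.-1 (fun h => (merges h)%:R)).
rewrite (eq_bigr (fun h : 'I_c.+1 => (-1) ^+ h * (h == 0%N :> nat)%:R *
   ((1 < s)%N%:R * (-1) ^+ s.-1 * (merges h)%:R))); last by move=> h _; ring.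
rewrite (single 0%N (fun h => (1 < s)%N%:R * (-1) ^+ s.-1 * (merges h)%:R)) leq0n.
case/andP: (s_bounds) => s0 sc; rewrite (_ : (s.-1 <= c)%N); last by lia.
have total : (-1) ^+ s.-1 * (merges s.-1)%:R + (-1) ^+ 0 * ((1 < s)%N%:R * (-1) ^+ s.-1 * (merges 0)%:R) =
    (-1) ^+ s.-1 * ('C(N s, N s.-1) * rest)%:R :> int.
  rewrite merge_prev; case: (ltnP 1 s) => s1.
    rewrite merge_first // (_ : (s == 1%N) = false) ?gtn_eqF //=.
    rewrite addn0 subn1 !expr0 !mul1r -mulrDr -natrD -mulnDl; congr (_ * (_ * _)%:R).
    have i1 : (N s.-1 < N s)%N by have := @Ninc s.-1; rewrite prednK //; apply; lia.
    have [y Ey] : exists y, N s.-1 = y.+1.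
      have mono t : (t <= c)%N -> (0 < N t)%N.
        by case: t => // t tc; apply: leq_trans (Ninc (ltnW tc)).
      by exists (N s.-1).-1; rewrite prednK // mono //; lia.
    have [x Ex] : exists x, N s = x.+1 by exists (N s).-1; lia.
    by rewrite Ex Ey /= binS addnC.
  have -> : s = 1%N by lia.
  rewrite eqxx subn0 !(mulr0n, mul0r, mulr0) addr0 addn1 prednK //.
  exact: leq_trans (Ninc (leq0n _)).
rewrite -addrA total; case: (eqVneq s c.+1) => [E|sc1].
  rewrite (_ : (s <= c)%N = false); last by rewrite E ltnn.
  rewrite add0r /rest E /= (big_geq (leqnn _)) muln1 natrM mulrA.
  by [].
have sc' : (s <= c)%N by lia.
rewrite sc' merge_next // -mulrDl -[s in (-1) ^+ s](prednK s0) exprS mulN1r addNr mul0r.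
by [].
Qed.

End LamRelation.

(** * Weight spaces and relations *)

Section Cumul.
Variables (r a : nat).
Hypotheses (a_gt0 : 0 < a) (a_le : a <= r).
Local Notation b := (r - a).
Implicit Types (D K : {set 'I_b}).

Definition cumul D (l : nat) := #|[set p : 'I_r | blk D p <= l]|.

Lemma cumulD1 K j l : j \in K -> cumul (K :\ j) l = cumul K (bump (blk K (a + j)).-1 l).
Proof.
move=> jK; apply: eq_card => p; rewrite !inE (blkD1 a_le) // /unbump /bump.
have : 0 < blk K (a + j) by apply/card_gt0P; exists j; rewrite !inE jK leqnn.
move: (blk K _) (blk K _) => x y; lia.
Qed.

Lemma cumulS D l : cumul D l.+1 = cumul D l + #|[set p : 'I_r | blk D p == l.+1]|.
Proof.
rewrite /cumul -cardsUI [X in _ = _ + X](_ : _ = 0) ?addn0.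
  by apply: eq_card => p; rewrite !inE leq_eqVlt ltnS orbC.
apply/eqP; rewrite cards_eq0; apply/eqP/setP => p; rewrite !inE.
by move: (blk D p) => x; lia.
Qed.

Lemma cumul_ltS D l : l < #|D| -> cumul D l < cumul D l.+1.
Proof.
move=> /(blk_surj a_le a_gt0)[p Ep]; rewrite cumulS -[X in X < _]addn0 ltn_add2l.
by apply/card_gt0P; exists p; rewrite inE Ep.
Qed.

Lemma card_ord_lt m : m <= r -> #|[set p : 'I_r | p < m]| = m.
Proof.
move=> mr; rewrite -[RHS](card_ord m) -cardsT.
have inj : injective (widen_ord mr) by move=> x y /(congr1 val) /= E; apply: val_inj.
rewrite -(card_imset setT inj); apply: eq_card => p; rewrite inE.
apply/idP/imsetP => [pm|[q _ ->]] /=; last exact: ltn_ord.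
by exists (Ordinal pm) => //; apply: val_inj.
Qed.

Lemma cumul_cut K (j : 'I_b) : j \in K -> cumul K (blk K (a + j)).-1 = a + j.
Proof.
move=> jK; have pos : 0 < blk K (a + j).
  by apply/card_gt0P; exists j; rewrite !inE jK leqnn.
rewrite -[RHS]card_ord_lt; last by have := ltn_ord j; lia.
by apply: eq_card => p; rewrite !inE -ltnS prednK // (blk_cut a_le).
Qed.

Lemma cumul_max D : cumul D #|D| = r.
Proof.
rewrite -[RHS](card_ord_lt (leqnn r)); apply: eq_card => p.
by rewrite !inE blk_le_card ltn_ord.
Qed.

Lemma cumul0_ge D l : a <= cumul D l.
Proof.
rewrite -(card_ord_lt a_le); apply/subset_leq_card/subsetP => p; rewrite !inE => pa.
have -> : blk D p = 0; last by [].
by apply/eqP; rewrite cards_eq0; apply/eqP/setP => i; rewrite !inE; lia.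
Qed.

(** Cuts are numbered by the block on their left, which turns sums over faces into the sums of
    [lam_relation]. *)
Lemma sum_cuts K m (F : nat -> int) : #|K| = m ->
  (\sum_(j in K) F (blk K (a + j)%N).-1 = \sum_(h < m) F h)%R.
Proof.
move=> Km; have ex (h : 'I_m) : exists j : 'I_b, j \in K /\ blk K (a + j) = h.+1.
  have [|j jK Ej] := cut_ex a_le a_gt0 (D := K) (l := h.+1).
    by rewrite Km ltn_ord.
  by exists j.
pose g h := sval (cid (ex h)).
have gK h : g h \in K by rewrite /g; case: cid => j [].
have gE h : blk K (a + g h) = h.+1 by rewrite /g; case: cid => j [].
have ginj : injective g.
  by move=> h h' E; apply: val_inj; have := gE h; rewrite E gE => -[].
have -> : K = g @: [set: 'I_m].
  apply/esym/eqP; rewrite eqEcard card_imset // cardsT card_ord Km leqnn andbT.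
  by apply/subsetP => j /imsetP[h _ ->].
rewrite big_imset /=; last by move=> x y _ _; apply: ginj.
apply: eq_big => [h|h _]; first by rewrite inE.
have -> : g @: [set: 'I_m] = K.
  apply/eqP; rewrite eqEcard card_imset // cardsT card_ord Km leqnn andbT.
  by apply/subsetP => j /imsetP[h' _ ->].
by rewrite gE.
Qed.

Lemma csgnE K (j : 'I_b) : j \in K -> csgn K j = ((-1) ^+ (blk K (a + j)%N).-1)%R.
Proof.
move=> jK; congr (_ ^+ _)%R; rewrite /blk (cardsD1 j [set i in K | a + i <= a + j]).
rewrite !inE jK leqnn /=; apply: eq_card => i; rewrite !inE leq_add2l -(inj_eq val_inj) /=.
by case: (i \in K); rewrite ?andbF //= ltn_neqAle.
Qed.

(* lambda(alpha), for the composition alpha cut out by [D]. *)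
Definition weight D := lam #|D|.+1 (cumul D).

End Cumul.

Section Relations.
Variables (n r a a' : nat).
Hypotheses (a_gt0 : 0 < a) (a_le : a <= a') (a'_le : a' <= r) (b_lt : r - a < n).
Local Notation b := (r - a).
Local Notation c := (r - a').
Implicit Types (v w x u : mindex n r) (D K : {set 'I_b}).

Local Notation a'_gt0 := (head_gt0 a_gt0 a_le).
Local Notation a_ler := (base_le a_le a'_le).
Local Notation tailp := (tailp a'_gt0 a'_le).
Local Notation wcut := (wcut b_lt).
Local Notation cut_orbit := (cut_orbit b_lt).
Local Notation hook_tail := (hook_tail a'_gt0 a'_le).
Local Notation orb_tensor := (orb_tensor a_gt0 a_le a'_le).

(** Provides the hypotheses on [H] in [lam_relation]: the tail beyond the corner uses each letter
    once, except 0 and [s]. *)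
Lemma tail_count w K s l : #|K| = c.+1 -> cut_orbit K w -> (0 < s <= c.+1) ->
  (forall i, w (tailp i) = bump s i :> nat) -> l <= c.+1 ->
  head_count a' w l + ((0 < l) && (l != s)) = #|[set p : 'I_r | blk K p == l]|.
Proof.
move=> Kc wK sb wE lc; rewrite -(cut_orbit_count (fun y => y == l) wK).
pose H : {set 'I_r} := [set p : 'I_r | p < a'].
rewrite -(cardsID H); congr (_ + _).
  by apply: eq_card => p; rewrite !inE andbC.
have [/andP[l0 ls]|nl] := boolP ((0 < l) && (l != s)).
  have ic : unbump s l < c.+1 by rewrite /unbump; lia.
  have wi : w (tailp (Ordinal ic)) = l :> nat by rewrite wE /= unbumpKcond (negbTE ls).
  rewrite (_ : _ :\: _ = [set tailp (Ordinal ic)]) ?cards1 //.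
  apply/setP => p; rewrite !inE; apply/andP/eqP => [[pH /eqP wp]|->].
    have [|i Ei] := @tailp_surj _ _ a'_gt0 a'_le p; first by lia.
    rewrite Ei; congr (tailp _); apply: val_inj => /=.
    by rewrite -(bumpK s i) -wE -Ei wp.
  by rewrite wi eqxx /= /unbump; split=> //; lia.
apply/esym/eqP; rewrite cards_eq0; apply/eqP/setP => p; rewrite !inE.
apply/negbTE/negP => /andP[pH /eqP wp]; case/negP: nl.
have [|i Ei] := @tailp_surj _ _ a'_gt0 a'_le p; first by lia.
have i0 : 0 < i by move: pH; rewrite Ei /=; lia.
by rewrite -wp Ei wE /bump; lia.
Qed.

Local Open Scope ring_scope.

(** An entry of the coboundary matrix: K and [w], whose tail skips [s], index the relation, and K :\
    j the generator. *)
Definition rel_coef K w s (j : 'I_b) : int :=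
  csgn K j * (merge_sign (blk K (a + j)).-1 s *
    'C(head_count a' w (blk K (a + j)).-1 + head_count a' w (blk K (a + j)).-1.+1,
       head_count a' w (blk K (a + j)).-1.+1)%:R).

Lemma rel_weight K w s : #|K| = c.+1 -> cut_orbit K w -> (0 < s <= c.+1)%N ->
  (forall i, w (tailp i) = bump s i :> nat) ->
  \sum_(j in K) (weight (K :\ j))%:R * rel_coef K w s j =
  if s == c.+1 then (-1) ^+ c * 'C(r, cumul K c)%:R *
    (\prod_(1 <= i < c.+1) 'C((cumul K i).-1, cumul K i.-1))%:R else 0.
Proof.
move=> Kc wK sb wE; rewrite -[X in 'C(X, _)](cumul_max K) Kc.
have cnt := tail_count Kc wK sb wE.
rewrite -(@lam_relation (cumul K) (head_count a' w) c s) //.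
- rewrite -(sum_cuts a_gt0 a_ler (fun h => (-1) ^+ h * (lam c.+1 (cumul K \o bump h))%:R *
     (merge_sign h s * 'C(head_count a' w h + head_count a' w h.+1, head_count a' w h.+1)%:R)) Kc).
  apply: eq_bigr => j jK; rewrite /rel_coef (csgnE jK) mulrA [_ * (-1) ^+ _]mulrC.
  congr (_ * _%:R * _); rewrite /weight.
  have -> : #|K :\ j| = c by move: Kc; rewrite (cardsD1 j K) jK => -[].
  by apply: eq_bigr => i _; rewrite /= !(cumulD1 a_gt0 a_ler).
- exact: leq_trans a_gt0 (cumul0_ge a_gt0 a_ler _ _).
- by move=> l lc; apply: (cumul_ltS a_gt0 a_ler); rewrite Kc.
- rewrite -[LHS]addn0 -[X in (_ + X)%N]/(nat_of_bool ((0 < 0)%N && (0%N != s))) cnt //.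
  by apply: eq_card => p; rewrite !inE leqn0.
- by move=> l lc; rewrite -[_ != s]/((0 < l.+1)%N && (l.+1 != s)) cnt // (cumulS a_gt0 a_ler) addKn.
Qed.

Definition wt_proj D : schur n r := proj_schur b_lt D (tbasis (wcut D)).

Lemma tcoef_wt_proj D (t : tensor n r) u :
  tcoef (wt_proj D *: t) u = if cut_orbit D u then tcoef t u else 0.
Proof.
rewrite tcoef_scale /wt_proj proj_schurE; last exact: wcut_inv.
have [/existsP[s /eqP us]|nu] := boolP (cut_orbit D u).
  have usD : wact u s^-1 = wcut D by rewrite -us wactK.
  rewrite (bigD1 u) //= (proj_mxE _ (@wcut_inv _ _ _ b_lt D) usD) tbasisE usD eqxx mul1r.
  rewrite big1 ?addr0 // => x xu.
  have [[y xy]|none] := pselect (exists y, wact x y = wcut D); last first.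
    by rewrite proj_mx0 ?mul0r // => y; apply/eqP => E; apply: none; exists y.
  rewrite (proj_mxE _ (@wcut_inv _ _ _ b_lt D) xy) tbasisE -xy.
  case: eqP => [E|_]; last by rewrite mul0r.
  by case/eqP: xu; rewrite -[x](wactK x y) -E wactK.
rewrite big1 // => x _.
have [[y xy]|none] := pselect (exists y, wact x y = wcut D); last first.
  by rewrite proj_mx0 ?mul0r // => y; apply/eqP => E; apply: none; exists y.
rewrite (proj_mxE _ (@wcut_inv _ _ _ b_lt D) xy) tbasisE.
case: eqP => [E|_]; last by rewrite mul0r.
by case/existsP: nu; exists y^-1%g; rewrite -E wactK.
Qed.

Lemma hook_tail_wt_proj D w (x : hook_weyl n r a') :
  hook_tail w (wt_proj D *: x) = if cut_orbit D w then hook_tail w x else 0.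
Proof.
rewrite -[x]hook_class_surj -linearZ !hook_tailE.
have E s : cut_orbit D (tail_act a'_gt0 a'_le w s) = cut_orbit D w.
  by have [t ->] := tail_act_wact a_gt0 a_le a'_le b_lt w s; rewrite cut_orbit_act.
rewrite /tail_alt; case: ifPn => wD; last rewrite big1 //.
  apply: eq_bigr => s _; rewrite -[sym_val (_ *: _)]/(wt_proj D *: sym_val _).
  by rewrite tcoef_wt_proj E wD.
move=> s _; rewrite -[sym_val (_ *: _)]/(wt_proj D *: sym_val _).
by rewrite tcoef_wt_proj E (negbTE wD) mulr0.
Qed.

Lemma hook_tail_orb v w : terminal a' v -> terminal a' w ->
  hook_tail v (hook_class (orb_tensor w)) = (v == w)%:R.
Proof.
move=> tv tw; rewrite hook_tailE.
have sv : blk_sorted [set: 'I_c] v by case/andP: tv.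
have sw : blk_sorted [set: 'I_c] w by case/andP: tw.
transitivity (tail_alt a'_gt0 a'_le v (orb [set: 'I_c] w)).
  by apply: eq_bigr => s _; rewrite /= tensE.
rewrite (@tail_alt_terminal _ _ _ a'_gt0 a'_le _ _ (orb_inv w)) ?orb_sorted //.
  exact: a'_gt0.
move=> u su ntu; rewrite orb_sorted //; last exact: a'_gt0.
by case: eqP => // uw; rewrite uw tw in ntu.
Qed.

(** The semistandard basis of the hook Weyl module, with [hook_tail] as dual basis. *)
Lemma hook_expand (x : hook_weyl n r a') :
  x = \sum_(w | terminal a' w) hook_class (orb_tensor w) *~ hook_tail w x.
Proof.
apply/eqP; rewrite -subr_eq0; apply/eqP.
apply: (@hook_eq0 _ _ _ a'_gt0 a'_le) => v tv.
have MZ (y : hook_weyl n r a') z : hook_tail v (y *~ z) = hook_tail v y * z.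
  by rewrite -[z in RHS]intz mulrzr; apply: raddfMz.
have sumE : hook_tail v (\sum_(w | terminal a' w)
    hook_class (orb_tensor w) *~ hook_tail w x) =
    \sum_(w | terminal a' w) hook_tail v (hook_class (orb_tensor w) *~ hook_tail w x).
  exact: raddf_sum.
rewrite raddfB /= sumE (bigD1 v) //= MZ hook_tail_orb // eqxx mul1r.
rewrite big1 ?addr0 ?subrr // => w /andP[tw wv].
by rewrite MZ hook_tail_orb // eq_sym (negbTE wv) mul0r.
Qed.

End Relations.

(** * Cochains with values in the second hook module *)

Section Cochains.
Local Open Scope ring_scope.
Variables (n r a k' : nat).
Local Notation k := k'.+1.
Local Notation a' := (a + k)%N.
Hypotheses (a_gt0 : (0 < a)%N) (a'_le : (a' <= r)%N) (b_lt : (r - a < n)%N).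
Local Notation b := (r - a)%N.
Local Notation c := (r - a')%N.
Implicit Types (v w : mindex n r) (D K : {set 'I_b}).

Local Notation a_le := (leq_addr k a).
Local Notation a'_gt0 := (head_gt0 a_gt0 a_le).
Local Notation tailp := (tailp a'_gt0 a'_le).
Local Notation wcut := (wcut b_lt).
Local Notation cut_orbit := (cut_orbit b_lt).
Local Notation hook_tail := (hook_tail a'_gt0 a'_le).
Local Notation orb_tensor := (orb_tensor a_gt0 a_le a'_le).
Local Notation merge_op := (merge_op b_lt).
Local Notation wt_proj := (wt_proj b_lt).
Local Notation gen := (cube_gen b_lt).
Local Notation hom := (cube_hom b_lt).
Local Notation rel_coef := (@rel_coef n r a a').
Local Notation N := (hook_weyl n r a').

Lemma card_deg D : (#|D| + k == b)%N = (#|D| == c).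
Proof. by have := a'_le; lia. Qed.

Lemma proj_schur0 D : proj_schur b_lt D 0 = 0.
Proof.
have i0 : blk_inv D (tcoef (0 : tensor n r)) by move=> s _ w; rewrite !tcoef0.
have := proj_schur_linear b_lt 1 i0 i0; rewrite scaler0 addr0 mul1r.
by move/eqP; rewrite -[X in X == _]addr0 (inj_eq (addrI _)) eq_sym => /eqP.
Qed.

Lemma hom_gen i (u : {set 'I_b} -> N) D : (#|D| + i = b)%N ->
  hom (i := i) u (gen i D) = wt_proj D *: u D.
Proof.
move=> Db; rewrite /cube_hom (bigD1 D) ?Db //= cube_genE // eqxx big1 ?addr0 //.
move=> D' /andP[_ D'D]; rewrite cube_genE // (negbTE D'D) proj_schur0.
exact: scale0r.
Qed.

Lemma gen_weight i (f : {linear cube n r a i -> N}) D : (#|D| + i = b)%N ->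
  f (gen i D) = wt_proj D *: f (gen i D).
Proof. by move=> Db; rewrite {1}(cube_homE b_lt f) hom_gen. Qed.

Lemma hook_tail_gen i (f : {linear cube n r a i -> N}) D w : (#|D| + i = b)%N ->
  ~~ cut_orbit D w -> hook_tail w (f (gen i D)) = 0.
Proof.
move=> Db wD; rewrite (gen_weight f Db).
by rewrite (hook_tail_wt_proj a_gt0 a_le a'_le) (negbTE wD).
Qed.

Lemma linear_gen0 i (f : {linear cube n r a i -> N}) :
  (forall D, (#|D| + i = b)%N -> f (gen i D) = 0) -> forall x, f x = 0.
Proof.
move=> f0 x; rewrite (cube_homE b_lt f); apply: big1 => D /eqP Db.
by rewrite f0 // scaler0.
Qed.

(** Fewer than c cuts leave too few letters for a strictly increasing tail. Hence every cochain of
    degree k is a cocycle. *)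
Lemma linear_high_deg i (f : {linear cube n r a i -> N}) x : (k < i)%N -> f x = 0.
Proof.
move=> ki; apply: linear_gen0 => D Db.
apply: (@hook_eq0 _ _ _ a'_gt0 a'_le) => w tw; apply: hook_tail_gen => //.
apply/negP => wD; have := terminal_card a_gt0 a_le a'_le tw wD.
by have := a'_le; lia.
Qed.

Definition vtop D : mindex n r :=
  odflt (wcut D) [pick w | terminal a' w && cut_orbit D w].

Lemma vtopP D : #|D| = c -> terminal a' (vtop D) /\ cut_orbit D (vtop D).
Proof.
move=> Dc; rewrite /vtop; case: pickP => [w /andP[]//|none].
have [|//|//|w [tw wD _]] := terminal_ex a_gt0 a_le a'_le b_lt (D := D)
    (l := fun i : 'I_c.+1 => i : nat).
  by move=> i; rewrite Dc -ltnS.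
by have := none w; rewrite tw wD.
Qed.

Definition cvec (f : cube n r a k -> N) D : int := hook_tail (vtop D) (f (gen k D)).

Lemma cvec_eq0 (f : {linear cube n r a k -> N}) :
  (forall D, #|D| = c -> cvec f D = 0) -> forall x, f x = 0.
Proof.
move=> f0; apply: linear_gen0 => D Db.
have Dc : #|D| = c by apply/eqP; rewrite -card_deg Db.
apply: (@hook_eq0 _ _ _ a'_gt0 a'_le) => w tw.
have [wD|wD] := boolP (cut_orbit D w); last exact: hook_tail_gen.
have [tv vD] := vtopP Dc.
rewrite -(terminal_uniq a_gt0 a_le a'_le Dc tv tw vD wD).
exact: f0.
Qed.

Lemma cvec_hom (z : {set 'I_b} -> int) D : #|D| = c ->
  cvec (hom (fun D => hook_class (orb_tensor (vtop D)) *~ z D)) D = z D.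
Proof.
move=> Dc; have [tv vD] := vtopP Dc.
have Db : (#|D| + k = b)%N by apply/eqP; rewrite card_deg Dc.
rewrite /cvec hom_gen // (hook_tail_wt_proj a_gt0 a_le a'_le) vD.
rewrite raddfMz /= (hook_tail_orb a_gt0 a_le a'_le) // eqxx.
by rewrite -mulrzr mul1r intz.
Qed.

Lemma sum_remove (R : nmodType) K D (F : 'I_b -> R) :
  \sum_(j in K | K :\ j == D) F j =
  if [pick j in K | K :\ j == D] is Some j then F j else 0.
Proof.
case: pickP => [j /andP[jK /eqP jD]|none]; last by rewrite big_pred0.
rewrite (big_pred1 j) // => i; apply/andP/eqP => [[iK /eqP iD]|->]; last by rewrite jK jD.
apply/eqP; apply: contraTT isT => ij.
have : i \in K :\ j by rewrite !inE ij iK.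
by rewrite jD -iD !inE eqxx.
Qed.

Lemma cvec_bd (g : {linear cube n r a k' -> N}) D : #|D| = c ->
  cvec (g \o @cube_d n r a k') D =
  \sum_(K : {set 'I_b} | (#|K| + k' == b)%N) \sum_(j in K | K :\ j == D)
     csgn K j * hook_tail (vtop D) (merge_op K j *: g (gen k' K)).
Proof.
move=> Dc; have Db : (#|D| + k = b)%N by apply/eqP; rewrite card_deg Dc.
rewrite /cvec /= (cube_homE b_lt g) /cube_hom.
rewrite [LHS](raddf_sum (hook_tail (vtop D))); apply: eq_bigr => K _.
rewrite sum_remove ffunE.
rewrite (eq_bigr (fun j => if K :\ j == D then tbasis (wcut D) *~ csgn K j else 0)); last first.
  by move=> j _; rewrite cube_genE //; case: eqP => // _; rewrite mul0rz.
rewrite -big_mkcondr sum_remove; case: pickP => [j /andP[jK /eqP jD]|none]; last first.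
  by rewrite proj_schur0 scale0r raddf0.
have Ht : blk_inv K (tcoef (tbasis (wcut D))).
  by apply: blk_inv_sub (@wcut_inv _ _ _ b_lt D); rewrite -jD subsetDl.
have i0 : blk_inv K (tcoef (0 : tensor n r)) by move=> s _ w; rewrite !tcoef0.
(* The integer sign is read as a scalar of S(n,r) so that [proj_schur_linear] applies. *)
have -> : tbasis (wcut D) *~ csgn K j = (csgn K j)%:~R *: tbasis (wcut D) + 0 :> tensor n r.
  by rewrite addr0 scaler_int.
rewrite proj_schur_linear // proj_schur0 addr0 mulrzl -scalerMzl raddfMz /=.
by rewrite /merge_op jD -mulrzr mulrC intz.
Qed.

Lemma hook_tail_merge_coef K j w s : j \in K -> #|K| = c.+1 ->
  terminal a' w -> cut_orbit K w -> (0 < s <= c.+1)%N ->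
  (forall i, w (tailp i) = bump s i :> nat) ->
  csgn K j * hook_tail (vtop (K :\ j)) (merge_op K j *: hook_class (orb_tensor w)) =
  rel_coef K w s j.
Proof.
move=> jK Kc tw wK sb wE.
have [tv vD] : terminal a' (vtop (K :\ j)) /\ cut_orbit (K :\ j) (vtop (K :\ j)).
  by apply: vtopP; move: Kc; rewrite (cardsD1 j K) jK => -[].
by rewrite (hook_tail_merge jK Kc tv vD tw wK sb wE).
Qed.

Definition theta (f : cube n r a k -> N) : int :=
  \sum_(D : {set 'I_b} | #|D| == c) (weight D)%:R * cvec f D.

(** Expanding the values of [g] in the semistandard basis separates the coboundary into relations,
    one for each K and terminal word of its weight. *)
Lemma theta_bd (g : {linear cube n r a k' -> N}) :
  theta (g \o @cube_d n r a k') =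
  \sum_(K : {set 'I_b} | #|K| == c.+1) \sum_(w | terminal a' w && cut_orbit K w)
    hook_tail w (g (gen k' K)) * \sum_(j in K) (weight (K :\ j))%:R *
      (csgn K j * hook_tail (vtop (K :\ j)) (merge_op K j *: hook_class (orb_tensor w))).
Proof.
have cardK K : (#|K| + k' == b)%N = (#|K| == c.+1) by have := a'_le; lia.
transitivity (\sum_(K : {set 'I_b} | #|K| == c.+1) \sum_(j in K)
    (weight (K :\ j))%:R * (csgn K j *
      hook_tail (vtop (K :\ j)) (merge_op K j *: g (gen k' K)))).
  rewrite /theta; under eq_bigr => D /eqP Dc do
    rewrite cvec_bd // (eq_bigl _ _ cardK) mulr_sumr.
  rewrite exchange_big; apply: eq_bigr => K /eqP Kc /=.
  under eq_bigr do rewrite mulr_sumr.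
  rewrite (exchange_big_dep (mem K)) /=; last by move=> D j _ /andP[].
  apply: eq_bigr => j jK; rewrite (big_pred1 (K :\ j)) // => D.
  rewrite jK /= eq_sym; apply/andP/eqP => [[_ /eqP//]|->]; split=> //.
  by move: Kc; rewrite (cardsD1 j K) jK add1n => -[->].
apply: eq_bigr => K; rewrite -cardK => /eqP Kb.
under [RHS]eq_bigr do rewrite mulr_sumr.
rewrite exchange_big /=; apply: eq_bigr => j jK.
rewrite {1}(hook_expand a_gt0 a_le a'_le (g (gen k' K))).
rewrite scaler_sumr [hook_tail _ _](raddf_sum (hook_tail (vtop (K :\ j)))) /=.
rewrite !mulr_sumr (bigID (cut_orbit K)) /= [X in _ + X]big1 ?addr0 => [|w /andP[tw wK]].
  apply: eq_bigr => w _; rewrite -scalerMzr raddfMz /=.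
  by rewrite -[in LHS]mulrzr intz; ring.
by rewrite hook_tail_gen // mulr0z scaler0 raddf0 !mulr0.
Qed.

End Cochains.

(** * The cokernel *)

Definition gcd_bin r k := \big[gcdn/0]_(1 <= j < k.+1) 'C(r, j).

Lemma gcd_bin_dvd r k j : 0 < j <= k -> gcd_bin r k %| 'C(r, j).
Proof.
move=> jk; rewrite /gcd_bin (bigD1_seq j) ?iota_uniq //=; first exact: dvdn_gcdl.
by rewrite mem_index_iota ltnS.
Qed.

Lemma merge_sign_eq0 x s : 0 < s -> s.+1 < x -> merge_sign x.-1 s = 0%R.
Proof. by move=> s0 sx; rewrite /merge_sign !ifN //; lia. Qed.

Section IntervalCuts.
Variables (r a : nat).
Hypotheses (a_gt0 : 0 < a) (a_le : a <= r).
Local Notation b := (r - a).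

(** For lo < hi <= b this is the composition (a + lo, 1, ..., 1, b - hi + 1). *)
Definition cuts lo hi : {set 'I_b} := [set i : 'I_b | lo <= i < hi].

Lemma blk_cuts lo hi p : hi <= b -> a + lo <= p < a + hi -> blk (cuts lo hi) p = p.+1 - (a + lo).
Proof.
move=> hb /andP[lp ph]; have le : a + lo <= p.+1 by lia.
have mr : p.+1 - (a + lo) <= b - lo by lia.
rewrite /blk -[RHS]card_ord -cardsT.
have inb (x : 'I_(p.+1 - (a + lo))) : lo + x < b by have := ltn_ord x; lia.
have inj : injective (fun x => Ordinal (inb x)).
  by move=> x y /(congr1 val) /= /addnI /val_inj.
rewrite -(card_imset setT inj); apply: eq_card => i; rewrite !inE.
apply/idP/imsetP => [/andP[/andP[li ih] ip]|[x _ ->]] /=; last first.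
  by have := ltn_ord x; lia.
have xp : i - lo < p.+1 - (a + lo) by lia.
by exists (Ordinal xp) => //; apply: val_inj => /=; lia.
Qed.

Lemma card_cuts lo hi : lo <= hi -> hi <= b -> #|cuts lo hi| = hi - lo.
Proof.
move=> lh hb; case: (ltngtP lo hi) lh => // [lh _|-> _]; last first.
  by rewrite subnn; apply/eqP; rewrite cards_eq0; apply/eqP/setP => i; rewrite !inE; lia.
transitivity (blk (cuts lo hi) (a + hi.-1)); last by rewrite blk_cuts //; lia.
by apply: eq_card => i; rewrite !inE; lia.
Qed.

Lemma cumul_cuts lo hi l : hi <= b -> l < hi - lo -> cumul (cuts lo hi) l = a + (lo + l).
Proof.
move=> hb lt; have ib : lo + l < b by lia.
have iK : Ordinal ib \in cuts lo hi by rewrite inE /=; lia.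
have := cumul_cut a_gt0 a_le iK; rewrite blk_cuts //=; last by lia.
by rewrite (_ : ((a + (lo + l)).+1 - (a + lo)).-1 = l) //; lia.
Qed.

End IntervalCuts.

Section ExtCompute.
Local Open Scope ring_scope.
Variables (n r a k' : nat).
Local Notation k := k'.+1.
Local Notation a' := (a + k)%N.
Hypotheses (a_gt0 : (0 < a)%N) (a'_le : (a' <= r)%N) (b_lt : (r - a < n)%N).
Local Notation b := (r - a)%N.
Local Notation c := (r - a')%N.
Implicit Types (v w : mindex n r) (D K : {set 'I_b}).

Local Notation a_le := (leq_addr k a).
Local Notation a'_gt0 := (head_gt0 a_gt0 a_le).
Local Notation a_ler := (base_le a_le a'_le).
Local Notation tailp := (tailp a'_gt0 a'_le).
Local Notation cut_orbit := (cut_orbit b_lt).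
Local Notation orb_tensor := (orb_tensor a_gt0 a_le a'_le).
Local Notation wt_proj := (wt_proj b_lt).
Local Notation gen := (cube_gen b_lt).
Local Notation hom := (cube_hom b_lt).
Local Notation rel_coef := (@rel_coef n r a a').
Local Notation N := (hook_weyl n r a').
Local Notation cvec := (cvec a_gt0 a'_le b_lt).
Local Notation theta := (theta a_gt0 a'_le b_lt).
Local Notation vtop := (vtop k' b_lt).

Local Notation d := (gcd_bin r k).

Lemma cumul_ge_add D l : (l <= #|D|)%N -> (a + l <= cumul D l)%N.
Proof.
elim: l => [|l IH] lD; first by rewrite addn0 (cumul0_ge a_gt0 a_ler).
by rewrite addnS; apply: leq_ltn_trans (IH (ltnW lD)) (cumul_ltS a_gt0 a_ler lD).
Qed.

Lemma theta_bd_dvd (g : {linear cube n r a k' -> N}) :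
  (d %| theta (g \o @cube_d n r a k'))%Z.
Proof.
rewrite theta_bd; apply: rpred_sum => K /eqP Kc; apply: rpred_sum => w /andP[tw wK].
apply: dvdz_mull.
have [s sb wE] := terminal_tail_bump a_gt0 a_le a'_le Kc tw wK.
rewrite (eq_bigr (fun j => (weight (K :\ j))%:R * rel_coef K w s j)); last first.
  by move=> j jK; rewrite (hook_tail_merge_coef jK Kc tw wK sb wE).
rewrite (rel_weight Kc wK sb wE); case: ifP => _; last exact: dvdz0.
apply/dvdz_mulr/dvdz_mull.
(* The last block has r - N_c places, between 1 and k of them because a + c <= N_c < r and r - (a +
   c) = k. *)
have lt : (cumul K c < r)%N.
  by rewrite -[X in (_ < X)%N](cumul_max K) Kc; apply: (cumul_ltS a_gt0 a_ler); rewrite Kc.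
have ge : (a + c <= cumul K c)%N by apply: cumul_ge_add; rewrite Kc.
rewrite -(bin_sub (ltnW lt)) natz dvdzE /=.
by apply: gcd_bin_dvd; lia.
Qed.

Definition is_bd (z : {set 'I_b} -> int) :=
  exists g : {linear cube n r a k' -> N},
    forall D, #|D| = c -> cvec (g \o @cube_d n r a k') D = z D.

Lemma is_bd_ext z z' : (forall D, #|D| = c -> z D = z' D) -> is_bd z -> is_bd z'.
Proof. by move=> E [g Hg]; exists g => D Dc; rewrite Hg // E. Qed.

Lemma is_bd0 : is_bd (fun=> 0).
Proof. by exists \0 => D _; rewrite /cvec raddf0. Qed.

Lemma is_bdD z z' : is_bd z -> is_bd z' -> is_bd (fun D => z D + z' D).
Proof.
move=> [g Hg] [g' Hg']; exists (g \+ g') => D Dc; rewrite -Hg // -Hg' //.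
exact: raddfD.
Qed.

Lemma is_bdN z : is_bd z -> is_bd (fun D => - z D).
Proof.
move=> [g Hg]; exists (\0 \- g) => D Dc; rewrite -Hg //.
by rewrite /cvec /= sub0r raddfN.
Qed.

Lemma is_bdM m z : is_bd z -> is_bd (fun D => m * z D).
Proof.
move=> bz; have nat_case (x : nat) : is_bd (fun D => x%:Z * z D).
  elim: x => [|x IH]; first by apply: is_bd_ext is_bd0 => D _; rewrite mul0r.
  apply: is_bd_ext (is_bdD bz IH) => D _.
  by rewrite -addn1 PoszD mulrDl mul1r addrC.
case: m => x; first exact: nat_case.
apply: is_bd_ext (is_bdN (nat_case x.+1)) => D _.
by rewrite NegzE mulNr.
Qed.

Lemma is_bd_sum (I : Type) (l : seq I) (P : pred I) (F : I -> {set 'I_b} -> int) :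
  (forall i, P i -> is_bd (F i)) -> is_bd (fun D => \sum_(i <- l | P i) F i D).
Proof.
move=> H; elim: l => [|i l IH].
  by apply: is_bd_ext is_bd0 => D _; rewrite big_nil.
case Pi: (P i); last by apply: is_bd_ext IH => D _; rewrite big_cons Pi.
by apply: is_bd_ext (is_bdD (H i Pi) IH) => D _; rewrite big_cons Pi.
Qed.

Definition unit_vec D : {set 'I_b} -> int := fun D' => (D' == D)%:R.

(** The coboundary of the cochain whose only nonzero value is the class of [orb_tensor w] at K, a
    vector of the right weight. *)
Lemma is_bd_rel K s : #|K| = c.+1 -> (0 < s <= c.+1)%N ->
  exists w, [/\ terminal a' w, cut_orbit K w,
    forall i, w (tailp i) = bump s i :> nat &
    is_bd (fun D => \sum_(j in K) rel_coef K w s j * unit_vec (K :\ j) D)].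
Proof.
move=> Kc sb.
have [|||w [tw wK wE]] := terminal_ex a_gt0 a_le a'_le b_lt (D := K)
    (l := fun i : 'I_c.+1 => bump s i).
- by move=> i; rewrite Kc /bump; have := ltn_ord i; lia.
- by rewrite /bump /=; lia.
- by move=> i j; rewrite /bump; lia.
exists w; split=> //.
pose u K' : N := if K' == K then hook_class (orb_tensor w) else 0.
have Kb : (#|K| + k' = b)%N by have := a'_le; lia.
have uK : wt_proj K *: hook_class (orb_tensor w) = hook_class (orb_tensor w).
  apply/eqP; rewrite -subr_eq0; apply/eqP.
  apply: (@hook_eq0 _ _ _ a'_gt0 a'_le) => v tv.
  rewrite raddfB /= (hook_tail_wt_proj a_gt0 a_le a'_le) (hook_tail_orb a_gt0 a_le a'_le) //.
  case: ifPn => wv; first by rewrite subrr.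
  by case: eqP wv => [->|]; rewrite ?wK ?subrr.
exists (hom (i := k') u) => D Dc; rewrite cvec_bd //.
rewrite (bigD1 K) ?Kb //= [X in _ + X]big1 ?addr0 => [|K' /andP[/eqP K'b K'K]]; last first.
  rewrite big1 // => j _; rewrite hom_gen // /u (negbTE K'K) !scaler0.
  by rewrite raddf0 mulr0.
rewrite [RHS](bigID (fun j => K :\ j == D)) /= [X in _ = _ + X]big1 ?addr0; last first.
  by move=> j /andP[jK jD]; rewrite /unit_vec eq_sym (negbTE jD) mulr0.
apply: eq_bigr => j /andP[jK /eqP jD].
rewrite hom_gen // /u eqxx uK -jD (hook_tail_merge_coef jK Kc tw wK sb wE).
by rewrite /unit_vec eqxx mulr1.
Qed.

Definition lastcuts : {set 'I_b} := cuts r a k b.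

Lemma card_lastcuts : #|lastcuts| = c.
Proof. by rewrite card_cuts ?leqnn //; have := a'_le; lia. Qed.

Lemma weight_lastcuts : weight lastcuts = 1%N.
Proof.
rewrite /weight card_lastcuts /lam big_nat big1 // => i /andP[i0 ic].
have Ni l : (l <= c)%N -> cumul lastcuts l = (a + (k + l))%N.
  move=> lc; case: (ltngtP l c) lc => // [lc _|-> _].
    by rewrite cumul_cuts //; have := a'_le; lia.
  by rewrite -{1}card_lastcuts cumul_max; have := a'_le; lia.
rewrite !Ni; [|by lia|by lia].
by rewrite (_ : (a + (k + i)).-1 = (a + (k + i.-1))%N) ?binn //; lia.
Qed.

(* The relations with [s <= c] hold for the weights over the integers; those
   whose second merged block is a singleton have coefficient 1, so that they
   express a composition through compositions whose cuts lie further right. *)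
Lemma is_bd_unit D : #|D| = c ->
  is_bd (fun D' => unit_vec D D' - (weight D)%:R * unit_vec lastcuts D').
Proof.
(* Pushing cuts to the right raises their sum, which is bounded. *)
pose S D : nat := (\sum_(i in D) i)%N.
have Sb D0 : (S D0 <= b * b)%N.
  apply: (@leq_trans (\sum_(i in D0) b)%N); first by apply: leq_sum => i _; apply/ltnW/ltn_ord.
  by rewrite sum_nat_const leq_mul2r -[X in (_ <= X)%N]card_ord max_card orbT.
have [m] := ubnP (b * b - S D); elim: m D => // m IH D /ltnSE SD Dc.
have [->|DL] := eqVneq D lastcuts.
  by apply: is_bd_ext is_bd0 => D' _; rewrite weight_lastcuts mul1r subrr.
have [j0 j0L j0D] : exists2 j, j \in lastcuts & j \notin D.
  apply/subsetPn; apply: contra DL => LD.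
  by rewrite eq_sym eqEcard LD Dc card_lastcuts leqnn.
have [i0 i0D i0L] : exists2 i, i \in D & i \notin lastcuts.
  apply/subsetPn; apply: contra DL => LD.
  by rewrite eqEcard LD Dc card_lastcuts leqnn.
(* Adding the last missing cut j makes the place a + j a block of its own, since all later cuts are
   present. *)
have [j jD jmax] : exists2 j : 'I_b, j \notin D & forall i : 'I_b, i \notin D -> (i <= j)%N.
  by case: (@arg_maxnP _ j0 (fun j => j \notin D) (fun i : 'I_b => i : nat) j0D) => j jD jmax; exists j.
have i0j : (i0 < j)%N.
  apply: leq_trans (jmax _ j0D).
  by move: j0L i0L; rewrite !inE; have := ltn_ord i0; lia.
pose K := j |: D.
have jK : j \in K by rewrite setU11.
have KjD : K :\ j = D by rewrite setU1K.
have Kc : #|K| = c.+1 by rewrite cardsU1 jD Dc.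
pose s := (blk K (a + j)).-1.
have pos : (0 < blk K (a + j))%N by apply/card_gt0P; exists j; rewrite !inE eqxx leqnn.
have sS : blk K (a + j) = s.+1 by rewrite prednK.
have s0 : (0 < s)%N.
  rewrite -ltnS -sS; apply: leq_ltn_trans (_ : (0 < blk K (a + i0))%N) _.
    by apply/card_gt0P; exists i0; rewrite !inE i0D orbT leqnn.
  by rewrite (blk_cut a_ler) //; lia.
have sc : (s <= c)%N by rewrite -ltnS -sS -Kc blk_le_card.
have sb : (0 < s <= c.+1)%N by rewrite s0 leqW.
have [w [tw wK wE bd]] := is_bd_rel Kc sb.
have rw := rel_weight Kc wK sb wE.
rewrite (ltn_eqF (_ : (s < c.+1)%N)) // in rw.
(* The skipped letter [s] belongs to the block before the cut j. The letter s + 1 occurs once, in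
   the leg, so the binomial is 1. *)
have coef_j : rel_coef K w s j = csgn K j.
  rewrite /rel_coef sS /= /merge_sign eqxx /= mul1r.
  have := tail_count Kc wK sb wE (l := s.+1) sc.
  rewrite (gtn_eqF (ltnSn s)) addn1 (_ : [set p | _] = [set cutp j]) ?cards1.
    by case=> ->; rewrite bin0 mulr1.
  apply/setP => p; rewrite !inE -sS; apply/eqP/eqP => [E|->//].
  apply: val_inj => /=; case: (ltngtP p (a + j)%N) => // jp.
    by move: jp; rewrite -(blk_cut a_ler _ jK) E ltnn.
  have pb : (j.+1 < b)%N by rewrite ltn_subRL addnS; apply: leq_ltn_trans jp (ltn_ord p).
  have j1K : Ordinal pb \in K.
    rewrite !inE orbC; apply/orP; left; apply: contraT => /jmax /=.
    by rewrite ltnn.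
  have := blk_cut a_ler (a + j) j1K; rewrite /= ltn_add2l ltnSn => lt.
  have : (blk K (a + j.+1) <= blk K p)%N by apply: leq_blk; rewrite addnS.
  by rewrite E leqNgt lt.
have total : is_bd (fun D' => \sum_(i in K) rel_coef K w s i *
    (unit_vec (K :\ i) D' - (weight (K :\ i))%:R * unit_vec lastcuts D')).
  apply: is_bd_ext bd => D' _; rewrite [RHS](eq_bigr (fun i =>
     rel_coef K w s i * unit_vec (K :\ i) D' -
     ((weight (K :\ i))%:R * rel_coef K w s i) * unit_vec lastcuts D')).
    by rewrite sumrB -mulr_suml rw mul0r subr0.
  by move=> i _; rewrite mulrBr mulrCA mulrA.
have rest : is_bd (fun D' => \sum_(i in K | i != j) rel_coef K w s i *
    (unit_vec (K :\ i) D' - (weight (K :\ i))%:R * unit_vec lastcuts D')).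
  apply: is_bd_sum => i /andP[iK ij].
  have Kic : #|K :\ i| = c by move: Kc; rewrite (cardsD1 i K) iK add1n => -[].
  (* Removing a cut left of j instead of j raises the sum; a cut right of j has coefficient 0. *)
  case: (ltngtP i j) => [lt|gt|/val_inj E]; last by rewrite E eqxx in ij.
    apply: is_bdM; apply: IH => //.
    have E1 : S K = (i + S (K :\ i))%N by rewrite /S (big_setD1 i).
    have E2 : S K = (j + S D)%N by rewrite /S (big_setD1 j) //= KjD.
    move: (Sb (K :\ i)) SD; rewrite (_ : S (K :\ i) = (j - i + S D)%N).
      by move: lt; clear; lia.
    by apply: (@addnI i); rewrite -E1 E2 addnA subnKC // ltnW.
  apply: is_bd_ext is_bd0 => D' _; rewrite /rel_coef.
  have lt : (s.+1 < blk K (a + i))%N by rewrite -sS (blk_cut a_ler) // ltn_add2l.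
  by rewrite merge_sign_eq0 // mul0r mulr0 mul0r.
have single : is_bd (fun D' => csgn K j *
    (unit_vec D D' - (weight D)%:R * unit_vec lastcuts D')).
  apply: is_bd_ext (is_bdD total (is_bdN rest)) => D' _.
  by rewrite (bigD1 j) //= KjD coef_j addrK.
apply: is_bd_ext (is_bdM (csgn K j) single) => D' _.
by rewrite mulrA csgnM mul1r.
Qed.

(** The relation skipping the last letter at (a + k - i, 1, ..., 1, i): the remaining factors of
    lambda are 1, and the last block of size i leaves C(r, i). *)
Lemma is_bd_bin i : (0 < i <= k)%N ->
  is_bd (fun D => 'C(r, i)%:R * unit_vec lastcuts D).
Proof.
move=> /andP[i0 ik]; pose K := cuts r a (k - i) (b - i).+1.
have ib : ((b - i).+1 <= b)%N by have := a'_le; lia.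
have Kc : #|K| = c.+1 by rewrite card_cuts //; have := a'_le; lia.
have sb : (0 < c.+1 <= c.+1)%N by rewrite leqnn.
have [w [tw wK wE bd]] := is_bd_rel Kc sb.
have rw := rel_weight Kc wK sb wE.
have Nl l : (l <= c)%N -> cumul K l = (a + (k - i + l))%N.
  by move=> lc; rewrite cumul_cuts //; have := a'_le; lia.
have prod1 : (\prod_(1 <= l < c.+1) 'C((cumul K l).-1, cumul K l.-1) = 1)%N.
  rewrite big_nat big1 // => l /andP[l0 lc]; rewrite !Nl; [|by lia|by lia].
  by rewrite (_ : (a + (k - i + l)).-1 = (a + (k - i + l.-1))%N) ?binn //; lia.
have binE : 'C(r, cumul K c) = 'C(r, i).
  rewrite Nl // (_ : (a + (k - i + c))%N = (r - i)%N) ?bin_sub //.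
    by have := a'_le; lia.
  by have := a'_le; lia.
rewrite eqxx prod1 mulr1 binE in rw.
(* Each generator in the relation is replaced by its weight times the last one, so the relation
   becomes the sum computed by [rel_weight]. *)
have total : is_bd (fun D' => \sum_(j in K) rel_coef K w c.+1 j *
    (unit_vec (K :\ j) D' - (weight (K :\ j))%:R * unit_vec lastcuts D')).
  apply: is_bd_sum => j jK; apply: is_bdM; apply: is_bd_unit.
  by move: Kc; rewrite (cardsD1 j K) jK add1n => -[].
apply: is_bd_ext (is_bdM ((-1) ^+ c) (is_bdD bd (is_bdN total))) => D' _.
rewrite -sumrB (eq_bigr (fun j =>
   ((weight (K :\ j))%:R * rel_coef K w c.+1 j) * unit_vec lastcuts D')).
  by rewrite -mulr_suml rw !mulrA -expr2 sqrr_sign mul1r.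
by move=> j _; rewrite mulrBr opprB addrC subrK mulrCA mulrA.
Qed.

Lemma is_bd_gcd : is_bd (fun D => d%:R * unit_vec lastcuts D).
Proof.
rewrite /gcd_bin big_nat.
apply: (big_ind (fun m : nat => is_bd (fun D => m%:R * unit_vec lastcuts D))).
- by apply: is_bd_ext is_bd0 => D _; rewrite mul0r.
- move=> x y bx by_; have [u [v E]] := Bezoutz x y.
  apply: is_bd_ext (is_bdD (is_bdM u bx) (is_bdM v by_)) => D _.
  by rewrite !mulrA -mulrDl !pmulrn !intz E.
- by move=> i; rewrite ltnS; apply: is_bd_bin.
Qed.

(** Modulo coboundaries, [cvec f] is [theta f] times the vector of [lastcuts], and d times that
    vector is a coboundary. *)
Lemma theta_dvd_is_bd (f : cube n r a k -> N) : (d %| theta f)%Z -> is_bd (cvec f).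
Proof.
move=> /dvdzP[q Eq].
have H1 : is_bd (fun D' => \sum_(D : {set 'I_b} | #|D| == c) cvec f D *
    (unit_vec D D' - (weight D)%:R * unit_vec lastcuts D')).
  by apply: is_bd_sum => D /eqP Dc; apply/is_bdM/is_bd_unit.
apply: is_bd_ext (is_bdD H1 (is_bdM q is_bd_gcd)) => D' Dc'.
have Eq' : q * d%:R = theta f by rewrite natz -Eq.
rewrite mulrA Eq' /theta mulr_suml -big_split /=.
rewrite (bigD1 D') ?Dc' //= big1 ?addr0 => [|D /andP[_ DD']].
  have -> : unit_vec D' D' = 1 by rewrite /unit_vec eqxx.
  by move: (unit_vec _ _) (_%:R) (cvec f D') => x y z; ring.
have -> : unit_vec D D' = 0 by rewrite /unit_vec eq_sym (negbTE DD').
by move: (unit_vec _ _) (_%:R) (cvec f D) => x y z; ring.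
Qed.

Local Notation Q := (cube_resolution a_gt0 a_ler b_lt).

Definition theta_class (f : cocycle Q N k) : int := theta (cocycle_fun f).

Fact theta_class_is_zmod_morphism : zmod_morphism theta_class.
Proof.
move=> f g; rewrite /theta_class /theta -sumrB; apply: eq_bigr => D _.
by rewrite -mulrBr; congr (_ * _); rewrite -[RHS]raddfB.
Qed.
HB.instance Definition _ := GRing.isZmodMorphism.Build (cocycle Q N k) int
  theta_class theta_class_is_zmod_morphism.

Lemma theta_class_coboundary (f : cocycle Q N k) :
  (d %| theta_class f)%Z = (f \in @coboundaries _ _ Q N k).
Proof.
have /asboolP[fl fd] := valP f.
pose fM := GRing.isLinear.Build (schur n r) (cube n r a k) N *:%R (cocycle_fun f) fl.
pose fL : {linear cube n r a k -> N} := HB.pack (cocycle_fun f) fM.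
apply/idP/asboolP => [|[g Hg]].
  move=> /theta_dvd_is_bd[g Hg]; exists g => x.
  apply/eqP; rewrite -subr_eq0; apply/eqP.
  pose h : {linear cube n r a k -> N} := fL \- (g \o @cube_d n r a k').
  have := @cvec_eq0 n r a k' a_gt0 a'_le b_lt h.
  rewrite -[cocycle_fun f x - _]/(h x); apply => D Dc.
  rewrite /cvec -[h _]/(fL (gen k D) - (g \o @cube_d n r a k') (gen k D)).
  by rewrite raddfB; apply/eqP; rewrite subr_eq0; apply/eqP/esym/Hg.
have -> : theta_class f = theta (g \o @cube_d n r a k').
  by congr theta; apply/funext => x; apply: Hg.
exact: theta_bd_dvd.
Qed.

(** Multiples of the generator at [lastcuts], of weight 1, suffice; they are cocycles by
    [linear_high_deg]. *)
Lemma theta_class_surj z : exists f, theta_class f = z.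
Proof.
pose u D : N := hook_class (orb_tensor (vtop D)) *~ (z * unit_vec lastcuts D).
have Hf : hom (i := k) u \in @cocycles _ _ Q N k.
  apply/asboolP; split; first exact: linearP.
  move=> x; pose g : {linear cube n r a k.+1 -> N} := hom (i := k) u \o @cube_d n r a k.
  exact: (linear_high_deg a_gt0 a'_le b_lt g x (ltnSn k)).
exists (Cocycle Hf); rewrite /theta_class /theta (bigD1 lastcuts) ?card_lastcuts //=.
rewrite weight_lastcuts mul1r (cvec_hom _ _ _ (fun D => z * unit_vec lastcuts D)) ?card_lastcuts //.
rewrite /unit_vec eqxx mulr1 big1 ?addr0 // => D /andP[/eqP Dc DL].
by rewrite (cvec_hom _ _ _ (fun D => z * unit_vec lastcuts D)) // /unit_vec (negbTE DL) !mulr0.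
Qed.

Local Open Scope quotient_scope.

Lemma ext_cube : zmod_iso (ext Q N k) (Zmod d).
Proof.
pose U := [the zmodClosed _ of @coboundaries _ _ Q N k].
pose h : {additive cocycle Q N k -> Zmod d} := \pi_(Zmod d) \o theta_class.
apply: (@first_iso _ _ U h) => [f|y].
  rewrite -theta_class_coboundary.
  rewrite -[h f]/(\pi_(Zmod d) (theta_class f)) -(raddf0 \pi_(Zmod d)).
  by rewrite -Quotient.idealrBE subr0.
have [f Ef] := theta_class_surj (repr y).
by exists f; rewrite -[LHS]/(\pi_(Zmod d) (theta_class f)) Ef reprK.
Qed.

End ExtCompute.

Local Open Scope nat_scope.

Theorem theorem4p1 (n a b k : nat) (ha : 1 <= a) (hk : 1 <= k <= b)
    (hn : b + 1 <= n) (P : proj_resolution (hook_weyl n (a + b) a)) :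
  zmod_iso (ext P (hook_weyl n (a + b) (a + k)) k)
           (Zmod (\big[gcdn/0]_(1 <= j < k.+1) 'C(a + b, j))).
Proof.
case: k hk => // k' /andP[_ kb].
have a'_le : a + k'.+1 <= a + b by rewrite leq_add2l.
have b_lt : a + b - a < n by rewrite addKn -addn1.
exact: zmod_iso_trans (ext_iso P _ _ _) (ext_cube ha a'_le b_lt).
Qed.
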